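(* If $s,s'\in\mathbb R$ and $k,k'\in\mathbb N$ are such that $s+2k>0$ and $s'+2k'>0$, then $U_s$ and $U_{s'}$, as unitary representations of $\mathrm{Aff}(\mathbb C_+)$ in $\widehat{\mathcal A}_{s,k}$ and $\widehat{\mathcal A}_{s',k'}$, respectively, are unitarily equivalent. If $(s,k),(s',k')\in\big((0,\infty)\times\{0\}\big)\cup\{(-h,1+h):h\in\mathbb N\}$, then the unitary representations $\widetilde U_s$ and $\widetilde U_{s'}$ of $\widetilde{\mathrm{Aut}}(\mathbb C_+)$ in $\widehat{\mathcal A}_{s,k}$ and $\widehat{\mathcal A}_{s',k'}$, respectively, are unitarily equivalent if and only if $s=s'$, or $s'=s+2k$, or $s=s'+2k'$.
   Context: $\mathbb N=\{0,1,2,\dots\}$. $\mathbb C_+$ is the upper half-plane; $\mathrm{Hol}(\mathbb C_+)$ is the space of holomorphic functions on it. $\mathrm{Aff}(\mathbb C_+)=\{z\mapsto Rz+x:R>0,x\in\mathbb R\}$, and $U_s(\varphi)f=(f\circ\varphi^{-1})\,|(\varphi^{-1})'(i)|^{s/2}$ for $\varphi\in\mathrm{Aff}(\mathbb C_+)$. $\widetilde{\mathrm{Aut}}(\mathbb C_+)$ is the universal covering group of the group of biholomorphisms of $\mathbb C_+$, acting on $\mathbb C_+$ through that group; $\widetilde U_s(\varphi)f=(f\circ\varphi^{-1})\,(J\varphi^{-1})^{s/2}$, where $J\varphi^{-1}=(\varphi^{-1})'$ and $(\varphi,z)\mapsto(J\varphi^{-1})^{s/2}(z)$ is the branch of the power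 which is continuous on $\widetilde{\mathrm{Aut}}(\mathbb C_+)\times\mathbb C_+$ and equals $1$ at (identity, $i$). For $s\ge0$, $\mathcal A_s$ is the reproducing kernel Hilbert space of holomorphic functions on $\mathbb C_+$ with reproducing kernel $(z,z')\mapsto\left(\frac{z-\overline{z'}}{2i}\right)^{-s}$ (principal power). For $s+2k\ge0$, $\mathcal A_{s,k}=\{f\in\mathrm{Hol}(\mathbb C_+):f^{(k)}\in\mathcal A_{s+2k}\}$ with the seminorm $f\mapsto\|f^{(k)}\|_{\mathcal A_{s+2k}}$, and $\widehat{\mathcal A}_{s,k}$ is the associated Hilbert space, i.e. the quotient of $\mathcal A_{s,k}$ by the space of polynomials of degree $<k$. The space $\mathcal A_{s,k}$ and its seminorm are invariant under $U_s$ on $\mathrm{Aff}(\mathbb C_+)$ (whenever $s+2k\ge0$) and under $\widetilde U_s$ on $\widetilde{\mathrm{Aut}}(\mathbb C_+)$ (for $(s,k)$ in the set of the second assertion), so these induce unitary representations in $\widehat{\mathcal A}_{s,k}$. *)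

(* Defs.v *)
From HB Require Import structures.
From mathcomp Require Import all_boot all_order all_algebra.
From mathcomp Require Import all_classical all_reals all_analysis.
From mathcomp Require Import complex ring.
Import numFieldNormedType.Exports.
Set Implicit Arguments.
Unset Strict Implicit.
Unset Printing Implicit Defensive.
Import Order.TTheory GRing.Theory Num.Theory.
Local Open Scope classical_set_scope.
Local Open Scope ring_scope.

(* R[i] itself carries no canonical topology: it is packaged as a numFieldType
   so as to inherit the one given by its norm. Derivatives over this field are
   complex derivatives. *)
Definition cplx (R : realType) : numFieldType := R[i].

Definition ofR (R : realType) (x : R) : cplx R := (x%:C)%C.

Definition cabs (R : realType) (w : cplx R) : R := complex.Re `|w|.

Definition cexp (R : realType) (w : cplx R) : cplx R :=
  ofR (expR (complex.Re w))
  * (cos (complex.Im w) +i* sin (complex.Im w))%C.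

(* The principal argument, in ]-pi, pi]. *)
Definition carg (R : realType) (w : cplx R) : R :=
  if 0 <= complex.Im w then acos (complex.Re w / cabs w)
  else - acos (complex.Re w / cabs w).

Definition clog (R : realType) (w : cplx R) : cplx R :=
  (ln (cabs w) +i* carg w)%C.

(* Principal power; only meant for w != 0. *)
Definition cpow (R : realType) (w : cplx R) (a : R) : cplx R :=
  cexp (ofR a * clog w).

Definition cpow_values (R : realType) (w : cplx R) (a : R) : set (cplx R) :=
  [set cexp (ofR a * l) | l in [set l | cexp l = w]].

Definition uhp (R : realType) : topologicalType :=
  set_type [set z : cplx R | 0 < complex.Im z].

Definition uhp_val (R : realType) (z : uhp R) : cplx R := set_val z.

Lemma uhp_val_gt0 (R : realType) (z : uhp R) : 0 < complex.Im (uhp_val z).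
Proof. exact: (set_mem (svalP z)). Qed.

Definition to_uhp (R : realType) (z : cplx R) (hz : 0 < complex.Im z) : uhp R :=
  exist _ z (mem_set hz).

Definition uhp_i (R : realType) : uhp R :=
  @to_uhp R ('i)%C ltr01.

Definition hfun (R : realType) : Type := uhp R -> cplx R.

(* The extension of f by 0 outside of the (open) half-plane; derivatives at
   points of the half-plane do not depend on the values outside. *)
Definition ext (R : realType) (f : hfun R) : cplx R -> cplx R :=
  fun z => if pselect (0 < complex.Im z) is left hz then f (to_uhp hz) else 0.

Definition holomorphic (R : realType) (f : hfun R) : Prop :=
  forall z : uhp R, derivable (ext f) (uhp_val z) 1.

Definition hderiv (R : realType) (f : hfun R) : hfun R :=
  fun z => derive1 (ext f) (uhp_val z).

Definition jac (R : realType) (phi : uhp R -> uhp R) : hfun R :=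
  hderiv (fun z => uhp_val (phi z)).

Definition biholomorphism (R : realType) (phi : uhp R -> uhp R) : Prop :=
  holomorphic (fun z => uhp_val (phi z)) /\
  exists psi : uhp R -> uhp R,
    [/\ cancel phi psi, cancel psi phi & holomorphic (fun z => uhp_val (psi z))].

(* A space of functions together with a sesquilinear form, linear in its first
   argument, which is only relevant on elements of the space. *)
Record fspace (R : realType) := FSpace {
  fs_mem :> hfun R -> Prop;
  fs_ip : hfun R -> hfun R -> cplx R }.

Definition lincomb (R : realType) (a : cplx R) (f g : hfun R) : hfun R :=
  fun z => a * f z + g z.

Definition fs_norm (R : realType) (H : fspace R) (f : hfun R) : R :=
  Num.sqrt (complex.Re (fs_ip H f f)).

Definition fs_dist (R : realType) (H : fspace R) (f g : hfun R) : R :=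
  fs_norm H (lincomb (-1) g f).

Definition is_hilbert (R : realType) (H : fspace R) : Prop :=
  [/\ H (fun=> 0) /\ (forall a f g, H f -> H g -> H (lincomb a f g)),
      (forall a f g h, H f -> H g -> H h ->
        fs_ip H (lincomb a f g) h = a * fs_ip H f h + fs_ip H g h),
      (forall f g, H f -> H g -> fs_ip H g f = ((fs_ip H f g)^*)%C),
      (forall f, H f ->
        0 <= fs_ip H f f /\ (fs_ip H f f = 0 -> f = fun=> 0)) &
      (forall u : nat -> hfun R, (forall n, H (u n)) ->
        (forall e : R, 0 < e -> exists N : nat, forall m n : nat,
          (N <= m)%N -> (N <= n)%N -> fs_dist H (u m) (u n) < e) ->
        exists2 f, H f & (fun n => fs_dist H (u n) f) @ \oo --> (0 : R))].

Definition is_rkhs (R : realType) (H : fspace R)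
    (K : uhp R -> uhp R -> cplx R) : Prop :=
  [/\ is_hilbert H,
      (forall f, H f -> holomorphic f),
      (forall w, H (fun z => K z w)) &
      (forall f w, H f -> f w = fs_ip H f (fun z => K z w))].

Definition kern (R : realType) (s : R) (z w : uhp R) : cplx R :=
  cpow ((uhp_val z - ((uhp_val w)^*)%C) / (2 * ('i)%C)) (- s).

(* A_{s,k} with the sesquilinear form of its seminorm, the spaces A_s being
   given by the argument A. *)
Definition Ask (R : realType) (A : R -> fspace R) (s : R) (k : nat) :
    fspace R :=
  FSpace
    [set f | holomorphic f /\ A (s + 2 * k%:R) (iter k (@hderiv R) f)]
    (fun f g => fs_ip (A (s + 2 * k%:R))
                  (iter k (@hderiv R) f) (iter k (@hderiv R) g)).

Definition polys (R : realType) (k : nat) : set (hfun R) :=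
  [set f | exists2 p : {poly cplx R},
             (size p <= k)%N & f = fun z => p.[uhp_val z]].

Definition coset (R : realType) (k : nat) (f : hfun R) : set (hfun R) :=
  [set lincomb 1 f q | q in @polys R k].

Definition hatsp (R : realType) (k : nat) (E : fspace R) : set (set (hfun R)) :=
  [set coset k f | f in [set f | E f]].

Definition set_lincomb (R : realType) (a : cplx R) (X Y : set (hfun R)) :
    set (hfun R) :=
  [set lincomb a f g | f in X & g in Y].

(* Unitary equivalence of the representations induced by U and U' in the
   quotients of E and E' by the polynomials of degree < k, resp. < k'; U and U'
   act on a coset as on a set of functions, and T is a bijective linear
   isometry between the quotients. *)
Definition unitarily_equivalent (R : realType) (G : Type)
    (k : nat) (E : fspace R) (U : G -> hfun R -> hfun R)
    (k' : nat) (E' : fspace R) (U' : G -> hfun R -> hfun R) : Prop :=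
  exists T : set (hfun R) -> set (hfun R),
    [/\ set_bij (hatsp k E) (hatsp k' E') T,
        (forall a X Y, hatsp k E X -> hatsp k E Y ->
          T (set_lincomb a X Y) = set_lincomb a (T X) (T Y)),
        (forall X Y, hatsp k E X -> hatsp k E Y ->
          forall f g f' g', X f -> Y g -> T X f' -> T Y g' ->
          fs_ip E' f' g' = fs_ip E f g) &
        (forall x X, hatsp k E X -> T (U x @` X) = U' x @` (T X))].

Record aff (R : realType) := Aff {
  aff_scale : R;
  aff_shift : R;
  aff_scale_gt0 : 0 < aff_scale }.

Lemma aff_act_subproof (R : realType) (phi : aff R) (z : uhp R) :
  0 < complex.Im (ofR (aff_scale phi) * uhp_val z + ofR (aff_shift phi)).
Proof.
case: phi => a b a0; have := uhp_val_gt0 z.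
by case: (uhp_val z) => x y /= y0; rewrite mul0r !addr0 mulr_gt0.
Qed.

Definition aff_act (R : realType) (phi : aff R) (z : uhp R) : uhp R :=
  to_uhp (aff_act_subproof phi z).

Lemma aff_inv_subproof (R : realType) (phi : aff R) : 0 < (aff_scale phi)^-1.
Proof. by rewrite invr_gt0 aff_scale_gt0. Qed.

Definition aff_inv (R : realType) (phi : aff R) : aff R :=
  Aff (- (aff_shift phi / aff_scale phi)) (aff_inv_subproof phi).

Lemma aff_actK (R : realType) (phi : aff R) :
  cancel (aff_act phi) (aff_act (aff_inv phi)).
Proof.
move=> z; apply: val_inj; have an0 := lt0r_neq0 (aff_scale_gt0 phi).
change (ofR (aff_scale phi)^-1
  * (ofR (aff_scale phi) * uhp_val z + ofR (aff_shift phi))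
  + ofR (- (aff_shift phi / aff_scale phi)) = uhp_val z).
case: (uhp_val z) => x y; congr (_ +i* _)%C => /=; first by field.
by field.
Qed.

Lemma aff_actKV (R : realType) (phi : aff R) :
  cancel (aff_act (aff_inv phi)) (aff_act phi).
Proof.
move=> z; apply: val_inj; have an0 := lt0r_neq0 (aff_scale_gt0 phi).
change (ofR (aff_scale phi)
  * (ofR (aff_scale phi)^-1 * uhp_val z
     + ofR (- (aff_shift phi / aff_scale phi)))
  + ofR (aff_shift phi) = uhp_val z).
case: (uhp_val z) => x y; congr (_ +i* _)%C => /=; first by field.
by field.
Qed.

Definition Uaff (R : realType) (s : R) (phi : aff R) (f : hfun R) : hfun R :=
  fun z => f (aff_act (aff_inv phi) z)
           * ofR (cabs (jac (aff_act (aff_inv phi)) (uhp_i R)) `^ (s / 2)).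

HB.mixin Record isTopGroup G & Topological G & Group G := {
  mulg_continuous : continuous (fun x : G * G => (x.1 * x.2)%g);
  invg_continuous : continuous (fun x : G => (x^-1)%g) }.

#[short(type="topGroupType")]
HB.structure Definition TopGroup := {G of isTopGroup G & Topological G & Group G}.

Definition simply_connected (R : realType) (T : topologicalType) : Prop :=
  (forall x y : T, exists c : R -> T,
     [/\ {within `[0, 1], continuous c}, c 0 = x & c 1 = y]) /\
  (forall c : R -> T, {within `[0, 1], continuous c} -> c 0 = c 1 ->
     exists H : R * R -> T,
       [/\ {within `[0, 1] `*` `[0, 1], continuous H},
           (forall t, t \in `[0, 1] -> H (0, t) = c t),
           (forall t, t \in `[0, 1] -> H (1, t) = c 0) &
           (forall r, r \in `[0, 1] -> H (r, 0) = c 0 /\ H (r, 1) = c 0)]).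

(* p is a covering map from E onto its range, with the subspace topology. *)
Definition covering_onto_range (E B : topologicalType) (p : E -> B) : Prop :=
  continuous p /\
  forall b, range p b -> exists U : set B,
    [/\ open U, U b &
      exists (I : Type) (V : I -> set E),
        [/\ (forall i, open (V i)), trivIset setT V,
            p @^-1` U = \bigcup_i V i &
            forall i, set_bij (V i) (U `&` range p) p /\
              forall W, open W -> W `<=` V i ->
                exists2 O : set B, open O & p @` W = O `&` range p]].

(* p : G -> Aut(C_+) is the universal covering group of the group Aut(C_+) of
   biholomorphisms, endowed with the compact-open topology. *)
Definition universal_covering_Aut (R : realType) (G : topGroupType)
    (p : G -> uhp R -> uhp R) : Prop :=
  [/\ range p = [set phi | biholomorphism phi],
      (forall g h, p (g * h)%g = p g \o p h),
      covering_onto_range (p : G -> {compact-open, uhp R -> uhp R}) &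
      simply_connected R G].

(* j is (g, z) |-> (J g^-1)^(s/2)(z): the branch of the power that is continuous
   on G * C_+ and takes the value 1 at (1, i). *)
Definition is_Jpow (R : realType) (G : topGroupType) (p : G -> uhp R -> uhp R)
    (s : R) (j : G -> uhp R -> cplx R) : Prop :=
  [/\ continuous (fun x : G * uhp R => j x.1 x.2),
      j 1%g (uhp_i R) = 1 &
      forall g z, cpow_values (jac (p (g^-1)%g) z) (s / 2) (j g z)].

Definition Ucov (R : realType) (G : topGroupType) (p : G -> uhp R -> uhp R)
    (j : G -> uhp R -> cplx R) (g : G) (f : hfun R) : hfun R :=
  fun z => f (p (g^-1)%g z) * j g z.

Definition admissible (R : realType) (s : R) (k : nat) : Prop :=
  (0 < s /\ k = 0%N) \/ exists h : nat, s = - h%:R /\ k = h.+1.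

(* Main.v *)
Require Import Defs.
From HB Require Import structures.
From mathcomp Require Import all_boot all_order all_algebra.
From mathcomp Require Import all_classical all_reals all_analysis.
From mathcomp Require Import complex ring lra.
Import numFieldNormedType.Exports.
Set Implicit Arguments.
Unset Strict Implicit.
Unset Printing Implicit Defensive.
Import Order.TTheory GRing.Theory Num.Theory.
Local Open Scope classical_set_scope.
Local Open Scope ring_scope.

(* The [k]-th derivative identifies the quotient of A_{s,k} with A_{s+2k} and U_s with U_{s+2k}, so
   the affine statement says that the representations in A_s and A_{s'} are equivalent for all
   s, s' > 0. For s' < s, fractional integration along vertical half-lines is a bounded functional on
   A_s at every point of the half-plane. The Gram matrix of its Riesz vectors is holomorphic and
   homogeneous under the affine group, which forces it to be a multiple of the kernel of A_{s'}; this
   yields an intertwining isometry of A_{s'} into A_s, and the same argument applied to its adjoint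
   shows that it is onto.

   For the covering group, the Schwarz lemma shows that an automorphism [phi] satisfies
   [phi' = q^-2] for some linear [q] with [(phi z - conj (phi w)) q(z) conj (q(w)) = z - conj w]. Bol's
   lemma, [(q^(k-1) f o phi)^(k) = q^(-k-1) f^(k) o phi], then reduces again to k = 0. The branches are
   compared through ratios with countable range, which are constant on connected spaces. Finally, an
   equivalence between A_s and A_{s'} maps the kernel at [i] to an eigenvector of the stabilizer of
   [i]; its quotient by the kernel of A_{s'} is a holomorphic function homogeneous of degree
   (s - s')/2 under rotations about [i], whence s' <= s, and equality by symmetry. *)

(** * Complex numbers *)

(** The spaces [A s] are given only through their reproducing kernels, so norms are never explicit
    integrals: operators are built from images of kernel functions with a prescribed Gram matrix,
    and identities between isometries are tested on kernels. Since the affine group is transitive on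
    the half-plane, homogeneity fixes a sesquiholomorphic kernel up to a scalar; the fractional
    integral therefore never has to be computed, only shown not to vanish. For [s = -h] and
    [k = h + 1] the multiplier of weight [s] is, up to sign, the polynomial [q^h], and the [k]-th
    derivative turns it into [q^(-h-2)], of weight [s + 2k = h + 2]. The number [s + 2k] is the only
    invariant left. Lifts of rotations to the covering group are never described: an unknown lift
    changes a logarithm of the Jacobian by a multiple of [2 pi i], and the resulting integer is
    disposed of by continuity and countability. The function theory rests on rectangles: integrals
    are differences of antiderivatives, and the value [2 pi i] in the Cauchy formula is replaced by
    the mere fact that the corresponding integral is not 0. *)

Section ComplexNumbers.
Context {R : realType}.
Local Notation C := (cplx R).
Local Notation Re := (@complex.Re R).
Local Notation Im := (@complex.Im R).

Definition ci : C := ('i)%C.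
Definition cconj (z : C) : C := (z^*)%C.

Lemma cplx_eq (z w : C) : Re z = Re w -> Im z = Im w -> z = w.
Proof. by case: z w => [a b] [c d] /= -> ->. Qed.

Lemma ReD (z w : C) : Re (z + w) = Re z + Re w. Proof. by case: z w => [? ?] []. Qed.
Lemma ImD (z w : C) : Im (z + w) = Im z + Im w. Proof. by case: z w => [? ?] []. Qed.
Lemma ReN (z : C) : Re (- z) = - Re z. Proof. by case: z. Qed.
Lemma ImN (z : C) : Im (- z) = - Im z. Proof. by case: z. Qed.
Lemma ReB (z w : C) : Re (z - w) = Re z - Re w. Proof. by rewrite ReD ReN. Qed.
Lemma ImB (z w : C) : Im (z - w) = Im z - Im w. Proof. by rewrite ImD ImN. Qed.
Lemma ReM (z w : C) : Re (z * w) = Re z * Re w - Im z * Im w.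
Proof. by case: z w => [? ?] []. Qed.
Lemma ImM (z w : C) : Im (z * w) = Re z * Im w + Im z * Re w.
Proof. by case: z w => [? ?] []. Qed.
Lemma Re_ofR (a : R) : Re (ofR a) = a. Proof. by []. Qed.
Lemma Im_ofR (a : R) : Im (ofR a) = 0. Proof. by []. Qed.
Lemma Re_ci : Re ci = 0. Proof. by []. Qed.
Lemma Im_ci : Im ci = 1. Proof. by []. Qed.
Lemma Re0 : Re 0 = 0. Proof. by []. Qed.
Lemma Im0 : Im 0 = 0. Proof. by []. Qed.
Lemma Re1 : Re 1 = 1. Proof. by []. Qed.
Lemma Im1 : Im 1 = 0. Proof. by []. Qed.
Lemma Re_conj (z : C) : Re (cconj z) = Re z. Proof. by case: z. Qed.
Lemma Im_conj (z : C) : Im (cconj z) = - Im z. Proof. by case: z. Qed.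

Definition ReImE := (ReD, ImD, ReN, ImN, ReM, ImM, Re_ofR, Im_ofR, Re_ci, Im_ci,
  Re0, Im0, Re1, Im1, Re_conj, Im_conj).

Lemma ofRD (a b : R) : ofR (a + b) = ofR a + ofR b.
Proof. by apply: cplx_eq; rewrite !ReImE ?addr0. Qed.
Lemma ofRN (a : R) : ofR (- a) = - ofR a.
Proof. by apply: cplx_eq; rewrite !ReImE ?oppr0. Qed.
Lemma ofRB (a b : R) : ofR (a - b) = ofR a - ofR b.
Proof. by rewrite ofRD ofRN. Qed.
Lemma ofRM (a b : R) : ofR (a * b) = ofR a * ofR b.
Proof. by apply: cplx_eq; rewrite !ReImE; ring. Qed.
Lemma ofR0 : ofR 0 = 0 :> C. Proof. by []. Qed.
Lemma ofR1 : ofR 1 = 1 :> C. Proof. by []. Qed.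
Lemma ofR_nat n : ofR n%:R = n%:R :> C.
Proof. by elim: n => // n IH; rewrite -natr1 ofRD IH ofR1 natr1. Qed.
Lemma ofR_inj : injective (@ofR R). Proof. by move=> a b []. Qed.
Lemma ofR_eq0 (a : R) : (ofR a == 0 :> C) = (a == 0).
Proof. by apply/eqP/eqP => [/ofR_inj//|->]. Qed.
Lemma ofRV (a : R) : ofR a^-1 = (ofR a)^-1.
Proof.
have [->|a0] := eqVneq a 0; first by rewrite !(invr0, ofR0).
have a0' : ofR a != 0 by rewrite ofR_eq0.
by apply: (mulfI a0'); rewrite -ofRM !divff.
Qed.

Lemma ciM : ci * ci = -1.
Proof. by apply: cplx_eq; rewrite !ReImE; ring. Qed.
Lemma ci_neq0 : ci != 0.
Proof. by apply/eqP => -[] /eqP; rewrite oner_eq0. Qed.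
Lemma cplxE (z : C) : z = ofR (Re z) + ci * ofR (Im z).
Proof. by apply: cplx_eq; rewrite !ReImE; ring. Qed.

Lemma cconjD (z w : C) : cconj (z + w) = cconj z + cconj w.
Proof. by apply: cplx_eq; rewrite !ReImE; ring. Qed.
Lemma cconjN (z : C) : cconj (- z) = - cconj z.
Proof. by apply: cplx_eq; rewrite !ReImE; ring. Qed.
Lemma cconjM (z w : C) : cconj (z * w) = cconj z * cconj w.
Proof. by apply: cplx_eq; rewrite !ReImE; ring. Qed.
Lemma cconjK : involutive cconj.
Proof. by move=> z; apply: cplx_eq; rewrite !ReImE ?opprK. Qed.
Lemma cconj_ofR (a : R) : cconj (ofR a) = ofR a.
Proof. by apply: cplx_eq; rewrite !ReImE ?oppr0. Qed.
Lemma cconj_i : cconj ci = - ci.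
Proof. by apply: cplx_eq; rewrite !ReImE ?oppr0. Qed.
Lemma cconj_inj : injective cconj. Proof. exact: inv_inj cconjK. Qed.
Lemma cconj1 : cconj 1 = 1. Proof. by rewrite -ofR1 cconj_ofR. Qed.
Lemma cconj0 : cconj 0 = 0. Proof. by rewrite -ofR0 cconj_ofR. Qed.
Lemma cconj_eq0 (z : C) : (cconj z == 0) = (z == 0).
Proof. by rewrite -[X in _ == X]cconj0 (inj_eq cconj_inj). Qed.
Lemma cconjV (z : C) : cconj z^-1 = (cconj z)^-1.
Proof.
have [->|z0] := eqVneq z 0; first by rewrite cconj0 !invr0 cconj0.
have z0' : cconj z != 0 by rewrite cconj_eq0.
by apply: (mulfI z0'); rewrite -cconjM !divff// cconj1.
Qed.
Lemma cconjX (z : C) n : cconj (z ^+ n) = cconj z ^+ n.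
Proof. by elim: n => [|n IH]; rewrite ?expr0 ?cconj1// !exprS cconjM IH. Qed.

Lemma cabsE (z : C) : `|z| = ofR (cabs z).
Proof. by rewrite /cabs normc_def. Qed.
Lemma cabs_sqrt (z : C) : cabs z = Num.sqrt (Re z ^+ 2 + Im z ^+ 2).
Proof. by rewrite /cabs normc_def. Qed.
Lemma cabs_ge0 (z : C) : 0 <= cabs z.
Proof. by rewrite cabs_sqrt sqrtr_ge0. Qed.
Lemma cabs_sq (z : C) : cabs z ^+ 2 = Re z ^+ 2 + Im z ^+ 2.
Proof. by rewrite cabs_sqrt sqr_sqrtr// addr_ge0 ?sqr_ge0. Qed.
Lemma cabsM (z w : C) : cabs (z * w) = cabs z * cabs w.
Proof. by apply: ofR_inj; rewrite ofRM -!cabsE normrM. Qed.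
Lemma cabs0 : cabs 0 = 0 :> R.
Proof. by apply: ofR_inj; rewrite -cabsE normr0. Qed.
Lemma cabs1 : cabs 1 = 1 :> R.
Proof. by apply: ofR_inj; rewrite -cabsE normr1. Qed.
Lemma cabsN (z : C) : cabs (- z) = cabs z.
Proof. by apply: ofR_inj; rewrite -!cabsE normrN. Qed.
Lemma cabsB (z w : C) : cabs (z - w) = cabs (w - z).
Proof. by rewrite -cabsN opprB. Qed.
Lemma cabs_eq0 (z : C) : (cabs z == 0) = (z == 0).
Proof. by rewrite -ofR_eq0 -cabsE normr_eq0. Qed.
Lemma cabs_gt0 (z : C) : (0 < cabs z) = (z != 0).
Proof. by rewrite lt_def cabs_ge0 andbT cabs_eq0. Qed.
Lemma cabsV (z : C) : cabs z^-1 = (cabs z)^-1.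
Proof. by apply: ofR_inj; rewrite ofRV -!cabsE normfV. Qed.
Lemma cabsX (z : C) n : cabs (z ^+ n) = cabs z ^+ n.
Proof. by elim: n => [|n IH]; rewrite ?expr0 ?cabs1// !exprS cabsM IH. Qed.
Lemma cabsD (z w : C) : cabs (z + w) <= cabs z + cabs w.
Proof. by rewrite -lecR -/(ofR _) -/(ofR _) ofRD -!cabsE ler_normD. Qed.
Lemma cabs_ofR (a : R) : cabs (ofR a) = `|a|.
Proof. by rewrite cabs_sqrt !ReImE expr0n addr0 sqrtr_sqr. Qed.
Lemma cabs_i : cabs ci = 1.
Proof. by rewrite cabs_sqrt !ReImE expr0n add0r expr1n sqrtr1. Qed.
Lemma cabs_conj (z : C) : cabs (cconj z) = cabs z.
Proof. by rewrite !cabs_sqrt !ReImE sqrrN. Qed.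
Lemma ler_Re_cabs (z : C) : `|Re z| <= cabs z.
Proof. by rewrite cabs_sqrt -sqrtr_sqr ler_wsqrtr// lerDl sqr_ge0. Qed.
Lemma ler_Im_cabs (z : C) : `|Im z| <= cabs z.
Proof. by rewrite cabs_sqrt -sqrtr_sqr ler_wsqrtr// lerDr sqr_ge0. Qed.
Lemma cabs_ReIm (z : C) : cabs z <= `|Re z| + `|Im z|.
Proof.
rewrite {1}(cplxE z); apply: le_trans (cabsD _ _) _.
by rewrite cabsM cabs_i mul1r !cabs_ofR.
Qed.
Lemma cabs_dist (z w : C) : `|cabs z - cabs w| <= cabs (z - w).
Proof.
have := cabsD (z - w) w; have := cabsD (w - z) z.
rewrite !subrK (cabsB w z) => h1 h2; rewrite ler_norml; lra.
Qed.
Lemma mul_cconj (z : C) : z * cconj z = ofR (cabs z ^+ 2).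
Proof. by rewrite cabs_sq; apply: cplx_eq; rewrite !ReImE; ring. Qed.

(** The radii of balls in [cplx R] are themselves elements of [cplx R]. Positivity in the order of
    [R[i]] includes having imaginary part 0, which is how real radii come in. *)
Lemma nbhs_cabsP (z : C) (P : set C) :
  nbhs z P <-> exists2 d : R, 0 < d & forall w, cabs (w - z) < d -> P w.
Proof.
split=> [/nbhs_ballP[e e0 he]|[d d0 hd]].
  have e0' : 0 < Re e.
    by move: e0; rewrite /= ltcE => /andP[].
  have eE : e = ofR (Re e).
    apply: cplx_eq => //; move: e0; rewrite /= ltcE => /andP[/eqP].
    by rewrite !ReImE.
  exists (Re e) => // w hw; apply: he; rewrite -ball_normE /ball_/= eE.
  by rewrite cabsE ltcR cabsB.
apply/nbhs_ballP; exists (ofR d); first by rewrite /= ltcR.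
move=> w; rewrite -ball_normE /ball_/= cabsE ltcR => hw.
by apply: hd; rewrite cabsB.
Qed.

Lemma cvgCP (T : Type) (F : set_system T) (FF : Filter F) (f : T -> C) (l : C) :
  f @ F --> l <-> forall e : R, 0 < e -> F [set x | cabs (f x - l) < e].
Proof.
split=> [h e e0|h P /nbhs_cabsP[d d0 hd]].
  by apply: (h [set w | cabs (w - l) < e]); apply/nbhs_cabsP; exists e.
rewrite nbhs_filterE /fmap /=; have := h d d0.
by apply: filterS => x /= hx; exact: hd.
Qed.

End ComplexNumbers.

(** * Derivatives on the half-plane *)

Section ComplexDerivative.
Context {R : realType}.
Local Notation C := (cplx R).
Local Notation Im := (@complex.Im R).

Lemma diff_quotient_epsP (F : C -> C) (z l : C) :
  (fun h => h^-1 *: ((F \o shift z) (h *: (1 : C)) - F z)) @ 0^' --> l <->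
  forall e : R, 0 < e -> exists2 d : R, 0 < d &
    forall w, cabs (w - z) < d -> cabs (F w - F z - l * (w - z)) <= e * cabs (w - z).
Proof.
have key (h : C) : h != 0 ->
    cabs (h^-1 *: ((F \o shift z) (h *: (1 : C)) - F z) - l) * cabs h
    = cabs (F (h + z) - F z - l * h).
  move=> h0; rewrite -cabsM; congr cabs.
  rewrite /GRing.scale /= mulr1 mulrBl; congr (_ - _).
  by rewrite mulrAC mulVf// mul1r.
rewrite cvgCP; split=> h e e0.
  have /nbhs_cabsP[d d0 hd] := h e e0; exists d => // w wz.
  have [->|wz0] := eqVneq w z; first by rewrite !subrr mulr0 subrr cabs0 mulr0.
  have w0 : w - z != 0 by rewrite subr_eq0.
  have := key (w - z) w0; rewrite subrK => <-.
  apply: ler_wpM2r; first exact: cabs_ge0.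
  by apply: ltW; apply: hd => //; rewrite subr0.
have [d d0 hd] := h (e / 2) (divr_gt0 e0 (ltr0n _ 2)).
apply/nbhs_cabsP; exists d => // w; rewrite subr0 => wd /= w0.
have := hd (w + z); rewrite addrK -(key w w0) => /(_ wd).
by rewrite ler_pM2r ?cabs_gt0// => hh; apply: le_lt_trans hh _; lra.
Qed.

Lemma is_derive_epsP (F : C -> C) (z l : C) :
  is_derive z 1 F l <-> forall e : R, 0 < e -> exists2 d : R, 0 < d &
    forall w, cabs (w - z) < d -> cabs (F w - F z - l * (w - z)) <= e * cabs (w - z).
Proof.
rewrite -diff_quotient_epsP; split=> [[df dfE]|h].
  by have := df; rewrite /derivable -dfE /derive; exact.
apply: DeriveDef; first by apply/cvg_ex; exists l.
rewrite /derive; apply: cvg_lim h; exact: norm_hausdorff.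
Qed.

(** Existence and value of the complex derivative in one relation, so that sums, products and
    compositions can be differentiated by composing terms, without separate holomorphy
    conditions. *)
Definition hd (f : hfun R) (z : uhp R) (l : C) := is_derive (uhp_val z) 1 (ext f) l.

Lemma ext_uhp (f : hfun R) (z : uhp R) : ext f (uhp_val z) = f z.
Proof.
rewrite /ext; case: pselect => [h|]; last by have := uhp_val_gt0 z.
by congr f; apply: val_inj.
Qed.

Lemma uhp_val_inj : injective (@uhp_val R).
Proof. exact: val_inj. Qed.

Lemma uhp_ballP (z : uhp R) (w : C) : cabs (w - uhp_val z) < Im (uhp_val z) -> 0 < Im w.
Proof.
have := ler_Im_cabs (w - uhp_val z); rewrite ImB ler_norml; lra.
Qed.

(** Points close enough to [z] lie in the half-plane, so the extension by 0 disappears from the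
    estimate. *)
Lemma hdP (f : hfun R) (z : uhp R) (l : C) :
  hd f z l <-> forall e : R, 0 < e -> exists2 d : R, 0 < d &
    forall w, cabs (uhp_val w - uhp_val z) < d ->
      cabs (f w - f z - l * (uhp_val w - uhp_val z)) <= e * cabs (uhp_val w - uhp_val z).
Proof.
rewrite /hd is_derive_epsP; split=> h e e0.
  have [d d0 hde] := h e e0; exists d => // w /hde.
  by rewrite !ext_uhp.
have [d d0 hde] := h e e0; exists (Num.min d (Im (uhp_val z))).
  by rewrite lt_min d0 uhp_val_gt0.
move=> w; rewrite lt_min => /andP[wd /uhp_ballP w0].
have -> : ext f w = f (to_uhp w0) by exact: (ext_uhp f (to_uhp w0)).
by rewrite (ext_uhp f z); exact: (hde (to_uhp w0)).
Qed.

Lemma hd_hderiv (f : hfun R) (z : uhp R) (l : C) : hd f z l -> hderiv f z = l.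
Proof. by move=> [_ <-]; rewrite /hderiv derive1E. Qed.

Lemma hd_unique (f : hfun R) (z : uhp R) (l m : C) : hd f z l -> hd f z m -> l = m.
Proof. by move=> /hd_hderiv <- /hd_hderiv <-. Qed.

Lemma holomorphicP (f : hfun R) :
  holomorphic f <-> forall z, hd f z (hderiv f z).
Proof.
split=> [h z|h z]; last by have [] := h z.
by apply: DeriveDef; [exact: h|rewrite /hderiv derive1E].
Qed.

Lemma hd_holomorphic (f g : hfun R) : (forall z, hd f z (g z)) -> holomorphic f.
Proof. by move=> h z; have [] := h z. Qed.

Lemma hd_hderivE (f g : hfun R) : (forall z, hd f z (g z)) -> hderiv f = g.
Proof. by move=> h; apply/funext => z; apply: hd_hderiv. Qed.

Lemma hd_eq (f : hfun R) z l m : hd f z l -> l = m -> hd f z m.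
Proof. by move=> ? <-. Qed.

Lemma hd_cst (c : C) z : hd (fun=> c) z 0.
Proof.
apply/hdP => e e0; exists 1 => // w _.
by rewrite mul0r subrr subr0 cabs0 mulr_ge0 ?cabs_ge0 ?ltW.
Qed.

Lemma hd_id z : hd (@uhp_val R) z 1.
Proof.
apply/hdP => e e0; exists 1 => // w _.
by rewrite mul1r subrr cabs0 mulr_ge0 ?cabs_ge0 ?ltW.
Qed.

Lemma hdD f g z l m : hd f z l -> hd g z m -> hd (fun w => f w + g w) z (l + m).
Proof.
move=> /is_derive_epsP hf /is_derive_epsP hg.
have : is_derive (uhp_val z) 1 (ext f \+ ext g) (l + m).
  by apply: is_deriveD; apply/is_derive_epsP.
congr is_derive; apply/funext => w; rewrite /ext /=.
by case: pselect => // _; rewrite addr0.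
Qed.

Lemma hdM f g z l m : hd f z l -> hd g z m ->
  hd (fun w => f w * g w) z (l * g z + f z * m).
Proof.
move=> hf hg.
have E : ext (fun w => f w * g w) = (ext f * ext g).
  apply/funext => w; change (ext (fun w => f w * g w) w = ext f w * ext g w).
  by rewrite /ext; case: pselect => // h; rewrite mulr0.
rewrite /hd E; apply: is_derive_eq (is_deriveM hf hg) _.
rewrite !ext_uhp /GRing.scale /=; ring.
Qed.

Lemma hdV f z l : f z != 0 -> hd f z l ->
  hd (fun w => (f w)^-1) z (- l / f z ^+ 2).
Proof.
move=> f0 hf; have h0 : ext f (uhp_val z) != 0 by rewrite ext_uhp.
have [df dfE] := hf.
have E : ext (fun w => (f w)^-1) = (fun y => (ext f y)^-1).
  by apply/funext => w; rewrite /ext; case: pselect => // _; rewrite invr0.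
rewrite /hd E; apply: DeriveDef; first exact: derivableV.
by rewrite deriveV// dfE ext_uhp /GRing.scale /= mulrC mulNr mulrN.
Qed.

Lemma hdN f z l : hd f z l -> hd (fun w => - f w) z (- l).
Proof.
move=> hf; have := hdM (hd_cst (-1) z) hf.
rewrite mul0r add0r mulN1r.
by congr hd; apply/funext => w; rewrite mulN1r.
Qed.

Lemma hdB f g z l m : hd f z l -> hd g z m -> hd (fun w => f w - g w) z (l - m).
Proof. by move=> hf hg; apply: hdD => //; apply: hdN. Qed.

Lemma hdZ c f z l : hd f z l -> hd (fun w => c * f w) z (c * l).
Proof. by move=> hf; have := hdM (hd_cst c z) hf; rewrite mul0r add0r. Qed.

Lemma hdX f z l n : hd f z l -> hd (fun w => f w ^+ n) z (n%:R * f z ^+ n.-1 * l).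
Proof.
move=> hf; elim: n => [|n IH]; first by rewrite !mul0r; apply: hd_cst.
have := hdM hf IH; rewrite /=.
have -> : (fun w => f w * f w ^+ n) = (fun w => f w ^+ n.+1).
  by apply/funext => w; rewrite exprS.
move=> /hd_eq; apply; case: n {IH} => [|n /=]; first by rewrite !expr0; ring.
by rewrite -[in RHS]natr1 exprS; ring.
Qed.

Lemma hd_compC (F : C -> C) (g : hfun R) (z : uhp R) (l m : C) : is_derive (g z : C) 1 F l -> hd g z m ->
  hd (fun w => F (g w)) z (l * m).
Proof.
move=> /is_derive_epsP hF /hdP hg; apply/hdP => e e0.
(* [B] is a Lipschitz constant of [g] near [z] and [A] a positive bound for the modulus of [l]; each
   of the two error terms below gets [e / 2]. *)
pose B := cabs m + 1; have B0 : 0 < B by rewrite ltr_wpDl ?cabs_ge0.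
pose A := cabs l + 1; have A0 : 0 < A by rewrite ltr_wpDl ?cabs_ge0.
have [d1 d10 h1] := hF (e / 2 / B) (divr_gt0 (divr_gt0 e0 (ltr0n _ 2)) B0).
have [d2 d20 h2] := hg (e / 2 / A) (divr_gt0 (divr_gt0 e0 (ltr0n _ 2)) A0).
have [d3 d30 h3] := hg 1 ltr01.
exists (Num.min (Num.min d2 d3) (d1 / B)).
  by rewrite !lt_min d20 d30 divr_gt0.
move=> w; rewrite !lt_min => /andP[/andP[wd2 wd3] wd1].
have lip : cabs (g w - g z) <= B * cabs (uhp_val w - uhp_val z).
  have := cabsD (g w - g z - m * (uhp_val w - uhp_val z)) (m * (uhp_val w - uhp_val z)).
  rewrite subrK => /le_trans; apply; rewrite cabsM mulrDl addrC lerD2l.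
  exact: h3.
have gd1 : cabs (g w - g z) < d1.
  by apply: le_lt_trans lip _; rewrite mulrC -ltr_pdivlMr.
have -> : F (g w) - F (g z) - l * m * (uhp_val w - uhp_val z) =
  (F (g w) - F (g z) - l * (g w - g z)) +
  l * (g w - g z - m * (uhp_val w - uhp_val z)) by ring.
apply: le_trans (cabsD _ _) _; rewrite cabsM.
have -> : e = e / 2 + e / 2 by lra.
rewrite mulrDl; apply: lerD.
  apply: le_trans (h1 _ gd1) _.
  apply: le_trans (ler_wpM2l _ lip) _; first by rewrite !divr_ge0// ltW.
  by rewrite mulrA divfK// gt_eqF.
apply: le_trans (_ : A * cabs (g w - g z - m * (uhp_val w - uhp_val z)) <= _).
  by apply: ler_wpM2r; [exact: cabs_ge0|rewrite lerDl].
by rewrite mulrC -ler_pdivlMr// mulrAC; exact: h2.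
Qed.

Lemma hd_comp f (phi : uhp R -> uhp R) z l m : hd f (phi z) l ->
  hd (fun w => uhp_val (phi w)) z m -> hd (fun w => f (phi w)) z (l * m).
Proof.
move=> hf hphi; have := hd_compC (g := fun w => uhp_val (phi w)) hf hphi.
by congr hd; apply/funext => w; rewrite ext_uhp.
Qed.

Lemma hd_cont f z l : hd f z l -> forall e : R, 0 < e -> exists2 d : R, 0 < d &
  forall w, cabs (uhp_val w - uhp_val z) < d -> cabs (f w - f z) < e.
Proof.
move=> /hdP /(_ _ ltr01)[d d0 hd'] e e0.
pose B := cabs l + 1; have B0 : 0 < B by rewrite ltr_wpDl ?cabs_ge0.
exists (Num.min d (e / B)) => [|w]; first by rewrite lt_min d0 divr_gt0.
rewrite lt_min => /andP[wd we].
have := cabsD (f w - f z - l * (uhp_val w - uhp_val z)) (l * (uhp_val w - uhp_val z)).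
rewrite subrK => /le_lt_trans; apply.
apply: (@le_lt_trans _ _ (B * cabs (uhp_val w - uhp_val z))).
  by rewrite cabsM mulrDl addrC lerD2l hd'.
by rewrite mulrC -ltr_pdivlMr.
Qed.

End ComplexDerivative.

(** * The complex exponential: functional equation, derivative, kernel *)

Section ComplexExponential.
Context {R : realType}.
Local Notation C := (cplx R).
Local Notation Re := (@complex.Re R).
Local Notation Im := (@complex.Im R).

Lemma is_derive_reP (F : R -> R) (z l : R) : is_derive z 1 F l ->
  forall e : R, 0 < e -> exists2 d : R, 0 < d &
    forall w, `|w - z| < d -> `|F w - F z - l * (w - z)| <= e * `|w - z|.
Proof.
move=> [df dfE] e e0; move: df; rewrite /derivable -/(derive _ _ _) => df.
have {df} : (fun h => h^-1 *: ((F \o shift z) (h *: (1 : R)) - F z)) @ 0^' --> l.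
  by rewrite -dfE.
move=> /cvgrPdist_lt/(_ _ e0) /nbhs_ballP[d /= d0 hd']; exists d => // w wz.
have [->|wz0] := eqVneq w z; first by rewrite !subrr mulr0 subrr normr0 mulr0.
have w0 : w - z != 0 by rewrite subr_eq0.
have := hd' (w - z); rewrite /ball /= sub0r normrN => /(_ wz w0) h.
have -> : F w - F z - l * (w - z) =
  - (l - (w - z)^-1 *: ((F \o shift z) ((w - z) *: (1 : R)) - F z)) * (w - z).
  by rewrite /GRing.scale /= mulr1 subrK; field.
by rewrite normrM normrN; apply: ler_wpM2r => //; apply: ltW; apply: le_lt_trans h.
Qed.

Lemma Re_cexp (w : C) : Re (cexp w) = expR (Re w) * cos (Im w).
Proof. by rewrite /cexp !ReImE /=; ring. Qed.
Lemma Im_cexp (w : C) : Im (cexp w) = expR (Re w) * sin (Im w).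
Proof. by rewrite /cexp !ReImE /=; ring. Qed.

Lemma cexpD (z w : C) : cexp (z + w) = cexp z * cexp w.
Proof.
apply: cplx_eq; rewrite !(Re_cexp, Im_cexp, ReImE) expRD.
  by rewrite cosD; ring.
by rewrite sinD; ring.
Qed.

Lemma cexp0 : cexp 0 = 1 :> C.
Proof. by apply: cplx_eq; rewrite !(Re_cexp, Im_cexp, ReImE) expR0 ?cos0 ?sin0 mul1r. Qed.

Lemma cexpNK (w : C) : cexp (- w) * cexp w = 1.
Proof. by rewrite -cexpD addNr cexp0. Qed.

Lemma cexp_neq0 (w : C) : cexp w != 0.
Proof.
by apply/eqP => w0; have := cexpNK w; rewrite w0 mulr0 => /eqP; rewrite eq_sym oner_eq0.
Qed.

Lemma cexpN (w : C) : cexp (- w) = (cexp w)^-1.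
Proof. by apply: (mulIf (cexp_neq0 w)); rewrite cexpNK mulVf// cexp_neq0. Qed.

Lemma cexpB (z w : C) : cexp (z - w) = cexp z / cexp w.
Proof. by rewrite cexpD cexpN. Qed.

Lemma cexpMn (w : C) n : cexp (w *+ n) = cexp w ^+ n.
Proof. by elim: n => [|n IH]; rewrite ?mulr0n ?cexp0// mulrS exprS cexpD IH. Qed.

Lemma cexp_conj (w : C) : cexp (cconj w) = cconj (cexp w).
Proof.
by apply: cplx_eq; rewrite !(Re_cexp, Im_cexp, ReImE) ?cosN ?sinN ?mulrN.
Qed.

Lemma cexp_ofR (a : R) : cexp (ofR a) = ofR (expR a).
Proof.
by apply: cplx_eq; rewrite !(Re_cexp, Im_cexp, ReImE) ?cos0 ?sin0 ?mulr1 ?mulr0.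
Qed.

Lemma cabs_cexp (w : C) : cabs (cexp w) = expR (Re w).
Proof.
apply/eqP; rewrite -(eqrXn2 (n:=2))// ?cabs_ge0 ?expR_ge0//.
rewrite cabs_sq Re_cexp Im_cexp !exprMn -mulrDr.
by rewrite cos2Dsin2 mulr1.
Qed.

Lemma is_derive_cexp (w : C) : is_derive w 1 (@cexp R) (cexp w).
Proof.
apply/is_derive_epsP => e e0.
(* The functional equation moves the estimate to the origin at the price of the factor
   [cabs (cexp w)]. There the real part costs 4 and the imaginary part 5 units of [e1 * r], within
   the 20 allowed. *)
pose e1 := e / 20 / (cabs (cexp w)).
have cw0 : 0 < cabs (cexp w) by rewrite cabs_gt0 cexp_neq0.
have e10 : 0 < e1 by rewrite !divr_gt0.
have [d1 d10 h1] := is_derive_reP (is_derive_expR (0 : R)) e10.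
have [d2 d20 h2] := is_derive_reP (is_derive_cos (0 : R)) e10.
have [d3 d30 h3] := is_derive_reP (is_derive_sin (0 : R)) e10.
have [d4 d40 h4] := is_derive_reP (is_derive_expR (0 : R)) ltr01.
exists (Num.min (Num.min (Num.min d1 d2) (Num.min d3 d4)) (Num.min 1 e1)).
  by rewrite !lt_min d10 d20 d30 d40 ltr01 e10.
move=> v; rewrite !lt_min.
move=> /andP[/andP[/andP[v1 v2] /andP[v3 v4]] /andP[v5 v6]].
have -> : cexp v - cexp w - cexp w * (v - w) =
    cexp w * (cexp (v - w) - 1 - (v - w)).
  by rewrite !mulrBr mulr1 -cexpD (_ : w + (v - w) = v); ring.
set h := v - w in v1 v2 v3 v4 v5 v6 *; clearbody h.
suff H : cabs (cexp h - 1 - h) <= 20 * e1 * cabs h.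
  rewrite cabsM; apply: le_trans (ler_wpM2l (cabs_ge0 _) H) _.
  rewrite le_eqVlt; apply/orP; left; apply/eqP; rewrite /e1; field.
  by rewrite gt_eqF.
set r := cabs h in v1 v2 v3 v4 v5 v6 *; have r0 : 0 <= r := cabs_ge0 h.
have xr := ler_Re_cabs h; have yr := ler_Im_cabs h.
rewrite -/r in xr yr; set x := Re h in xr *; set y := Im h in yr *.
have := h1 x; rewrite !subr0 expR0 mul1r => /(_ (le_lt_trans xr v1)) H1.
have := h2 y; rewrite !subr0 cos0 sin0 oppr0 mul0r subr0 => /(_ (le_lt_trans yr v2)) H2.
have := h3 y; rewrite !subr0 cos0 sin0 subr0 mul1r => /(_ (le_lt_trans yr v3)) H3.
have := h4 x; rewrite !subr0 expR0 !mul1r => /(_ (le_lt_trans xr v4)) H4.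
have E0 := expR_gt0 x.
have x1 : `|expR x - 1| <= 2 * r.
  have := ler_normD (expR x - 1 - x) x; rewrite subrK; lra.
have E3 : expR x <= 3 by have /ler_normlP[] := x1; lra.
apply: le_trans (cabs_ReIm _) _.
rewrite !ReB !ImB Re_cexp Im_cexp Re1 Im1 -/x -/y.
have H2' : `|cos y - 1| <= e1 * r by apply: le_trans H2 _; rewrite ler_pM2l.
have H3' : `|sin y - y| <= e1 * r by apply: le_trans H3 _; rewrite ler_pM2l.
have H1' : `|expR x - 1 - x| <= e1 * r by apply: le_trans H1 _; rewrite ler_pM2l.
have er0 : 0 <= e1 * r by rewrite mulr_ge0// ltW.
have A : `|expR x * cos y - 1 - x| <= 4 * (e1 * r).
  have -> : expR x * cos y - 1 - x = (expR x - 1 - x) + expR x * (cos y - 1) by ring.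
  apply: le_trans (ler_normD _ _) _; rewrite normrM (gtr0_norm E0).
  have I1 : expR x * `|cos y - 1| <= 3 * (e1 * r) by apply: ler_pM => //; exact: ltW.
  apply: le_trans (lerD H1' I1) _.
  by rewrite -{1}[e1 * r]mul1r -mulrDl ler_wpM2r//; lra.
have B : `|expR x * sin y - 0 - y| <= 5 * (e1 * r).
  have -> : expR x * sin y - 0 - y = expR x * (sin y - y) + y * (expR x - 1) by ring.
  apply: le_trans (ler_normD _ _) _; rewrite !normrM (gtr0_norm E0).
  have I1 : expR x * `|sin y - y| <= 3 * (e1 * r) by apply: ler_pM => //; exact: ltW.
  have I2 : `|y| * `|expR x - 1| <= r * (2 * r) by apply: ler_pM.
  have I3 : r * r <= e1 * r by apply: ler_wpM2r => //; exact: ltW.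
  apply: le_trans (lerD I1 I2) _; rewrite [r * (2 * r)]mulrCA.
  have -> : 5 * (e1 * r) = 3 * (e1 * r) + 2 * (e1 * r) by ring.
  by rewrite lerD2l ler_pM2l.
rewrite -mulrA; apply: le_trans (lerD A B) _.
by rewrite -mulrDl ler_wpM2r// -natrD ler_nat.
Qed.

(** The modulus kills the real part. The floor moves the imaginary part into [[0, 2 pi)], where the
    cosine equals 1 only at 0: it is injective on [[0, pi]], and the other half is reflected onto
    it. *)
Lemma cexp_eq1 (w : C) : cexp w = 1 -> exists n : int, w = ofR (2 * pi * n%:~R) * ci.
Proof.
move=> w1; have e1 : expR (Re w) = 1 by rewrite -cabs_cexp w1 cabs1.
have x0 : Re w = 0 by apply: expR_inj; rewrite e1 expR0.
have cy : cos (Im w) = 1.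
  have := congr1 Re w1; by rewrite Re_cexp e1 mul1r Re1.
pose n : int := Num.floor (Im w / (2 * pi)).
have p0 : 0 < 2 * pi :> R by rewrite mulr_gt0// pi_gt0.
have cosn (m : nat) t : cos (t + 2 * pi * m%:R) = cos t :> R.
  have -> : 2 * pi * m%:R = (pi *+ 2) *+ m :> R by rewrite mulr_natr mulr_natl.
  by rewrite (periodicn (@cosD2pi R)).
have cosz (m : int) t : cos (t + 2 * pi * m%:~R) = cos t :> R.
  case: m => m; first exact: cosn.
  by rewrite NegzE mulrNz mulrN -pmulrn -[LHS](cosn m.+1) subrK.
pose t := Im w - 2 * pi * n%:~R.
have ct : cos t = 1.
  by rewrite -cy -[in RHS](cosz (- n) (Im w)) mulrNz mulrN.
have t0 : 0 <= t.
  by rewrite subr_ge0 mulrC -ler_pdivlMr// floor_le.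
have t2 : t < 2 * pi.
  rewrite ltrBlDr -[X in X + _]mulr1 -mulrDr mulrC -ltr_pdivrMr//.
  by rewrite addrC -[1]/(1%:~R) -intrD floorD1_gt.
suff t00 : t = 0.
  exists n; apply: cplx_eq; rewrite !ReImE ?x0; first by ring.
  by move/subr0_eq: t00 => ->; ring.
have [tpi|tpi] := leP t pi.
  by apply: cos_inj; rewrite ?in_itv/= ?t0 ?tpi ?lexx ?pi_ge0 ?cos0.
have : 2 * pi - t = 0.
  apply: cos_inj; rewrite ?in_itv/= ?lexx ?pi_ge0//; first by apply/andP; split; lra.
  rewrite cos0 -cosN opprB -[RHS]ct -[RHS](cosz (-1)).
  by rewrite (_ : (-1)%:~R = -1)// mulrN1.
lra.
Qed.

End ComplexExponential.

(** * Principal logarithm and powers on the right half-plane *)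

Section ComplexLogarithm.
Context {R : realType}.
Local Notation C := (cplx R).
Local Notation Re := (@complex.Re R).
Local Notation Im := (@complex.Im R).
Local Opaque cexp.

Lemma cexpK (l : C) : - pi < Im l <= pi -> clog (cexp l) = l.
Proof.
move=> /andP[lb ub]; have e0 := expR_gt0 (Re l).
have quot : Re (cexp l) / cabs (cexp l) = cos (Im l).
  by rewrite cabs_cexp Re_cexp mulrAC divff ?mul1r// gt_eqF.
apply: cplx_eq => /=; first by rewrite cabs_cexp expRK.
rewrite /carg quot Im_cexp pmulr_rge0//; case: ifPn => [s0|].
  have [b0|b0] := leP 0 (Im l); first by rewrite cosK// in_itv/= b0.
  have := @sin_gt0_pi R (- Im l); rewrite sinN; lra.
rewrite -ltNge => s0; have b0 : Im l <= 0.
  rewrite leNgt; apply/negP => b0; have := @sin_ge0_pi R (Im l); lra.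
by rewrite cosKN ?opprK// b0 ltW.
Qed.

Lemma lipschitz_cvg (f : C -> R) (w : C) :
  (forall v, `|f v - f w| <= cabs (v - w)) -> f @ w --> f w.
Proof.
move=> h; apply/(@cvgrPdist_lt _ _ _ _ (nbhs_filter w)) => e e0; apply/nbhs_cabsP; exists e => // v /=.
by rewrite distrC; apply: le_lt_trans.
Qed.

Lemma Re_cvg (w : C) : Re @ w --> Re w.
Proof. by apply: lipschitz_cvg => v; rewrite -ReB ler_Re_cabs. Qed.
Lemma Im_cvg (w : C) : Im @ w --> Im w.
Proof. by apply: lipschitz_cvg => v; rewrite -ImB ler_Im_cabs. Qed.
Lemma cabs_cvg (w : C) : @cabs R @ w --> cabs w.
Proof. by apply: lipschitz_cvg => v; exact: cabs_dist. Qed.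

(** On the right half-plane the arctangent gives the argument without the case distinction of
    [carg], which makes continuity visible. All kernel arguments lie there, so the cut is never
    met. *)
Definition rlog (w : C) : C := (ln (cabs w) +i* atan (Im w / Re w))%C.

Lemma cexp_rlog (w : C) : 0 < Re w -> cexp (rlog w) = w.
Proof.
move=> w0; have cw : 0 < cabs w.
  by apply: lt_le_trans w0 _; apply: le_trans (ler_norm _) (ler_Re_cabs _).
pose x := Im w / Re w.
have sx : cabs w = Re w * Num.sqrt (1 + x ^+ 2).
  rewrite cabs_sqrt -{2}(gtr0_norm w0) -sqrtr_sqr -sqrtrM ?sqr_ge0//.
  by congr Num.sqrt; rewrite /x; field; rewrite gt_eqF.
have s0 : Num.sqrt (1 + x ^+ 2) != 0.
  by rewrite gt_eqF// sqrtr_gt0 ltr_wpDr ?sqr_ge0.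
have cosE : expR (ln (cabs w)) * cos (atan x) = Re w.
  by rewrite lnK ?posrE// cos_atan sx mulfK.
apply: cplx_eq; rewrite ?Re_cexp ?Im_cexp /= -/x //.
have c0 : cos (atan x) != 0 by rewrite cos_atan invr_neq0.
have -> : sin (atan x) = x * cos (atan x).
  by have := atanK x; rewrite /tan => {2}<-; rewrite divfK.
by rewrite mulrCA cosE /x divfK// gt_eqF.
Qed.

Lemma Im_rlog (w : C) : - pi < Im (rlog w) <= pi.
Proof.
have /= := atan_gtNpi2 (Im w / Re w); have := atan_ltpi2 (Im w / Re w).
have := @pi_gt0 R; set a := atan _ => /= h1 h2 h3; apply/andP; split; lra.
Qed.

Lemma clog_rlog (w : C) : 0 < Re w -> clog w = rlog w.
Proof. by move=> w0; rewrite -{1}(cexp_rlog w0) cexpK// Im_rlog. Qed.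

Lemma clogK (w : C) : 0 < Re w -> cexp (clog w) = w.
Proof. by move=> w0; rewrite clog_rlog// cexp_rlog. Qed.

Lemma clog_cexp_eq (w l : C) : cexp l = w -> - pi < Im l <= pi -> clog w = l.
Proof. by move=> <-; exact: cexpK. Qed.

Lemma clog_cont (w0 : C) : 0 < Re w0 -> forall e : R, 0 < e ->
  exists2 d : R, 0 < d & forall w, cabs (w - w0) < d -> cabs (clog w - clog w0) < e.
Proof.
move=> w00 e e0.
have cw : 0 < cabs w0.
  by apply: lt_le_trans w00 _; apply: le_trans (ler_norm _) (ler_Re_cabs _).
have h1 : (fun w => ln (cabs w)) @ w0 --> ln (cabs w0).
  by apply: (cvg_comp _ _ (cabs_cvg (w:=w0))); exact: continuous_ln.
have h2 : (fun w => atan (Im w / Re w)) @ w0 --> atan (Im w0 / Re w0).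
  have hq : (fun w => Im w / Re w) @ w0 --> Im w0 / Re w0.
    have FF := nbhs_filter w0.
    have i1 := @cvgV R C (nbhs w0) FF (Re : C -> R) (Re w0) (lt0r_neq0 w00) (@Re_cvg w0).
    exact: (@cvgM R C (nbhs w0) FF (Im : C -> R) _ _ _ (@Im_cvg w0) i1).
  by apply: (cvg_comp _ _ hq); exact: continuous_atan.
have e2 : 0 < e / 2 by rewrite divr_gt0.
have := h1; move/cvgrPdist_lt => /(_ _ e2)/nbhs_cabsP[d1 d10 hd1].
have := h2; move/cvgrPdist_lt => /(_ _ e2)/nbhs_cabsP[d2 d20 hd2].
exists (Num.min (Num.min d1 d2) (Re w0)) => [|w]; first by rewrite !lt_min d10 d20.
rewrite !lt_min => /andP[/andP[/hd1 w1 /hd2 w2] w3].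
have wp : 0 < Re w.
  have := le_lt_trans (ler_Re_cabs (w - w0)) w3; rewrite ReB ltr_norml; lra.
rewrite !clog_rlog//; apply: le_lt_trans (cabs_ReIm _) _.
rewrite ReB ImB /=; move: w1 w2 => /=.
rewrite distrC => w1; rewrite distrC => w2.
by rewrite [e]splitr; exact: ltrD.
Qed.

Lemma is_derive_clog (w0 : C) : 0 < Re w0 -> is_derive w0 1 (@clog R) w0^-1.
Proof.
move=> w00; apply/is_derive_epsP => e e0.
have cw : 0 < cabs w0.
  by apply: lt_le_trans w00 _; apply: le_trans (ler_norm _) (ler_Re_cabs _).
have w0n : w0 != 0 by rewrite -cabs_gt0.
(* The first term makes the increment of the logarithm at most twice that of [w] divided by
   [cabs w0]; given this, the second one turns the error of the exponential into [e] times the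
   increment of [w]. *)
pose e1 := Num.min (cabs w0 / 2) (e * cabs w0 ^+ 2 / 2).
have e10 : 0 < e1 by rewrite lt_min !divr_gt0// mulr_gt0// exprn_gt0.
have /is_derive_epsP/(_ _ e10)[d d0 hd'] := is_derive_cexp (clog w0).
have [d' d'0 hc] := clog_cont w00 d0.
exists (Num.min d' (Re w0)) => [|w]; first by rewrite lt_min d'0.
rewrite lt_min => /andP[/hc wd w3].
have wp : 0 < Re w.
  have := le_lt_trans (ler_Re_cabs (w - w0)) w3; rewrite ReB ltr_norml; lra.
have := hd' _ wd; rewrite !clogK//.
set D := clog w - clog w0; set E := w - w0 => H.
have H1 : cabs w0 * cabs D <= 2 * cabs E.
  have := cabsD (w0 * D - E) E; rewrite subrK cabsM (cabsB _ E).
  have : e1 * cabs D <= cabs w0 / 2 * cabs D.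
    by apply: ler_wpM2r; rewrite ?cabs_ge0// ge_min lexx.
  move: H; set a := e1 * _; have -> : cabs w0 / 2 * cabs D = (cabs w0 * cabs D) / 2 by ring.
  set b := cabs w0 * _; set c := cabs (E - _); set f := cabs E; clear; lra.
have -> : D - w0^-1 * E = - (w0^-1 * (E - w0 * D)) by field.
rewrite cabsN cabsM cabsV mulrC ler_pdivrMr//.
apply: le_trans H _.
apply: (@le_trans _ _ (e * cabs w0 ^+ 2 / 2 * cabs D)).
  by apply: ler_wpM2r; rewrite ?cabs_ge0// ge_min lexx orbT.
have -> : e * cabs w0 ^+ 2 / 2 * cabs D = e * cabs w0 / 2 * (cabs w0 * cabs D) by ring.
have -> : e * cabs E * cabs w0 = e * cabs w0 / 2 * (2 * cabs E) by field.
by apply: ler_wpM2l => //; rewrite !divr_ge0 ?mulr_ge0 ?cabs_ge0// ltW.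
Qed.

Lemma cpowD (w : C) (a b : R) : cpow w (a + b) = cpow w a * cpow w b.
Proof. by rewrite /cpow ofRD mulrDl cexpD. Qed.

Lemma cpow0 (w : C) : cpow w 0 = 1.
Proof. by rewrite /cpow ofR0 mul0r cexp0. Qed.

Lemma cpow_neq0 (w : C) a : cpow w a != 0.
Proof. exact: cexp_neq0. Qed.

Lemma cpowN (w : C) a : cpow w (- a) = (cpow w a)^-1.
Proof.
by apply: (mulfI (cpow_neq0 w a)); rewrite -cpowD subrr cpow0 mulfV// cpow_neq0.
Qed.

Lemma clogZ (r : R) (w : C) : 0 < r -> 0 < Re w ->
  clog (ofR r * w) = ofR (ln r) + clog w.
Proof.
move=> r0 w0; apply: clog_cexp_eq.
  by rewrite cexpD cexp_ofR lnK// clogK.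
by rewrite ImD Im_ofR add0r clog_rlog// Im_rlog.
Qed.

Lemma clog_conj (w : C) : 0 < Re w -> clog (cconj w) = cconj (clog w).
Proof.
move=> w0; apply: clog_cexp_eq; first by rewrite cexp_conj clogK.
rewrite Im_conj clog_rlog//=.
have /= := atan_gtNpi2 (Im w / Re w); have := atan_ltpi2 (Im w / Re w).
have := @pi_gt0 R; set a := atan _ => /= h1 h2 h3; apply/andP; split; lra.
Qed.

Lemma clog_ofR (r : R) : 0 < r -> clog (ofR r) = ofR (ln r).
Proof.
move=> r0; apply: clog_cexp_eq; first by rewrite cexp_ofR lnK.
by rewrite Im_ofR oppr_lt0 pi_gt0 pi_ge0.
Qed.

Lemma cpowZ (r : R) (w : C) a : 0 < r -> 0 < Re w ->
  cpow (ofR r * w) a = ofR (r `^ a) * cpow w a.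
Proof.
move=> r0 w0; rewrite /cpow clogZ// mulrDr cexpD -ofRM cexp_ofR.
by rewrite /powR gt_eqF.
Qed.

Lemma cpow_ofR (r : R) a : 0 < r -> cpow (ofR r) a = ofR (r `^ a).
Proof.
by move=> r0; rewrite /cpow clog_ofR// -ofRM cexp_ofR /powR gt_eqF.
Qed.

Lemma cpow_conj (w : C) a : 0 < Re w -> cpow (cconj w) a = cconj (cpow w a).
Proof.
by move=> w0; rewrite /cpow clog_conj// -cexp_conj cconjM cconj_ofR.
Qed.

Lemma hd_cpow (f : hfun R) (z : uhp R) l a : 0 < Re (f z) -> hd f z l ->
  hd (fun w => cpow (f w) a) z (ofR a * cpow (f z) a / f z * l).
Proof.
move=> f0 hf; have h1 := hdZ (ofR a) (hd_compC (is_derive_clog f0) hf).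
apply: hd_eq (hd_compC (is_derive_cexp _) h1) _.
by rewrite /cpow; ring.
Qed.

End ComplexLogarithm.

(** * Line integrals and Cauchy theory *)

Section LineIntegrals.
Context {R : realType}.
Local Notation C := (cplx R).
Local Notation Re := (@complex.Re R).
Local Notation Im := (@complex.Im R).

Lemma is_derive_re_epsP (F : R -> R) (z l : R) : is_derive z 1 F l <->
  forall e : R, 0 < e -> exists2 d : R, 0 < d &
    forall w, `|w - z| < d -> `|F w - F z - l * (w - z)| <= e * `|w - z|.
Proof.
split=> [|h]; first exact: is_derive_reP.
suff H : (fun h => h^-1 *: ((F \o shift z) (h *: (1 : R)) - F z)) @ 0^' --> l.
  apply: DeriveDef; first by apply/cvg_ex; exists l.
  by rewrite /derive; apply: cvg_lim H.
apply/cvgrPdist_le => e e0; have [d d0 hd'] := h e e0.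
apply/nbhs_ballP; exists d => // w; rewrite /ball /= sub0r normrN => wd w0.
rewrite /GRing.scale /= mulr1.
have -> : l - w^-1 * (F (w + z) - F z) = - (w^-1 * (F (w + z) - F z - l * (w + z - z))).
  by field.
rewrite normrN normrM normfV mulrC ler_pdivrMr ?normr_gt0//.
by have := hd' (w + z); rewrite addrK; apply.
Qed.

(** The derivative of a complex curve in a real parameter, taken componentwise so that the real mean
    value theorem and the fundamental theorem of calculus apply directly. *)
Definition rd (U : R -> C) (t : R) (l : C) :=
  is_derive t 1 (fun s => Re (U s)) (Re l) /\ is_derive t 1 (fun s => Im (U s)) (Im l).

Lemma rdP U t l : rd U t l <->
  forall e : R, 0 < e -> exists2 d : R, 0 < d &
    forall s, `|s - t| < d -> cabs (U s - U t - l * ofR (s - t)) <= e * `|s - t|.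
Proof.
rewrite /rd !is_derive_re_epsP; split=> [[h1 h2] e e0|h].
  have e2 : 0 < e / 2 by rewrite divr_gt0.
  have [d1 d10 H1] := h1 _ e2; have [d2 d20 H2] := h2 _ e2.
  exists (Num.min d1 d2) => [|s]; first by rewrite lt_min d10.
  rewrite lt_min => /andP[/H1 s1 /H2 s2].
  apply: le_trans (cabs_ReIm _) _; rewrite !ReImE !mulr0 subr0 add0r.
  by rewrite [e]splitr mulrDl; exact: lerD.
split=> e e0; have [d d0 H] := h _ e0; exists d => // s /H hs.
  apply: le_trans hs; apply: le_trans (ler_Re_cabs _).
  by rewrite !ReImE mulr0 subr0.
apply: le_trans hs; apply: le_trans (ler_Im_cabs _).
by rewrite !ReImE mulr0 add0r.
Qed.

Lemma rdD U V t l m : rd U t l -> rd V t m -> rd (fun s => U s + V s) t (l + m).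
Proof.
move=> [a b] [c d]; split.
  have -> : (fun s => Re (U s + V s)) = (fun s => Re (U s)) \+ (fun s => Re (V s)).
    by apply/funext => s; rewrite ReD.
  by rewrite ReD; exact: is_deriveD.
have -> : (fun s => Im (U s + V s)) = (fun s => Im (U s)) \+ (fun s => Im (V s)).
  by apply/funext => s; rewrite ImD.
by rewrite ImD; exact: is_deriveD.
Qed.

Lemma rd_cst c t : rd (fun=> c) t 0.
Proof. by split; exact: is_derive_cst. Qed.

Lemma rd_eq U t l m : rd U t l -> l = m -> rd U t m.
Proof. by move=> ? <-. Qed.

Lemma rd_comp (F : C -> C) (g : R -> C) t l m : is_derive (g t) 1 F l -> rd g t m ->
  rd (fun s => F (g s)) t (l * m).
Proof.
move=> /is_derive_epsP hF /rdP hg; apply/rdP => e e0.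
pose B := cabs m + 1; have B0 : 0 < B by rewrite ltr_wpDl ?cabs_ge0.
pose A := cabs l + 1; have A0 : 0 < A by rewrite ltr_wpDl ?cabs_ge0.
have [d1 d10 h1] := hF (e / 2 / B) (divr_gt0 (divr_gt0 e0 (ltr0n _ 2)) B0).
have [d2 d20 h2] := hg (e / 2 / A) (divr_gt0 (divr_gt0 e0 (ltr0n _ 2)) A0).
have [d3 d30 h3] := hg 1 ltr01.
exists (Num.min (Num.min d2 d3) (d1 / B)).
  by rewrite !lt_min d20 d30 divr_gt0.
move=> s; rewrite !lt_min => /andP[/andP[wd2 wd3] wd1].
have lip : cabs (g s - g t) <= B * `|s - t|.
  have := cabsD (g s - g t - m * ofR (s - t)) (m * ofR (s - t)).
  rewrite subrK => /le_trans; apply; rewrite cabsM cabs_ofR mulrDl addrC lerD2l.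
  exact: h3.
have gd1 : cabs (g s - g t) < d1.
  by apply: le_lt_trans lip _; rewrite mulrC -ltr_pdivlMr.
have -> : F (g s) - F (g t) - l * m * ofR (s - t) =
  (F (g s) - F (g t) - l * (g s - g t)) +
  l * (g s - g t - m * ofR (s - t)) by ring.
apply: le_trans (cabsD _ _) _; rewrite cabsM.
have -> : e = e / 2 + e / 2 by rewrite -splitr.
rewrite mulrDl; apply: lerD.
  apply: le_trans (h1 _ gd1) _.
  apply: le_trans (ler_wpM2l _ lip) _; first by rewrite !divr_ge0// ltW.
  by rewrite mulrA divfK// gt_eqF.
apply: le_trans (_ : A * cabs (g s - g t - m * ofR (s - t)) <= _).
  by apply: ler_wpM2r; [exact: cabs_ge0|rewrite lerDl].
by rewrite mulrC -ler_pdivlMr// mulrAC; exact: h2.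
Qed.

Lemma rdZ c U t l : rd U t l -> rd (fun s => c * U s) t (c * l).
Proof.
move=> hU; have hc : is_derive (U t) 1 (fun w : C => c * w) c.
  apply/is_derive_epsP => e e0; exists 1 => // w _.
  by rewrite -mulrBr subrr cabs0 mulr_ge0 ?cabs_ge0 ?ltW.
exact: rd_comp hc hU.
Qed.

Lemma rdB U V t l m : rd U t l -> rd V t m -> rd (fun s => U s - V s) t (l - m).
Proof.
move=> hU hV; have := rdD hU (rdZ (-1) hV); rewrite mulN1r.
by congr rd; apply/funext => s; rewrite mulN1r.
Qed.

Lemma rd_affine (a b : C) t : rd (fun s => a + b * ofR s) t b.
Proof.
apply/rdP => e e0; exists 1 => // s _.
rewrite ofRB; have -> : a + b * ofR s - (a + b * ofR t) - b * (ofR s - ofR t) = 0 by ring.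
by rewrite cabs0 mulr_ge0// ltW.
Qed.

Lemma rd_reparam U t l (g : R -> R) m : rd U (g t) l -> is_derive t 1 g m ->
  rd (fun s => U (g s)) t (l * ofR m).
Proof.
move=> [h1 h2] hg; split; rewrite !ReImE.
  rewrite mulr0 subr0.
  have := @is_derive1_comp R (fun s => Re (U s)) g t _ _ h1 hg.
  by rewrite mulrC.
rewrite mulr0 add0r.
have := @is_derive1_comp R (fun s => Im (U s)) g t _ _ h2 hg.
by rewrite mulrC.
Qed.

(** There is no mean value equality for complex curves; a rotation making the total increment real
    and nonnegative reduces the inequality to the real theorem for [G - Re (c * U)]. *)
Lemma rd_mean_value (U u : R -> C) (G g : R -> R) a b : a <= b ->
  (forall t, a <= t <= b -> rd U t (u t)) ->
  (forall t, a <= t <= b -> is_derive t 1 G (g t)) ->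
  (forall t, a <= t <= b -> cabs (u t) <= g t) ->
  cabs (U b - U a) <= G b - G a.
Proof.
move=> ab hU hG hle.
pose D := U b - U a.
pose c := if D == 0 then 0 else cconj D / ofR (cabs D).
have c1 : cabs c <= 1.
  rewrite /c; case: eqP => [_|/eqP D0]; first by rewrite cabs0 ler01.
  rewrite cabsM cabsV cabs_conj cabs_ofR ger0_norm ?cabs_ge0//.
  by rewrite divff// cabs_eq0.
have cD : Re (c * D) = cabs D.
  rewrite /c; case: eqP => [->|/eqP D0]; first by rewrite mul0r cabs0.
  rewrite mulrAC [_ * D]mulrC mul_cconj -ofRV -ofRM Re_ofR expr2 mulfK//.
  by rewrite cabs_eq0.
pose phi t := G t - Re (c * U t).
have hphi t : a <= t <= b -> is_derive t 1 phi (g t - Re (c * u t)).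
  move=> tab; apply: is_deriveB; first exact: hG.
  by have [] := rdZ c (hU _ tab).
have [t||t tab] := @MVT_segment R phi (fun t => g t - Re (c * u t)) a b ab.
- by rewrite in_itv/= => /andP[at' tb]; apply: hphi; rewrite !ltW.
- by apply: derivable_within_continuous => x /itvP xab; have [] := hphi x; rewrite ?xab.
rewrite /phi => E.
have cu : Re (c * u t) <= g t.
  apply: le_trans (hle _ _); last by move: tab; rewrite in_itv.
  apply: le_trans (ler_norm _) _; apply: le_trans (ler_Re_cabs _) _.
  by rewrite cabsM ler_piMl ?cabs_ge0.
have : 0 <= (g t - Re (c * u t)) * (b - a) by rewrite mulr_ge0 // subr_ge0.
rewrite -E -/D -cD /D mulrBr ReB.
move: (Re (c * U a)) (Re (c * U b)) (G a) (G b); clear => x y z w; lra.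
Qed.

Lemma rd_mean_value_cst (U u : R -> C) M a b : a <= b ->
  (forall t, a <= t <= b -> rd U t (u t)) ->
  (forall t, a <= t <= b -> cabs (u t) <= M) ->
  cabs (U b - U a) <= M * (b - a).
Proof.
move=> ab hU hM; rewrite mulrBr.
apply: (@rd_mean_value U u (fun t => M * t) (fun=> M)) => // t _.
have := @is_deriveZ R R R id M t 1 1 (is_derive_id t 1).
by rewrite /GRing.scale /= mulr1.
Qed.

Definition ccont (u : R -> C) (t : R) := forall e : R, 0 < e ->
  exists2 d : R, 0 < d & forall s, `|s - t| < d -> cabs (u s - u t) < e.

Lemma ccont_Re u t : ccont u t -> {for t, continuous (fun s => Re (u s))}.
Proof.
move=> h; apply/cvgrPdist_lt => e e0; have [d d0 hd'] := h _ e0.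
apply/nbhs_ballP; exists d => // s; rewrite /ball /= distrC => /hd'.
by rewrite distrC -ReB; apply: le_lt_trans; exact: ler_Re_cabs.
Qed.

Lemma ccont_Im u t : ccont u t -> {for t, continuous (fun s => Im (u s))}.
Proof.
move=> h; apply/cvgrPdist_lt => e e0; have [d d0 hd'] := h _ e0.
apply/nbhs_ballP; exists d => // s; rewrite /ball /= distrC => /hd'.
by rewrite distrC -ImB; apply: le_lt_trans; exact: ler_Im_cabs.
Qed.

Lemma ccont_cabs u t : ccont u t -> {for t, continuous (fun s => cabs (u s))}.
Proof.
move=> h; apply/cvgrPdist_lt => e e0; have [d d0 hd'] := h _ e0.
apply/nbhs_ballP; exists d => // s; rewrite /ball /= distrC => /hd'.
by rewrite distrC; apply: le_lt_trans; exact: cabs_dist.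
Qed.

Lemma ccont_bounded u a b : a <= b -> (forall t, a <= t <= b -> ccont u t) ->
  exists M, 0 <= M /\ forall t, a <= t <= b -> cabs (u t) <= M.
Proof.
move=> ab hu.
have hc : {within `[a, b], continuous (fun s => cabs (u s))}.
  apply: continuous_in_subspaceT => t; rewrite inE /= in_itv /= => tab.
  exact/ccont_cabs/hu.
have [c _ hM] := EVT_max ab hc.
by exists (cabs (u c)); split=> [|t tab]; [exact: cabs_ge0|apply: hM; rewrite in_itv].
Qed.

Lemma derive1_is_derive (F : R -> R) t l :
  derivable F t 1 /\ derive1 F t = l -> is_derive t 1 F l.
Proof. by move=> [h1 <-]; apply: DeriveDef => //; rewrite derive1E. Qed.

Lemma local_antiderivative (u : R -> R) a b : a < b ->
  (forall t, a <= t <= b -> {for t, continuous u}) ->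
  exists F, forall t, a < t < b -> is_derive t 1 F (u t).
Proof.
move=> ab hu; exists (fun x => \int[lebesgue_measure]_(t in `[a, x]) u t)%R.
move=> t /andP[at' tb].
have intu : (@lebesgue_measure R).-integrable `[a, b] (EFin \o u).
  apply: continuous_compact_integrable; first exact: segment_compact.
  apply: continuous_in_subspaceT => s; rewrite inE /= in_itv /= => sab.
  exact: hu.
have ct : {for t, continuous u} by apply: hu; rewrite !ltW.
exact: derive1_is_derive (continuous_FTC1_closed tb intu at' ct).
Qed.

Lemma local_antiderivativeC (u : R -> C) a b : a < b ->
  (forall t, a <= t <= b -> ccont u t) ->
  exists F, forall t, a < t < b -> rd F t (u t).
Proof.
move=> ab hu.
have [|F1 h1] := @local_antiderivative (fun s => Re (u s)) a b ab.
  by move=> t tab; exact/ccont_Re/hu.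
have [|F2 h2] := @local_antiderivative (fun s => Im (u s)) a b ab.
  by move=> t tab; exact/ccont_Im/hu.
exists (fun t => (F1 t +i* F2 t)%C) => t tab; split; [exact: h1|exact: h2].
Qed.

Lemma rd_diff_unique (U V u : R -> C) a b :
  (forall t, (a <= t <= b) || (b <= t <= a) -> rd U t (u t) /\ rd V t (u t)) ->
  U b - U a = V b - V a.
Proof.
wlog ab : a b / a <= b => [H h|h].
  have [ab|/ltW ba] := leP a b; first exact: H.
  apply: oppr_inj; rewrite !opprB; apply: H => // t tab; apply: h.
  by rewrite orbC.
have := @rd_mean_value_cst (fun t => U t - V t) (fun=> 0) 0 a b ab.
rewrite mul0r => H; apply/subr0_eq/eqP; rewrite -cabs_eq0 eq_le cabs_ge0 andbT.
have -> : U b - U a - (V b - V a) = U b - V b - (U a - V a) by ring.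
apply: H => t tab; last by rewrite cabs0.
by have [|hU hV] := h t; rewrite ?tab//; have := rdB hU hV; rewrite subrr.
Qed.

(* Possibly unbounded, so as to cover the horizontal lines and the vertical half-lines. *)
Definition open_itv (D : set R) :=
  (forall t, D t -> exists a b, [/\ D a, D b & a < t < b]) /\
  (forall a b t, D a -> D b -> a <= t <= b -> D t).

Lemma open_itvT : open_itv setT.
Proof.
by split=> // t _; exists (t - 1), (t + 1); split=> //; rewrite ltrBlDr ltrDl ltr01.
Qed.

Lemma open_itv_pos : open_itv [set t | 0 < t].
Proof.
split=> [t /= t0|a b t /= a0 _ /andP[ab _]]; last exact: lt_le_trans ab.
exists (t / 2), (t + 1); split; rewrite /= ?divr_gt0 ?addr_gt0//.
by apply/andP; split; lra.
Qed.

Definition antider (D : set R) (u U : R -> C) := forall t, D t -> rd U t (u t).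

(** The fundamental theorem gives antiderivatives inside compact intervals only. Normalized to
    vanish at a common point [c], two of them agree where both are defined, so that they glue. *)
Lemma antider_exists (D : set R) (u : R -> C) : open_itv D ->
  (forall t, D t -> ccont u t) -> exists U, antider D u U.
Proof.
move=> [oD cD] hu.
have [[c Dc]|nD] := pselect (exists c, D c); last first.
  by exists (fun=> 0) => t Dt; exfalso; apply: nD; exists t.
(* For [t] in [D] exactly one [v] satisfies [P t]: the value at [t] of any local antiderivative
   vanishing at [c]. The global one selects it. *)
pose P t v := exists a b F, [/\ D a, D b, a < t < b, a < c < b &
  (forall s, a < s < b -> rd F s (u s)) /\ v = F t - F c].
have exP t : D t -> exists a b F, [/\ D a, D b, a < t < b, a < c < b &
    (forall s, a < s < b -> rd F s (u s))].
  move=> Dt; have [a1 [b1 [Da1 Db1 /andP[a1t b1t]]]] := oD t Dt.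
  have [a2 [b2 [Da2 Db2 /andP[a2t b2t]]]] := oD c Dc.
  pose a := Num.min a1 a2; pose b := Num.max b1 b2.
  have Da : D a by rewrite /a; case: (leP a1 a2).
  have Db : D b by rewrite /b; case: (leP b1 b2).
  have hat : a < t < b by rewrite gt_min lt_max a1t b1t.
  have hac : a < c < b by rewrite gt_min lt_max a2t b2t !orbT.
  have ab : a < b by case/andP: hat => /lt_trans; apply.
  have [|F hF] := @local_antiderivativeC u a b ab.
    by move=> s sab; apply: hu; apply: cD sab.
  by exists a, b, F.
exists (fun t => xget 0 (P t)) => t Dt.
have [a [b [F [Da Db hat hac hF]]]] := exP t Dt.
have key s : a < s < b -> xget 0 (P s) = F s - F c.
  move=> sab; have : P s (xget 0 (P s)).
    by apply: (@xgetPex _ 0 (P s)); exists (F s - F c), a, b, F.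
  move=> [a' [b' [F' [_ _ sab' cab' [hF' ->]]]]].
  apply: (@rd_diff_unique F' F u) => x xs; split; [apply: hF'|apply: hF];
    move: sab' cab' sab hac xs => /andP[? ?] /andP[? ?] /andP[? ?] /andP[? ?];
    by case/orP => /andP[h1 h2]; apply/andP; split;
      ((apply: lt_le_trans h1; done) || (apply: le_lt_trans h2 _; done)).
have hb : rd (fun s => F s - F c) t (u t).
  by apply: rd_eq (rdB (hF t hat) (rd_cst (F c) t)) _; rewrite subr0.
case: hb => hb1 hb2.
have nr : \near t, a < t < b.
  case/andP: hat => at' tb; near=> s; apply/andP; split; near: s.
    exact: lt_nbhsr.
  exact: lt_nbhsl.
split.
  by apply: near_eq_is_derive hb1; near do rewrite key//.
by apply: near_eq_is_derive hb2; near do rewrite key//.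
Unshelve. all: by end_near. Qed.

(** The chosen antiderivative depends on [D] and [u] but not on the endpoints, so additivity and
    antisymmetry in the endpoints are ring identities that hold for every [u]. *)
Definition cint (D : set R) (u : R -> C) (a b : R) : C :=
  let U := xget (fun=> 0) [set U | antider D u U] in U b - U a.

Lemma cintE D u U a b : open_itv D -> antider D u U -> D a -> D b ->
  cint D u a b = U b - U a.
Proof.
move=> [oD cD] hU Da Db; rewrite /cint.
have := xgetPex (fun=> 0 : C) (ex_intro [set U | antider D u U] U hU).
set V := xget _ _ => /= hV; apply: (@rd_diff_unique V U u) => t tab.
suff Dt : D t by split; [exact: hV|exact: hU].
by case/orP: tab; [exact: cD|exact: cD].
Qed.

Lemma cint_antider D u a b : open_itv D -> (forall t, D t -> ccont u t) ->
  exists U, antider D u U /\ cint D u a b = U b - U a.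
Proof.
move=> oD hu; have [U hU] := antider_exists oD hu.
exists (xget (fun=> 0) [set U | antider D u U]); split => //.
exact: (xgetPex (fun=> 0 : C) (ex_intro [set U | antider D u U] U hU)).
Qed.

Lemma cintN D u a b : cint D u a b = - cint D u b a.
Proof. by rewrite /cint; ring. Qed.

Lemma cint_lin D u v c a b : open_itv D -> (forall t, D t -> ccont u t) ->
  (forall t, D t -> ccont v t) -> D a -> D b ->
  cint D (fun t => c * u t + v t) a b = c * cint D u a b + cint D v a b.
Proof.
move=> oD hu hv Da Db.
have [U [hU ->]] := cint_antider a b oD hu; have [V [hV ->]] := cint_antider a b oD hv.
rewrite (cintE (U := fun t => c * U t + V t)) //; first by ring.
by move=> t Dt; apply: rdD; [apply: rdZ; exact: hU|exact: hV].
Qed.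

Lemma cint_le D u M a b : open_itv D -> (forall t, D t -> ccont u t) -> D a -> D b ->
  (forall t, (a <= t <= b) || (b <= t <= a) -> cabs (u t) <= M) ->
  cabs (cint D u a b) <= M * `|b - a|.
Proof.
move=> oD hu.
wlog ab : a b / a <= b => [H Da Db hM|Da Db hM].
  have [ab|/ltW ba] := leP a b; first exact: H.
  rewrite cintN cabsN distrC; apply: H => // t tab; apply: hM.
  by rewrite orbC.
have [U [hU ->]] := cint_antider a b oD hu.
rewrite ger0_norm ?subr_ge0//; apply: (@rd_mean_value_cst U u) => // t tab.
  by apply: hU; case: oD => _; apply; [exact: Da|exact: Db|exact: tab].
by apply: hM; rewrite tab.
Qed.

Lemma ccont_lin c u v t : ccont u t -> ccont v t -> ccont (fun s => c * u s + v s) t.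
Proof.
move=> hu hv e e0.
pose B := cabs c + 1; have B0 : 0 < B by rewrite ltr_wpDl ?cabs_ge0.
have [d1 d10 h1] := hu (e / 2 / B) (divr_gt0 (divr_gt0 e0 (ltr0n _ 2)) B0).
have [d2 d20 h2] := hv (e / 2) (divr_gt0 e0 (ltr0n _ 2)).
exists (Num.min d1 d2) => [|s]; first by rewrite lt_min d10.
rewrite lt_min => /andP[/h1 s1 /h2 s2].
have -> : c * u s + v s - (c * u t + v t) = c * (u s - u t) + (v s - v t) by ring.
apply: le_lt_trans (cabsD _ _) _; rewrite [e]splitr; apply: ler_ltD => //.
rewrite cabsM; apply: (@le_trans _ _ (B * cabs (u s - u t))).
  by apply: ler_wpM2r; [exact: cabs_ge0|rewrite lerDl].
by rewrite mulrC -ler_pdivlMr// ltW.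
Qed.

Lemma ccont_cst c t : ccont (fun=> c) t.
Proof. by move=> e e0; exists 1 => // s _; rewrite subrr cabs0. Qed.

Lemma cint_cst D c a b : open_itv D -> D a -> D b ->
  cint D (fun=> c) a b = c * ofR (b - a).
Proof.
move=> oD Da Db; rewrite (cintE (U := fun t => 0 + c * ofR t)) //.
  by rewrite ofRB; ring.
by move=> t _; exact: rd_affine.
Qed.

Lemma rd_ccont U t l : rd U t l -> ccont U t.
Proof.
move=> /rdP /(_ _ ltr01)[d d0 hd'] e e0.
pose B := cabs l + 1; have B0 : 0 < B by rewrite ltr_wpDl ?cabs_ge0.
exists (Num.min d (e / B)) => [|s]; first by rewrite lt_min d0 divr_gt0.
rewrite lt_min => /andP[wd we].
have := cabsD (U s - U t - l * ofR (s - t)) (l * ofR (s - t)).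
rewrite subrK => /le_lt_trans; apply.
apply: (@le_lt_trans _ _ (B * `|s - t|)).
  by rewrite cabsM cabs_ofR mulrDl addrC lerD2l hd'.
by rewrite mulrC -ltr_pdivlMr.
Qed.

End LineIntegrals.

(** * Goursat's and Morera's theorems on rectangles *)

Section Goursat.
Context {R : realType}.
Local Notation C := (cplx R).
Local Notation Re := (@complex.Re R).
Local Notation Im := (@complex.Im R).

Definition pt (x y : R) : C := ofR x + ci * ofR y.

Lemma Re_pt x y : Re (pt x y) = x. Proof. by rewrite !ReImE; ring. Qed.
Lemma Im_pt x y : Im (pt x y) = y. Proof. by rewrite !ReImE; ring. Qed.
Lemma ptE (z : C) : z = pt (Re z) (Im z). Proof. exact: cplxE. Qed.
Lemma ptB x y x' y' : pt x y - pt x' y' = pt (x - x') (y - y').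
Proof. by rewrite /pt !ofRB; ring. Qed.
Lemma cabs_pt x y : cabs (pt x y) <= `|x| + `|y|.
Proof. by have := cabs_ReIm (pt x y); rewrite Re_pt Im_pt. Qed.

Definition fcont (f : C -> C) (z : C) := forall e : R, 0 < e ->
  exists2 d : R, 0 < d & forall w, cabs (w - z) < d -> cabs (f w - f z) < e.

Definition hcont f y := forall t, ccont (fun t => f (pt t y)) t.
Definition vcont f x := forall t, 0 < t -> ccont (fun t => f (pt x t)) t.

Lemma fcont_hcont f y : (forall t, fcont f (pt t y)) -> hcont f y.
Proof.
move=> hf t e e0; have [d d0 hd'] := hf t e e0; exists d => // s st; apply: hd'.
rewrite ptB subrr; apply: le_lt_trans (cabs_pt _ _) _.
by rewrite normr0 addr0.
Qed.

Lemma fcont_vcont f x : (forall t, 0 < t -> fcont f (pt x t)) -> vcont f x.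
Proof.
move=> hf t t0 e e0; have [d d0 hd'] := hf t t0 e e0; exists d => // s st; apply: hd'.
rewrite ptB subrr; apply: le_lt_trans (cabs_pt _ _) _.
by rewrite normr0 add0r.
Qed.

Definition hint f y a b := cint setT (fun t => f (pt t y)) a b.
Definition vint f x a b := cint [set t | 0 < t] (fun t => f (pt x t)) a b.
(** The counterclockwise contour integral. Each side uses the antiderivative on its whole line or
    half-line, so cutting a rectangle is again an algebraic identity. *)
Definition rint f x1 x2 y1 y2 :=
  hint f y1 x1 x2 + ci * vint f x2 y1 y2 - hint f y2 x1 x2 - ci * vint f x1 y1 y2.

Lemma rint_cutx f x1 x2 y1 y2 x : rint f x1 x2 y1 y2 = rint f x1 x y1 y2 + rint f x x2 y1 y2.
Proof. by rewrite /rint /hint /vint /cint; ring. Qed.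
Lemma rint_cuty f x1 x2 y1 y2 y : rint f x1 x2 y1 y2 = rint f x1 x2 y1 y + rint f x1 x2 y y2.
Proof. by rewrite /rint /hint /vint /cint; ring. Qed.
Lemma rint_flipx f (x1 x2 y1 y2 : R) : rint f x1 x2 y1 y2 = - rint f x2 x1 y1 y2.
Proof. by rewrite /rint /hint /vint /cint; ring. Qed.
Lemma rint_flipy f (x1 x2 y1 y2 : R) : rint f x1 x2 y1 y2 = - rint f x1 x2 y2 y1.
Proof. by rewrite /rint /hint /vint /cint; ring. Qed.

Definition bcont f x1 x2 y1 y2 :=
  [/\ hcont f y1, hcont f y2, vcont f x1 & vcont f x2].

Definition boundary x1 x2 y1 y2 (z : C) :=
  (x1 <= Re z <= x2 /\ (Im z = y1 \/ Im z = y2)) \/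
  (y1 <= Im z <= y2 /\ (Re z = x1 \/ Re z = x2)).

Lemma rint_le f M (x1 x2 y1 y2 : R) : x1 <= x2 -> 0 < y1 -> y1 <= y2 ->
  bcont f x1 x2 y1 y2 -> (forall z, boundary x1 x2 y1 y2 z -> cabs (f z) <= M) ->
  cabs (rint f x1 x2 y1 y2) <= 2 * M * ((x2 - x1) + (y2 - y1)).
Proof.
move=> x12 y10 y12 [hh1 hh2 hv1 hv2] hM; have y20 := lt_le_trans y10 y12.
have le (t a b : R) : a <= b -> (a <= t <= b) || (b <= t <= a) -> a <= t <= b.
  move=> ab /orP[//|/andP[bt ta]].
  by rewrite (le_trans ab bt) (le_trans ta ab).
have B1 y : hcont f y -> y = y1 \/ y = y2 -> cabs (hint f y x1 x2) <= M * (x2 - x1).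
  move=> hc yy; have -> : x2 - x1 = `|x2 - x1| by rewrite ger0_norm ?subr_ge0.
  apply: cint_le => // [|t /(le _ _ _ x12) tx]; first exact: open_itvT.
  by apply: hM; left; rewrite Re_pt Im_pt.
have B2 x : vcont f x -> x = x1 \/ x = x2 -> cabs (vint f x y1 y2) <= M * (y2 - y1).
  move=> hc xx; have -> : y2 - y1 = `|y2 - y1| by rewrite ger0_norm ?subr_ge0.
  apply: cint_le => // [|t /(le _ _ _ y12) tx]; first exact: open_itv_pos.
  by apply: hM; right; rewrite Re_pt Im_pt.
rewrite /rint; apply: le_trans (cabsD _ _) _; rewrite cabsN.
apply: le_trans (lerD (le_trans (cabsD _ _) (lerD (cabsD _ _) (lexx _))) (lexx _)) _.
rewrite cabsN !cabsM cabs_i !mul1r.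
have := B1 _ hh1 (or_introl erefl); have := B1 _ hh2 (or_intror erefl).
have := B2 _ hv1 (or_introl erefl); have := B2 _ hv2 (or_intror erefl).
have -> : 2 * M * (x2 - x1 + (y2 - y1)) = 2 * (M * (x2 - x1)) + 2 * (M * (y2 - y1)) by ring.
move: (M * (x2 - x1)) (M * (y2 - y1)) (cabs (hint _ _ _ _)) (cabs (hint _ _ _ _))
  (cabs (vint _ _ _ _)) (cabs (vint _ _ _ _)) => a b c d e g; clear; lra.
Qed.

Lemma rint_lin c f g (x1 x2 y1 y2 : R) : 0 < y1 -> 0 < y2 ->
  bcont f x1 x2 y1 y2 -> bcont g x1 x2 y1 y2 ->
  rint (fun z => c * f z + g z) x1 x2 y1 y2 = c * rint f x1 x2 y1 y2 + rint g x1 x2 y1 y2.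
Proof.
move=> y10 y20 [a1 a2 a3 a4] [b1 b2 b3 b4]; rewrite /rint /hint /vint.
by rewrite !cint_lin//; [ring|exact: open_itv_pos|exact: open_itvT|exact: open_itv_pos|exact: open_itvT].
Qed.

Lemma bcont_lin c f g (x1 x2 y1 y2 : R) :
  bcont f x1 x2 y1 y2 -> bcont g x1 x2 y1 y2 ->
  bcont (fun z => c * f z + g z) x1 x2 y1 y2.
Proof.
move=> [a1 a2 a3 a4] [b1 b2 b3 b4].
by split=> [t|t|t t0|t t0]; apply: ccont_lin => //; auto.
Qed.

Lemma fcont_bcont f (x1 x2 y1 y2 : R) : 0 < y1 -> 0 < y2 ->
  (forall z : C, 0 < Im z -> fcont f z) -> bcont f x1 x2 y1 y2.
Proof.
move=> y10 y20 hf; split; (apply: fcont_hcont || apply: fcont_vcont) => t *;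
  by apply: hf; rewrite Im_pt.
Qed.

Lemma rd_hline y t : rd (fun t => pt t y) t 1.
Proof.
have := rd_affine (ci * ofR y) 1 t.
by congr rd; apply/funext => s; rewrite mul1r addrC.
Qed.

Lemma rd_vline x t : rd (fun t => pt x t) t ci.
Proof. exact: rd_affine. Qed.

Lemma hint_primitive (f F : C -> C) y a b : (forall t, is_derive (pt t y) 1 F (f (pt t y))) ->
  hint f y a b = F (pt b y) - F (pt a y).
Proof.
move=> hF; rewrite /hint (cintE (U := fun t => F (pt t y)))//; first exact: open_itvT.
by move=> t _; apply: rd_eq (rd_comp (g := fun t => pt t y) (hF t) (rd_hline y t)) _; rewrite mulr1.
Qed.

Lemma vint_primitive (f F : C -> C) x a b : 0 < a -> 0 < b ->
  (forall t, 0 < t -> is_derive (pt x t) 1 F (f (pt x t))) ->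
  ci * vint f x a b = F (pt x b) - F (pt x a).
Proof.
move=> a0 b0 hF; rewrite /vint (cintE (U := fun t => - ci * F (pt x t)))//.
- rewrite -mulrBr mulrA mulrN ciM opprK mul1r //.
- exact: open_itv_pos.
move=> t t0; apply: rd_eq (rdZ (- ci) (rd_comp (g := fun t => pt x t) (hF t t0) (rd_vline x t))) _.
by rewrite mulrCA mulNr ciM opprK mulr1.
Qed.

Lemma rint_primitive (f F : C -> C) (x1 x2 y1 y2 : R) : 0 < y1 -> 0 < y2 ->
  (forall z : C, 0 < Im z -> is_derive z 1 F (f z)) -> rint f x1 x2 y1 y2 = 0.
Proof.
move=> y10 y20 hF; rewrite /rint.
have hh y : 0 < y -> hint f y x1 x2 = F (pt x2 y) - F (pt x1 y).
  by move=> y0; apply: hint_primitive => t; apply: hF; rewrite Im_pt.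
have hv x : ci * vint f x y1 y2 = F (pt x y2) - F (pt x y1).
  by apply: vint_primitive => // t t0; apply: hF; rewrite Im_pt.
by rewrite !hh// !hv; ring.
Qed.

Lemma is_derive_quadratic (a b z : C) :
  is_derive z 1 (fun z : C => a * z + b / 2 * (z * z)) (a + b * z).
Proof.
apply/is_derive_epsP => e e0; pose B := cabs (b / 2) + 1.
have B0 : 0 < B by rewrite ltr_wpDl ?cabs_ge0.
exists (e / B) => [|w we]; first by rewrite divr_gt0.
have -> : a * w + b / 2 * (w * w) - (a * z + b / 2 * (z * z)) - (a + b * z) * (w - z) =
    b / 2 * (w - z) * (w - z) by field.
rewrite cabsM; apply: ler_wpM2r; first exact: cabs_ge0.
rewrite cabsM; apply: (@le_trans _ _ (B * cabs (w - z))).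
  by apply: ler_wpM2r; [exact: cabs_ge0|rewrite lerDl].
by rewrite mulrC -ler_pdivlMr// ltW.
Qed.

Lemma is_derive_fcont (f : C -> C) (z l : C) : is_derive z 1 f l -> fcont f z.
Proof.
move=> /is_derive_epsP /(_ _ ltr01)[d d0 hd'] e e0.
pose B := cabs l + 1; have B0 : 0 < B by rewrite ltr_wpDl ?cabs_ge0.
exists (Num.min d (e / B)) => [|w]; first by rewrite lt_min d0 divr_gt0.
rewrite lt_min => /andP[wd we].
have := cabsD (f w - f z - l * (w - z)) (l * (w - z)).
rewrite subrK => /le_lt_trans; apply.
apply: (@le_lt_trans _ _ (B * cabs (w - z))).
  by rewrite cabsM mulrDl addrC lerD2l hd'.
by rewrite mulrC -ltr_pdivlMr.
Qed.

Lemma rint_affine (a b : C) (x1 x2 y1 y2 : R) : 0 < y1 -> 0 < y2 ->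
  rint (fun z => a + b * z) x1 x2 y1 y2 = 0.
Proof.
move=> y10 y20; exact: (rint_primitive x1 x2 y10 y20 (fun z _ => is_derive_quadratic a b z)).
Qed.

Lemma fcont_affine (a b : C) z : fcont (fun z => a + b * z) z.
Proof.
have h : is_derive z 1 (fun z : C => a + b * z) b; last exact: is_derive_fcont h.
apply/is_derive_epsP => e e0; exists 1 => // w _.
have -> : a + b * w - (a + b * z) - b * (w - z) = 0 by ring.
by rewrite cabs0 mulr_ge0 ?cabs_ge0 ?ltW.
Qed.

Lemma geometric_lt (a e : R) : 0 < e -> exists n, a / 2 ^+ n < e.
Proof.
move=> e0; have [n hn] : exists n : nat, `|a| / e < n%:R.
  by exists (Num.trunc (`|a| / e)).+1; apply: truncnS_gt.
exists n; rewrite ltr_pdivrMr ?exprn_gt0// mulrC -ltr_pdivrMr//.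
apply: (@le_lt_trans _ _ (`|a| / e)).
  by rewrite ler_wpM2r ?invr_ge0 ?ler_norm// ltW.
apply: lt_trans hn _.
by rewrite -natrX ltr_nat ltn_expl.
Qed.

(* Bisection: the sub-rectangle at stage [n] has sides [w / 2 ^ n] and [h / 2 ^ n]
   and carries at least a quarter of the previous integral. *)
Lemma goursat (f : C -> C) (x1 x2 y1 y2 : R) : x1 <= x2 -> 0 < y1 -> y1 <= y2 ->
  (forall z : C, 0 < Im z -> fcont f z) ->
  (forall z : C, x1 <= Re z <= x2 -> y1 <= Im z <= y2 -> exists l, is_derive z 1 f l) ->
  rint f x1 x2 y1 y2 = 0.
Proof.
move=> x12 y10 y12 cf df; pose w := x2 - x1; pose h := y2 - y1.
have w0 : 0 <= w by rewrite subr_ge0.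
have h0 : 0 <= h by rewrite subr_ge0.
pose W n := w / 2 ^+ n; pose H n := h / 2 ^+ n.
have W0 n : 0 <= W n by rewrite divr_ge0// exprn_ge0.
have H0 n : 0 <= H n by rewrite divr_ge0// exprn_ge0.
have WS n : W n = W n.+1 + W n.+1.
  by rewrite /W exprS; field; rewrite expf_neq0.
have HS n : H n = H n.+1 + H n.+1.
  by rewrite /H exprS; field; rewrite expf_neq0.
pose I n (p : R * R) := rint f p.1 (p.1 + W n) p.2 (p.2 + H n).
have step n p : exists q : R * R,
    [/\ (q.1 = p.1 \/ q.1 = p.1 + W n.+1), (q.2 = p.2 \/ q.2 = p.2 + H n.+1) &
        cabs (I n p) <= 4 * cabs (I n.+1 q)].
  have E : I n p = I n.+1 p + I n.+1 (p.1 + W n.+1, p.2)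
      + (I n.+1 (p.1, p.2 + H n.+1) + I n.+1 (p.1 + W n.+1, p.2 + H n.+1)).
    rewrite /I /= (WS n) (HS n) !addrA (rint_cuty _ _ _ _ _ (p.2 + H n.+1)).
    set x := p.1; set y := p.2; set a := W n.+1; set b := H n.+1.
    by rewrite (rint_cutx f x (x + a + a) y (y + b) (x + a))
      (rint_cutx f x (x + a + a) (y + b) (y + b + b) (x + a)) !addrA.
  apply/not_existsP => hn.
  have k q : (q.1 = p.1 \/ q.1 = p.1 + W n.+1) -> (q.2 = p.2 \/ q.2 = p.2 + H n.+1) ->
      4 * cabs (I n.+1 q) < cabs (I n p).
    by move=> a b; rewrite ltNge; apply/negP => c; apply: (hn q).
  have k1 := k p (or_introl erefl) (or_introl erefl).
  have k2 := k (p.1 + W n.+1, p.2) (or_intror erefl) (or_introl erefl).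
  have k3 := k (p.1, p.2 + H n.+1) (or_introl erefl) (or_intror erefl).
  have k4 := k (p.1 + W n.+1, p.2 + H n.+1) (or_intror erefl) (or_intror erefl).
  have : cabs (I n p) <= cabs (I n.+1 p) + cabs (I n.+1 (p.1 + W n.+1, p.2)) +
      (cabs (I n.+1 (p.1, p.2 + H n.+1)) + cabs (I n.+1 (p.1 + W n.+1, p.2 + H n.+1))).
    by rewrite E; apply: le_trans (cabsD _ _) _; apply: lerD; exact: cabsD.
  suff : forall u v x y z : R, 4 * v < u -> 4 * x < u -> 4 * y < u -> 4 * z < u ->
      u <= v + x + (y + z) -> (0 : R) < 0.
    by move=> hh k5; have := hh _ _ _ _ _ k1 k2 k3 k4 k5; rewrite ltxx.
  by clear; move=> u v x y z; lra.
have {step}[g hg] : exists g : nat -> R * R -> R * R, forall n p,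
    [/\ ((g n p).1 = p.1 \/ (g n p).1 = p.1 + W n.+1),
        ((g n p).2 = p.2 \/ (g n p).2 = p.2 + H n.+1) &
        cabs (I n p) <= 4 * cabs (I n.+1 (g n p))].
  have [g hg] := choice (fun np : nat * (R * R) => step np.1 np.2).
  by exists (fun n p => g (n, p)) => n p; exact: (hg (n, p)).
pose P := fix P n := if n is m.+1 then g m (P m) else (x1, y1).
have PS n : P n.+1 = g n (P n) by [].
have I0 : I 0%N (P 0%N) = rint f x1 x2 y1 y2.
  by rewrite /I /W /H /= expr0 !divr1 /w /h ![_ + (_ - _)]addrC !subrK.
have In n : cabs (rint f x1 x2 y1 y2) <= 4 ^+ n * cabs (I n (P n)).
  elim: n => [|n IH]; first by rewrite -I0 expr0 mul1r.
  apply: le_trans IH _; rewrite exprSr -mulrA ler_pM2l ?exprn_gt0//.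
  by rewrite PS; have [] := hg n (P n).
have nest n : [/\ (P n).1 <= (P n.+1).1, (P n.+1).1 + W n.+1 <= (P n).1 + W n,
    (P n).2 <= (P n.+1).2 & (P n.+1).2 + H n.+1 <= (P n).2 + H n].
  rewrite PS; have [e1 e2 _] := hg n (P n); move: (g n (P n)) e1 e2 => q e1 e2.
  have := W0 n.+1; have := H0 n.+1; rewrite (WS n) (HS n) => a b.
  by case: e1 => ->; case: e2 => ->; split; move: a b; clear; lra.
have nest2 m n : [/\ (P m).1 <= (P (m + n)%N).1, (P (m + n)%N).1 + W (m + n)%N <= (P m).1 + W m,
    (P m).2 <= (P (m + n)%N).2 & (P (m + n)%N).2 + H (m + n)%N <= (P m).2 + H m].
  elim: n => [|n [a b c d]]; first by rewrite addn0.
  have [a' b' c' d'] := nest (m + n)%N; rewrite addnS; split.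
  - exact: le_trans a'.
  - exact: le_trans b.
  - exact: le_trans c'.
  - exact: le_trans d.
have lim (u : nat -> R) (L : nat -> R) : (forall n, 0 <= L n) ->
    (forall m n, u m <= u (m + n)%N /\ u (m + n)%N + L (m + n)%N <= u m + L m) ->
    exists X, forall n, u n <= X <= u n + L n.
  move=> L0 hu; pose E := [set u n | n in [set: nat]].
  have ub m : ubound E (u m + L m).
    move=> _ [n _ <-]; have [a _] := hu n m; have [_ b] := hu m n.
    apply: le_trans a _; rewrite addnC; apply: le_trans b.
    by rewrite lerDl.
  have hs : has_sup E by split; [exists (u 0%N), 0%N|exists (u 0%N + L 0%N); exact: ub].
  exists (sup E) => n; apply/andP; split.
    by apply: ub_le_sup; [exists (u 0%N + L 0%N); exact: ub|exists n].
  by apply: ge_sup (ub n); exists (u 0%N), 0%N.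
have [X hX] := lim (fun n => (P n).1) W W0 (fun m n => let: And4 a b _ _ := nest2 m n in conj a b).
have [Y hY] := lim (fun n => (P n).2) H H0 (fun m n => let: And4 _ _ a b := nest2 m n in conj a b).
have [||l /is_derive_epsP hl] := df (pt X Y).
- by rewrite Re_pt; have := hX 0%N; rewrite /W /= expr0 divr1 /w [_ + (_ - _)]addrC subrK.
- by rewrite Im_pt; have := hY 0%N; rewrite /H /= expr0 divr1 /h [_ + (_ - _)]addrC subrK.
apply/eqP; rewrite -cabs_eq0 eq_le cabs_ge0 andbT; apply/ler_addgt0Pl => e e0.
rewrite addr0; pose S := w + h.
have S0 : 0 <= S by rewrite addr_ge0.
(* The factor [4 ^ n] lost in the bisection cancels the squared size of the small rectangle and
   leaves [2 * e1 * S ^ 2], here at most [e]; as [S] may be 0, the denominator has [S + 1]. *)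
have e10 : 0 < e / (2 * (S + 1) ^+ 2) by rewrite divr_gt0// mulr_gt0// exprn_gt0// ltr_wpDl.
set e1 := e / _ in e10.
have [d d0 hd'] := hl _ e10.
have [n hn] := geometric_lt S d0.
have Sn : W n + H n = S / 2 ^+ n by rewrite /S mulrDl.
have pn0 : 0 < (P n).2.
  by apply: lt_le_trans y10 _; have [_ _] := nest2 0%N n.
have pn0' : 0 < (P n).2 + H n by rewrite ltr_wpDr.
set p1 := (P n).1 in pn0 *; set p2 := (P n).2 in pn0 *.
(* The affine part of [f] at the limit point has a primitive, so subtracting it does not change the
   integral; what remains is at most [e1 * S / 2 ^ n] on the small boundary. *)
pose r z := f z + (-1) * (f (pt X Y) + l * (z - pt X Y)).
have cr : bcont r p1 (p1 + W n) p2 (p2 + H n).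
  have -> : r = (fun z => (-1) * (f (pt X Y) - l * pt X Y + l * z) + f z).
    by apply/funext => z; rewrite /r; ring.
  by apply: bcont_lin; apply: fcont_bcont => // z _; exact: fcont_affine.
have Ir : I n (P n) = rint r p1 (p1 + W n) p2 (p2 + H n).
  have -> : r = (fun z => (-1) * (f (pt X Y) - l * pt X Y + l * z) + f z).
    by apply/funext => z; rewrite /r; ring.
  rewrite rint_lin//; first by rewrite rint_affine// mulr0 add0r.
    by apply: fcont_bcont => // z _; exact: fcont_affine.
  exact: fcont_bcont.
have Ib : cabs (I n (P n)) <= 2 * (e1 * (W n + H n)) * ((p1 + W n - p1) + (p2 + H n - p2)).
  rewrite Ir; apply: rint_le => //; rewrite ?lerDl// => z bz.
  have inQ : p1 <= Re z <= p1 + W n /\ p2 <= Im z <= p2 + H n.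
    by case: bz => -[h1 h2]; split => //; case: h2 => ->; rewrite lexx lerDl ?W0 ?H0.
  have zd : cabs (z - pt X Y) <= W n + H n.
    rewrite {1}(ptE z) ptB; apply: le_trans (cabs_pt _ _) _.
    case: inQ => /andP[a1 a2] /andP[a3 a4]; have /andP[b1 b2] := hX n; have /andP[b3 b4] := hY n.
    move: a1 a2 a3 a4 b1 b2 b3 b4; rewrite -/p1 -/p2.
    move: (Re z) (Im z) (W n) (H n) => u v W' H' *.
    by apply: lerD; rewrite ler_norml; apply/andP; split; lra.
  have := hd' z; rewrite Sn in zd => /(_ (le_lt_trans zd hn)).
  have -> : f z - f (pt X Y) - l * (z - pt X Y) = r z by rewrite /r; ring.
  by move=> /le_trans; apply; rewrite Sn ler_pM2l.
apply: le_trans (In n) _.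
have : 4 ^+ n * cabs (I n (P n)) <= 2 * e1 * S ^+ 2.
  apply: le_trans (ler_wpM2l _ Ib) _; first by rewrite exprn_ge0.
  rewrite ![_ + _ - _]addrAC !subrr !add0r Sn.
  rewrite le_eqVlt; apply/orP; left; apply/eqP.
  have -> : (4 : R) = 2 ^+ 2 by rewrite -natrX.
  rewrite -exprM mulnC exprM; field.
  by rewrite expf_neq0.
move=> /le_trans; apply; rewrite /e1.
have -> : 2 * (e / (2 * (S + 1) ^+ 2)) * S ^+ 2 = e * (S ^+ 2 / (S + 1) ^+ 2).
  by field; rewrite lt0r_neq0// ltr_wpDl.
rewrite ler_piMr//; first exact: ltW.
rewrite ler_pdivrMr ?mul1r ?exprn_gt0 ?ltr_wpDl//.
have S1 : S <= S + 1 by rewrite lerDl.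
by rewrite lerXn2r// nnegrE// (le_trans S0).
Qed.

(** Rectangles that miss [a] contribute nothing, so the contour shrinks to a small one around [a],
    where continuity bounds [f]. *)
Lemma goursat_except (f : C -> C) (a : C) (x1 x2 y1 y2 : R) : x1 <= x2 -> 0 < y1 -> y1 <= y2 ->
  (forall z : C, 0 < Im z -> fcont f z) ->
  (forall z : C, 0 < Im z -> z != a -> exists l, is_derive z 1 f l) ->
  rint f x1 x2 y1 y2 = 0.
Proof.
move=> x12 y10 y12 cf df.
have good u1 u2 v1 v2 : u1 <= u2 -> 0 < v1 -> v1 <= v2 ->
    ~ (u1 <= Re a <= u2 /\ v1 <= Im a <= v2) -> rint f u1 u2 v1 v2 = 0.
  move=> u12 v10 v12 na; apply: goursat => // z hx hy; apply: df.
    by apply: lt_le_trans v10 _; case/andP: hy.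
  by apply/eqP => za; apply: na; rewrite -za.
have [aQ|aQ] := pselect (x1 <= Re a <= x2 /\ y1 <= Im a <= y2); last exact: good.
case: aQ => /andP[a1 a2] /andP[a3 a4].
have a0 : 0 < Im a := lt_le_trans y10 a3.
have [d d0 hd'] := cf a a0 1 ltr01.
apply/eqP; rewrite -cabs_eq0 eq_le cabs_ge0 andbT; apply/ler_addgt0Pl => e e0.
rewrite addr0.
pose M := cabs (f a) + 1; have M0 : 0 < M by rewrite ltr_wpDl ?cabs_ge0.
(* With [s <= d / 3] the small rectangle stays in the ball where [f] is bounded by [M]; its sides
   are at most [2 * s], so the integral is at most [8 * M * s <= e]. Clipping by [max] and [min]
   handles [a] on or near the boundary. *)
pose s := Num.min (d / 3) (e / (8 * M)).
have s0 : 0 < s by rewrite lt_min !divr_gt0// mulr_gt0.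
pose u1 := Num.max x1 (Re a - s); pose u2 := Num.min x2 (Re a + s).
pose v1 := Num.max y1 (Im a - s); pose v2 := Num.min y2 (Im a + s).
have hu1 : x1 <= u1 /\ Re a - s <= u1 <= Re a.
  rewrite /u1 le_max lexx; split=> //; rewrite le_max lexx orbT ge_max a1; lra.
have hu2 : u2 <= x2 /\ Re a <= u2 <= Re a + s.
  rewrite /u2 ge_min lexx; split=> //; rewrite ge_min lexx orbT le_min a2; lra.
have hv1 : y1 <= v1 /\ Im a - s <= v1 <= Im a.
  rewrite /v1 le_max lexx; split=> //; rewrite le_max lexx orbT ge_max a3; lra.
have hv2 : v2 <= y2 /\ Im a <= v2 <= Im a + s.
  rewrite /v2 ge_min lexx; split=> //; rewrite ge_min lexx orbT le_min a4; lra.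
case: hu1 => hu1 /andP[hu1' hu1'']; case: hu2 => hu2 /andP[hu2' hu2''].
case: hv1 => hv1 /andP[hv1' hv1'']; case: hv2 => hv2 /andP[hv2' hv2''].
have deg v v' u : rint f u u v v' = 0 by rewrite /rint /hint /cint; ring.
have deg' v u u' : rint f u u' v v = 0 by rewrite /rint /vint /cint; ring.
have E1 : rint f x1 x2 y1 y2 = rint f u1 x2 y1 y2.
  rewrite (rint_cutx _ _ _ _ _ u1).
  suff -> : rint f x1 u1 y1 y2 = 0 by rewrite add0r.
  rewrite /u1; case: (leP x1 (Re a - s)) => h; last by rewrite deg.
  by apply: good => //; move=> [/andP[_ h'] _]; move: h' s0; clear; lra.
have E2 : rint f u1 x2 y1 y2 = rint f u1 u2 y1 y2.
  rewrite (rint_cutx _ _ _ _ _ u2).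
  suff -> : rint f u2 x2 y1 y2 = 0 by rewrite addr0.
  rewrite /u2; case: (leP x2 (Re a + s)) => h; first by rewrite deg.
  apply: good => //; first exact: ltW.
  by move=> [/andP[h' _] _]; move: h' s0; clear; lra.
have u12 : u1 <= u2 by apply: le_trans hu2'.
have E3 : rint f u1 u2 y1 y2 = rint f u1 u2 v1 y2.
  rewrite (rint_cuty _ _ _ _ _ v1).
  suff -> : rint f u1 u2 y1 v1 = 0 by rewrite add0r.
  rewrite /v1; case: (leP y1 (Im a - s)) => h; last by rewrite deg'.
  by apply: good => //; move=> [_ /andP[_ h']]; move: h' s0; clear; lra.
have v10 : 0 < v1 := lt_le_trans y10 hv1.
have v12 : v1 <= v2 by apply: le_trans hv2'.
have E4 : rint f u1 u2 v1 y2 = rint f u1 u2 v1 v2.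
  rewrite (rint_cuty _ _ _ _ _ v2).
  suff -> : rint f u1 u2 v2 y2 = 0 by rewrite addr0.
  rewrite /v2; case: (leP y2 (Im a + s)) => h; first by rewrite deg'.
  apply: good => //; [by apply: lt_le_trans a0 _; lra|exact: ltW|].
  by move=> [_ /andP[h' _]]; move: h' s0; clear; lra.
rewrite E1 E2 E3 E4.
apply: (@le_trans _ _ (2 * M * ((u2 - u1) + (v2 - v1)))).
  apply: rint_le => //; first exact: fcont_bcont _ (lt_le_trans v10 v12) cf.
  move=> z bz.
  have inQ : u1 <= Re z <= u2 /\ v1 <= Im z <= v2.
    by case: bz => -[h1 h2]; split => //; case: h2 => ->; rewrite lexx ?u12 ?v12.
  have zd : cabs (z - a) < d.
    apply: le_lt_trans (cabs_ReIm _) _; rewrite ReB ImB.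
    case: inQ => /andP[b1 b2] /andP[b3 b4].
    have sd : s <= d / 3 by rewrite ge_min lexx.
    have : `|Re z - Re a| <= s by rewrite ler_norml; apply/andP; split; lra.
    have : `|Im z - Im a| <= s by rewrite ler_norml; apply/andP; split; lra.
    by move: sd d0; clear; lra.
  have := hd' z zd => h; have := cabsD (f z - f a) (f a).
  rewrite subrK /M; move: h; clear; lra.
have sM : 8 * (M * s) <= e.
  by rewrite mulrA mulrC -ler_pdivlMr ?mulr_gt0// ge_min lexx orbT.
apply: le_trans sM; have -> : 8 * (M * s) = 2 * M * (4 * s) by ring.
apply: ler_wpM2l; first by rewrite mulr_ge0// ltW.
move: hu1' hu2'' hv1' hv2''; clear; lra.
Qed.

Lemma rint_eq0_orient f (x1 x2 y1 y2 : R) :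
  (forall x1 x2 y1 y2, x1 <= x2 -> 0 < y1 -> y1 <= y2 -> rint f x1 x2 y1 y2 = 0) ->
  0 < y1 -> 0 < y2 -> rint f x1 x2 y1 y2 = 0.
Proof.
move=> h y10 y20; have [x12|/ltW x21] := leP x1 x2; have [y12|/ltW y21] := leP y1 y2.
- exact: h.
- by rewrite rint_flipy h// oppr0.
- by rewrite rint_flipx h// oppr0.
- by rewrite rint_flipx rint_flipy h// !oppr0.
Qed.

(** The primitive integrates from [ci] along the line of height 1 and then vertically. Since
    integrals over rectangles vanish, its increment from [z0] to [z] can be taken along two short
    segments near [z0], where [f] is almost constant. *)
Lemma morera_primitive (f : C -> C) : (forall z : C, 0 < Im z -> fcont f z) ->
  (forall x1 x2 y1 y2, x1 <= x2 -> 0 < y1 -> y1 <= y2 -> rint f x1 x2 y1 y2 = 0) ->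
  exists F : C -> C, forall z : C, 0 < Im z -> is_derive z 1 F (f z).
Proof.
move=> cf rf; exists (fun z => hint f 1 0 (Re z) + ci * vint f (Re z) 1 (Im z)).
move=> z0 z00; apply/is_derive_epsP => e e0.
have e20 : 0 < e / 2 by rewrite divr_gt0.
have [d d0 hd'] := cf z0 z00 _ e20.
exists (Num.min (d / 2) (Im z0)) => [|z]; first by rewrite lt_min divr_gt0.
rewrite lt_min => /andP[zd zi].
have z_gt0 : 0 < Im z.
  have := le_lt_trans (ler_Im_cabs (z - z0)) zi; rewrite ImB ltr_norml; lra.
have xd := ler_Re_cabs (z - z0); have yd := ler_Im_cabs (z - z0).
rewrite ReB in xd; rewrite ImB in yd.
have -> : hint f 1 0 (Re z) + ci * vint f (Re z) 1 (Im z) -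
    (hint f 1 0 (Re z0) + ci * vint f (Re z0) 1 (Im z0)) =
    hint f (Im z0) (Re z0) (Re z) + ci * vint f (Re z) (Im z0) (Im z).
  have := rint_eq0_orient (Re z0) (Re z) rf ltr01 z00.
  rewrite /rint => E; apply/subr0_eq; rewrite -[RHS]E /hint /vint /cint; ring.
have hcy : hcont f (Im z0) by apply: fcont_hcont => t; apply: cf; rewrite Im_pt.
have vcx : vcont f (Re z) by apply: fcont_vcont => t t0; apply: cf; rewrite Im_pt.
have between (u v t m : R) : `|v - u| < m -> (u <= t <= v) || (v <= t <= u) -> `|t - u| < m.
  by move=> /ltr_normlP[? ?] /orP[] /andP[? ?]; rewrite ltr_norml; apply/andP; split; lra.
have Hd : cabs (hint f (Im z0) (Re z0) (Re z) - f z0 * ofR (Re z - Re z0))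
    <= e / 2 * `|Re z - Re z0|.
  rewrite -(cint_cst (f z0) open_itvT (I : setT (Re z0)) (I : setT (Re z))).
  rewrite addrC -[- _]mulN1r /hint -(cint_lin (-1) open_itvT)//; last first.
    by move=> t _; exact: ccont_cst.
  apply: cint_le => //; first exact: open_itvT.
    by move=> t _; apply: ccont_lin => //; exact: ccont_cst.
  move=> t /(between _ _ _ _ (le_lt_trans xd zd)) ht.
  rewrite mulN1r addrC; apply: ltW; apply: hd'.
  rewrite [X in _ - X](ptE z0) ptB subrr; apply: le_lt_trans (cabs_pt _ _) _.
  rewrite normr0 addr0; apply: lt_trans ht _; move: d0; clear; lra.
have Vd : cabs (vint f (Re z) (Im z0) (Im z) - f z0 * ofR (Im z - Im z0))
    <= e / 2 * `|Im z - Im z0|.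
  rewrite -(cint_cst (f z0) open_itv_pos (z00 : [set t | 0 < t] (Im z0)) (z_gt0 : [set t | 0 < t] (Im z))).
  rewrite addrC -[- _]mulN1r /vint -(cint_lin (-1) open_itv_pos)//; last first.
    by move=> t _; exact: ccont_cst.
  apply: cint_le => //; first exact: open_itv_pos.
    by move=> t ht; apply: ccont_lin; [exact: ccont_cst|exact: vcx].
  move=> t /(between _ _ _ _ (le_lt_trans yd zd)) ht.
  rewrite mulN1r addrC; apply: ltW; apply: hd'.
  rewrite [X in _ - X](ptE z0) ptB; apply: le_lt_trans (cabs_pt _ _) _.
  move: xd ht zd; clear; lra.
have -> : hint f (Im z0) (Re z0) (Re z) + ci * vint f (Re z) (Im z0) (Im z) -
    f z0 * (z - z0) = (hint f (Im z0) (Re z0) (Re z) - f z0 * ofR (Re z - Re z0)) +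
    ci * (vint f (Re z) (Im z0) (Im z) - f z0 * ofR (Im z - Im z0)).
  have -> : z - z0 = ofR (Re z - Re z0) + ci * ofR (Im z - Im z0).
    by rewrite -ReB -ImB -cplxE.
  ring.
apply: le_trans (cabsD _ _) _; rewrite cabsM cabs_i mul1r.
apply: le_trans (lerD Hd Vd) _; rewrite -mulrDr.
have -> : e * cabs (z - z0) = e / 2 * (2 * cabs (z - z0)) by field.
rewrite ler_pM2l//; move: xd yd; clear; lra.
Qed.

End Goursat.

(** * Cauchy's formula, derivatives, maximum principle, locally uniform limits *)

Section Cauchy.
Context {R : realType}.
Local Notation C := (cplx R).
Local Notation Re := (@complex.Re R).
Local Notation Im := (@complex.Im R).

Lemma ccontM u v t : ccont u t -> ccont v t -> ccont (fun s => u s * v s : C) t.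
Proof.
move=> hu hv e e0.
pose B := cabs (v t) + 1; have B0 : 0 < B by rewrite ltr_wpDl ?cabs_ge0.
pose A := cabs (u t) + 1; have A0 : 0 < A by rewrite ltr_wpDl ?cabs_ge0.
have [d1 d10 h1] := hu (e / 2 / B) (divr_gt0 (divr_gt0 e0 (ltr0n _ 2)) B0).
have [d2 d20 h2] := hv (e / 2 / A) (divr_gt0 (divr_gt0 e0 (ltr0n _ 2)) A0).
have [d3 d30 h3] := hv 1 ltr01.
exists (Num.min (Num.min d1 d2) d3) => [|s]; first by rewrite !lt_min d10 d20.
rewrite !lt_min => /andP[/andP[/h1 s1 /h2 s2] /h3 s3].
have -> : u s * v s - u t * v t = (u s - u t) * v s + u t * (v s - v t) by ring.
apply: le_lt_trans (cabsD _ _) _; rewrite !cabsM [e]splitr.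
have vB : cabs (v s) <= B.
  have := cabsD (v s - v t) (v t); rewrite subrK => /le_trans; apply.
  by rewrite /B addrC lerD2l ltW.
apply: ler_ltD.
  apply: le_trans (ler_wpM2l (cabs_ge0 _) vB) _.
  by rewrite -ler_pdivlMr// ltW.
apply: (@le_lt_trans _ _ (A * cabs (v s - v t))).
  by apply: ler_wpM2r; [exact: cabs_ge0|rewrite lerDl].
by rewrite mulrC -ltr_pdivlMr.
Qed.

Lemma ccontV u t : u t != 0 -> ccont u t -> ccont (fun s => (u s)^-1 : C) t.
Proof.
move=> u0 hu e e0; pose c := cabs (u t); have c0 : 0 < c by rewrite cabs_gt0.
have q0 : 0 < e * c * c / 2 by rewrite divr_gt0// !mulr_gt0.
have [d1 d10 h1] := hu _ q0.
have [d2 d20 h2] := hu (c / 2) (divr_gt0 c0 (ltr0n _ 2)).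
exists (Num.min d1 d2) => [|s]; first by rewrite !lt_min d10 d20.
rewrite !lt_min => /andP[/h1 s1 /h2 s2].
have us : c / 2 < cabs (u s).
  have := cabsD (u t - u s) (u s); rewrite subrK cabsB -/c.
  by move: s2; clearbody c; move: (cabs (u s - u t)) (cabs (u s)) => x y; lra.
have us0 : u s != 0 by rewrite -cabs_gt0; apply: lt_trans us; rewrite divr_gt0.
have -> : (u s)^-1 - (u t)^-1 = - (u s - u t) / (u s * u t) by field; rewrite ?us0 ?u0.
rewrite cabsM cabsN cabsV cabsM ltr_pdivrMr; last by rewrite mulr_gt0// cabs_gt0.
apply: lt_trans s1 _; rewrite -/c.
have -> : e * c * c / 2 = e * (c / 2 * c) by ring.
by rewrite ltr_pM2l// ltr_pM2r.
Qed.

Lemma ccontX u t n : ccont u t -> ccont (fun s => u s ^+ n : C) t.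
Proof.
move=> hu; elim: n => [|n IH]; first exact: ccont_cst.
have := ccontM hu IH; congr ccont.
by apply/funext => s; rewrite exprS.
Qed.

Definition kz n (a z : C) : C := (z - a)^-1 ^+ n.

Lemma bcont_kz n a (x1 x2 y1 y2 : R) f : bcont f x1 x2 y1 y2 ->
  Im a != y1 -> Im a != y2 -> Re a != x1 -> Re a != x2 ->
  bcont (fun z => f z * kz n a z) x1 x2 y1 y2.
Proof.
move=> [h1 h2 v1 v2] i1 i2 r1 r2.
have hh y : hcont f y -> Im a != y -> hcont (fun z => f z * kz n a z) y.
  move=> hf ay t; apply: ccontM; first exact: hf.
  apply: ccontX; apply: ccontV; last first.
    have := rd_ccont (rd_affine (ci * ofR y - a) 1 t).
    by congr ccont; apply/funext => s; rewrite /pt; ring.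
  apply/eqP => /(congr1 Im); rewrite ImB Im_pt Im0 => /subr0_eq E.
  by rewrite E eqxx in ay.
have vv x : vcont f x -> Re a != x -> vcont (fun z => f z * kz n a z) x.
  move=> hf ay t t0; apply: ccontM; first exact: hf.
  apply: ccontX; apply: ccontV; last first.
    have := rd_ccont (rd_affine (ofR x - a) ci t).
    by congr ccont; apply/funext => s; rewrite /pt; ring.
  apply/eqP => /(congr1 Re); rewrite ReB Re_pt Re0 => /subr0_eq E.
  by rewrite E eqxx in ay.
by split; auto.
Qed.

Definition interior4 (x1 x2 y1 y2 : R) (a : C) :=
  x1 < Re a < x2 /\ y1 < Im a < y2.

Lemma interior_bcont_kz n a (x1 x2 y1 y2 : R) f : bcont f x1 x2 y1 y2 ->
  interior4 x1 x2 y1 y2 a -> bcont (fun z => f z * kz n a z) x1 x2 y1 y2.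
Proof.
move=> hf [/andP[a1 a2] /andP[a3 a4]].
by apply: bcont_kz => //; rewrite ?(gt_eqF a1) ?(lt_eqF a2) ?(gt_eqF a3) ?(lt_eqF a4).
Qed.

Lemma interior_dist a (x1 x2 y1 y2 : R) : interior4 x1 x2 y1 y2 a ->
  exists2 r : R, 0 < r & (forall z, boundary x1 x2 y1 y2 z -> r <= cabs (z - a)) /\
    (forall b, cabs (b - a) < r -> interior4 x1 x2 y1 y2 b).
Proof.
move=> [/andP[a1 a2] /andP[a3 a4]].
pose r := Num.min (Num.min (Re a - x1) (x2 - Re a)) (Num.min (Im a - y1) (y2 - Im a)).
exists r; first by rewrite !lt_min !subr_gt0 a1 a2 a3.
have [r1 r2 r3 r4] : [/\ r <= Re a - x1, r <= x2 - Re a, r <= Im a - y1 & r <= y2 - Im a].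
  by rewrite /r !ge_min !lexx !orbT.
clearbody r; split=> [z bz|b ba].
  have := ler_Re_cabs (z - a); have := ler_Im_cabs (z - a); rewrite ReB ImB.
  move=> /ler_normlP[h1 h2] /ler_normlP[h3 h4].
  by case: bz => -[_ [E|E]]; rewrite ?E in h1 h2 h3 h4; lra.
have := ler_Re_cabs (b - a); have := ler_Im_cabs (b - a); rewrite ReB ImB.
move=> /ler_normlP[h1 h2] /ler_normlP[h3 h4].
by split; apply/andP; split; lra.
Qed.

Lemma bcont_bounded f (x1 x2 y1 y2 : R) : bcont f x1 x2 y1 y2 -> x1 <= x2 -> 0 < y1 -> y1 <= y2 ->
  exists2 M, 0 < M & forall z, boundary x1 x2 y1 y2 z -> cabs (f z) <= M.
Proof.
move=> [h1 h2 v1 v2] x12 y10 y12.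
have vp x t : vcont f x -> y1 <= t <= y2 -> ccont (fun t => f (pt x t)) t.
  by move=> hv /andP[ty _]; apply: hv; apply: lt_le_trans ty.
have [M1 [p1 q1]] := ccont_bounded x12 (fun t _ => h1 t).
have [M2 [p2 q2]] := ccont_bounded x12 (fun t _ => h2 t).
have [M3 [p3 q3]] := ccont_bounded y12 (fun t => vp x1 t v1).
have [M4 [p4 q4]] := ccont_bounded y12 (fun t => vp x2 t v2).
exists (M1 + M2 + M3 + M4 + 1); first lra.
move=> z bz; rewrite (ptE z); case: bz => -[zr [E|E]]; rewrite E.
- by apply: le_trans (q1 _ zr) _; lra.
- by apply: le_trans (q2 _ zr) _; lra.
- by apply: le_trans (q3 _ zr) _; lra.
- by apply: le_trans (q4 _ zr) _; lra.
Qed.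

(** The Taylor remainder of the Cauchy kernel in its parameter; the exponents 1 and 2 are those met
    when a Cauchy integral is differentiated twice. The constant 8 covers both, being [2 <= 8] for
    the first and [6 + 2] for the second. *)
Lemma kz_estimate n (r : R) (a w z : C) : (n = 1%N \/ n = 2%N) -> 0 < r ->
  r <= cabs (z - a) -> cabs (w - a) <= r / 2 ->
  cabs (kz n w z - kz n a z - n%:R * (w - a) * kz n.+1 a z) <=
    8 / r ^+ n.+2 * cabs (w - a) ^+ 2.
Proof.
move=> hn r0; rewrite /kz; set t := z - a; set d := w - a => ht hd'.
have -> : z - w = t - d by rewrite /t /d; ring.
have td : r / 2 <= cabs (t - d).
  have := cabsD (t - d) d; rewrite subrK.
  by move: ht hd'; move: (cabs t) (cabs d) (cabs (t - d)) => x y v; lra.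
have t0 : t != 0 by rewrite -cabs_gt0 (lt_le_trans r0).
have td0 : t - d != 0 by rewrite -cabs_gt0 (lt_le_trans _ td)// divr_gt0.
have ti : cabs t^-1 <= r^-1 by rewrite cabsV lef_pV2 ?posrE// (lt_le_trans r0).
have tdi : cabs (t - d)^-1 <= 2 / r.
  by rewrite cabsV -invf_div lef_pV2 ?posrE ?divr_gt0// (lt_le_trans _ td)// divr_gt0.
have i0 : 0 <= r^-1 by rewrite invr_ge0 ltW.
have [p0 p1] : 0 <= cabs t^-1 /\ 0 <= cabs (t - d)^-1 by rewrite !cabs_ge0.
case: hn => ->.
  have -> : (t - d)^-1 ^+ 1 - t^-1 ^+ 1 - 1%:R * d * t^-1 ^+ 2 =
    (t^-1 ^+ 2 * (t - d)^-1) * d ^+ 2 by field; rewrite ?t0 ?td0.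
  rewrite cabsM cabsX; apply: ler_wpM2r; first by rewrite exprn_ge0 ?cabs_ge0.
  rewrite cabsM cabsX; apply: (@le_trans _ _ (r^-1 ^+ 2 * (2 / r))).
    by apply: ler_pM => //; [rewrite exprn_ge0|rewrite lerXn2r// nnegrE].
  have -> : r^-1 ^+ 2 * (2 / r) = 2 / r ^+ 3 by field; rewrite gt_eqF.
  by apply: ler_wpM2r; rewrite ?invr_ge0 ?exprn_ge0 ?ler_nat// ltW.
have -> : (t - d)^-1 ^+ 2 - t^-1 ^+ 2 - 2%:R * d * t^-1 ^+ 3 =
  (3 * (t^-1 ^+ 3 * (t - d)^-1) + d * (t^-1 ^+ 3 * (t - d)^-1 ^+ 2)) * d ^+ 2.
  by field; rewrite ?t0 ?td0.
rewrite cabsM cabsX; apply: ler_wpM2r; first by rewrite exprn_ge0 ?cabs_ge0.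
apply: le_trans (cabsD _ _) _.
have c3 : cabs (3 : C) = 3 by rewrite -(ofR_nat 3) cabs_ofR ger0_norm.
have E1 : cabs (3 * (t^-1 ^+ 3 / (t - d))) = 3 * (cabs t^-1 ^+ 3 * cabs (t - d)^-1).
  by rewrite (cabsM 3) (cabsM (t^-1 ^+ 3)) cabsX c3.
have E2 : cabs (d * (t^-1 ^+ 3 * (t - d)^-1 ^+ 2)) = cabs d * (cabs t^-1 ^+ 3 * cabs (t - d)^-1 ^+ 2).
  by rewrite (cabsM d) (cabsM (t^-1 ^+ 3)) !cabsX.
rewrite E1 E2.
have T3 : cabs t^-1 ^+ 3 <= r^-1 ^+ 3 by rewrite lerXn2r// nnegrE.
have T30 : 0 <= cabs t^-1 ^+ 3 by rewrite exprn_ge0.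
have D2 : cabs (t - d)^-1 ^+ 2 <= (2 / r) ^+ 2.
  by rewrite lerXn2r// nnegrE// divr_ge0// ltW.
apply: (@le_trans _ _ (3 * (r^-1 ^+ 3 * (2 / r)) + r / 2 * (r^-1 ^+ 3 * (2 / r) ^+ 2))).
  apply: lerD; first by apply: ler_wpM2l => //; apply: ler_pM.
  apply: ler_pM => //; [exact: cabs_ge0|by rewrite mulr_ge0// exprn_ge0|].
  by apply: ler_pM => //; rewrite exprn_ge0.
by rewrite le_eqVlt; apply/orP; left; apply/eqP; field; rewrite gt_eqF.
Qed.

Definition cauchy_int n (x1 x2 y1 y2 : R) f (a : C) := rint (fun z => f z * kz n a z) x1 x2 y1 y2.

Lemma is_derive_cauchy_int n f (x1 x2 y1 y2 : R) (a : C) : (n = 1%N \/ n = 2%N) ->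
  0 < y1 -> bcont f x1 x2 y1 y2 -> interior4 x1 x2 y1 y2 a ->
  is_derive a 1 (cauchy_int n x1 x2 y1 y2 f) (n%:R * cauchy_int n.+1 x1 x2 y1 y2 f a).
Proof.
move=> hn y10 cf aQ.
have [r r0 [hr hr']] := interior_dist aQ.
have [x12 y12] : x1 <= x2 /\ y1 <= y2.
  by case: aQ => /andP[p q] /andP[p' q']; split; apply: ltW; apply: lt_trans; eauto.
have [M M0 hM] := bcont_bounded cf x12 y10 y12.
have y20 : 0 < y2 := lt_le_trans y10 y12.
apply/is_derive_epsP => e e0.
(* The integrated remainder is at most [(B - 1)] times the square of [cabs (w - a)]; the summand 1
   keeps [B] positive. *)
pose B := 2 * (M * (8 / r ^+ n.+2)) * ((x2 - x1) + (y2 - y1)) + 1.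
have B0 : 0 < B.
  have S0 : 0 <= (x2 - x1) + (y2 - y1) by rewrite addr_ge0 ?subr_ge0.
  have r40 : 0 <= 8 / r ^+ n.+2 by rewrite divr_ge0// exprn_ge0// ltW.
  by rewrite /B ltr_wpDl// mulr_ge0// mulr_ge0// mulr_ge0// ltW.
exists (Num.min (r / 2) (e / B)) => [|w]; first by rewrite lt_min !divr_gt0.
rewrite lt_min => /andP[w1 w2].
have wQ : interior4 x1 x2 y1 y2 w.
  by apply: hr'; apply: lt_trans w1 _; rewrite ltr_pdivrMr// ltr_pMr// ltr1n.
pose K z := f z * (kz n w z - kz n a z - n%:R * (w - a) * kz n.+1 a z).
have b1 := interior_bcont_kz n cf wQ.
have b2 := interior_bcont_kz n cf aQ.
have b3 := interior_bcont_kz n.+1 cf aQ.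
have KE : K = (fun z => - (n%:R * (w - a)) * (f z * kz n.+1 a z) +
    ((-1) * (f z * kz n a z) + f z * kz n w z)).
  by apply/funext => z; rewrite /K; ring.
have cK : bcont K x1 x2 y1 y2 by rewrite KE; do 2! apply: bcont_lin => //.
have -> : cauchy_int n x1 x2 y1 y2 f w - cauchy_int n x1 x2 y1 y2 f a -
    n%:R * cauchy_int n.+1 x1 x2 y1 y2 f a * (w - a) = rint K x1 x2 y1 y2.
  rewrite KE (rint_lin _ y10 y20 b3 (bcont_lin (-1) b2 b1)).
  rewrite (rint_lin (-1) y10 y20 b2 b1) /cauchy_int.
  move: (rint (fun z => f z * kz n.+1 a z) x1 x2 y1 y2) => u.
  move: (rint (fun z => f z * kz n a z) x1 x2 y1 y2) => v.
  by move: (rint (fun z => f z * kz n w z) x1 x2 y1 y2) => v'; ring.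
have := @rint_le R K (M * (8 / r ^+ n.+2 * cabs (w - a) ^+ 2)) x1 x2 y1 y2 x12 y10 y12 cK.
have hK z : boundary x1 x2 y1 y2 z -> cabs (K z) <= M * (8 / r ^+ n.+2 * cabs (w - a) ^+ 2).
  move=> bz; rewrite cabsM; apply: ler_pM => //; rewrite ?cabs_ge0//; first exact: hM.
  by apply: kz_estimate => //; [exact: hr|exact: ltW].
move=> /(_ hK) /le_trans; apply.
have -> : 2 * (M * (8 / r ^+ n.+2 * cabs (w - a) ^+ 2)) * (x2 - x1 + (y2 - y1)) =
  (B - 1) * cabs (w - a) * cabs (w - a).
  by rewrite /B; move: (8 / r ^+ n.+2) => q; ring.
apply: ler_wpM2r; first exact: cabs_ge0.
apply: (@le_trans _ _ (B * cabs (w - a))).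
  by apply: ler_wpM2r; [exact: cabs_ge0|rewrite gerBl].
by rewrite mulrC -ler_pdivlMr// ltW.
Qed.

Lemma Im_cint_gt0 D c u (a b : R) : open_itv D -> (forall t, D t -> ccont u t) -> D a -> D b ->
  a < b -> (forall t, a <= t <= b -> 0 < Im (c * u t)) -> 0 < Im (c * cint D u a b).
Proof.
move=> oD hu Da Db ab hI; have [U [hU ->]] := cint_antider a b oD hu.
have h t : a <= t <= b -> is_derive t 1 (fun s => Im (c * U s)) (Im (c * u t)).
  move=> tab; have Dt : D t by case: oD => _; apply; [exact: Da|exact: Db|exact: tab].
  by have [] := rdZ c (hU _ Dt).
have [t||t tab E] := @MVT_segment R (fun s => Im (c * U s)) (fun t => Im (c * u t)) a b (ltW ab).
- by rewrite in_itv/= => /andP[at' tb]; apply: h; rewrite !ltW.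
- by apply: derivable_within_continuous => x /itvP xab; have [] := h x; rewrite ?xab.
rewrite mulrBr ImB E mulr_gt0// ?subr_gt0//; apply: hI.
by move: tab; rewrite in_itv.
Qed.

Lemma Re_inv (w : C) : Re w^-1 = Re w / cabs w ^+ 2.
Proof.
have [->|w0] := eqVneq w 0; first by rewrite invr0 Re0 mul0r.
have -> : w^-1 = cconj w * ofR (cabs w ^+ 2)^-1.
  rewrite ofRV -mul_cconj; field; by rewrite cconj_eq0 w0.
by rewrite !ReImE; ring.
Qed.

Lemma Im_inv (w : C) : Im w^-1 = - Im w / cabs w ^+ 2.
Proof.
have [->|w0] := eqVneq w 0; first by rewrite invr0 Im0 oppr0 mul0r.
have -> : w^-1 = cconj w * ofR (cabs w ^+ 2)^-1.
  rewrite ofRV -mul_cconj; field; by rewrite cconj_eq0 w0.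
by rewrite !ReImE; ring.
Qed.

(** This replaces the value [2 pi i]: each of the four sides contributes a positive imaginary
    part. *)
Lemma cauchy_int1_neq0 (x1 x2 y1 y2 : R) (a : C) : 0 < y1 -> interior4 x1 x2 y1 y2 a ->
  cauchy_int 1 x1 x2 y1 y2 (fun=> 1) a != 0.
Proof.
move=> y10 aQ; have b1 : bcont (fun=> 1 : C) x1 x2 y1 y2.
  by split=> [t|t|t t0|t t0]; exact: ccont_cst.
have [h1 h2 v1 v2] := interior_bcont_kz 1 b1 aQ.
case: (aQ) => /andP[a1 a2] /andP[a3 a4].
have y20 : 0 < y2 by apply: lt_trans y10 _; apply: lt_trans a4.
have y12 := lt_trans a3 a4; have x12 := lt_trans a1 a2.
have abs0 (w : C) : w != 0 -> 0 < (cabs w ^+ 2)^-1.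
  by move=> w0; rewrite invr_gt0 exprn_gt0// cabs_gt0.
have H1 : 0 < Im (1 * hint (fun z => 1 * kz 1 a z) y1 x1 x2).
  apply: Im_cint_gt0 => //; first exact: open_itvT.
  move=> t _; rewrite !mul1r /kz expr1 Im_inv ImB Im_pt; apply: mulr_gt0.
    by rewrite opprB subr_gt0.
  by apply: abs0; apply/eqP => /(congr1 Im); rewrite ImB Im_pt Im0 => /subr0_eq E; move: a3; rewrite E ltxx.
have H2 : 0 < Im ((-1) * hint (fun z => 1 * kz 1 a z) y2 x1 x2).
  apply: Im_cint_gt0 => //; first exact: open_itvT.
  move=> t _; rewrite mul1r mulN1r ImN /kz expr1 Im_inv ImB Im_pt mulNr opprK; apply: mulr_gt0.
    by rewrite subr_gt0.
  by apply: abs0; apply/eqP => /(congr1 Im); rewrite ImB Im_pt Im0 => /subr0_eq E; move: a4; rewrite E ltxx.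
have H3 : 0 < Im (ci * vint (fun z => 1 * kz 1 a z) x2 y1 y2).
  apply: Im_cint_gt0 => //; first exact: open_itv_pos.
  move=> t _; rewrite mul1r ImM Re_ci Im_ci mul0r add0r mul1r.
  rewrite /kz expr1 Re_inv ReB Re_pt; apply: mulr_gt0; first by rewrite subr_gt0.
  by apply: abs0; apply/eqP => /(congr1 Re); rewrite ReB Re_pt Re0 => /subr0_eq E; move: a2; rewrite E ltxx.
have H4 : 0 < Im ((- ci) * vint (fun z => 1 * kz 1 a z) x1 y1 y2).
  apply: Im_cint_gt0 => //; first exact: open_itv_pos.
  move=> t _; rewrite mul1r ImM ReN ImN Re_ci Im_ci oppr0 mul0r add0r mulN1r.
  rewrite /kz expr1 Re_inv ReB Re_pt -mulNr; apply: mulr_gt0; first by rewrite opprB subr_gt0.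
  by apply: abs0; apply/eqP => /(congr1 Re); rewrite ReB Re_pt Re0 => /subr0_eq E; move: a1; rewrite E ltxx.
suff : 0 < Im (cauchy_int 1 x1 x2 y1 y2 (fun=> 1) a).
  by move=> h; apply/eqP => E; rewrite E Im0 ltxx in h.
have -> : cauchy_int 1 x1 x2 y1 y2 (fun=> 1) a =
  1 * hint (fun z => 1 * kz 1 a z) y1 x1 x2 + ci * vint (fun z => 1 * kz 1 a z) x2 y1 y2 +
  ((-1) * hint (fun z => 1 * kz 1 a z) y2 x1 x2 + (- ci) * vint (fun z => 1 * kz 1 a z) x1 y1 y2).
  by rewrite /cauchy_int /rint !mul1r mulN1r mulNr addrA.
by rewrite ImD (ImD (1 * _)) (ImD (-1 * _)) !addr_gt0.
Qed.

Definition holoC (f : C -> C) := forall z : C, 0 < Im z -> exists l, is_derive z 1 f l.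

Lemma holoC_fcont f : holoC f -> forall z : C, 0 < Im z -> fcont f z.
Proof. by move=> h z /h [l]; exact: is_derive_fcont. Qed.

Lemma holoC_primitive_except (f : C -> C) (a : C) :
  (forall z : C, 0 < Im z -> fcont f z) ->
  (forall z : C, 0 < Im z -> z != a -> exists l, is_derive z 1 f l) ->
  exists F : C -> C, forall z : C, 0 < Im z -> is_derive z 1 F (f z).
Proof.
move=> cf df; apply: morera_primitive => // x1 x2 y1 y2 x12 y10 y12.
exact: goursat_except cf df.
Qed.

Lemma holoC_primitive (f : C -> C) : holoC f ->
  exists F : C -> C, forall z : C, 0 < Im z -> is_derive z 1 F (f z).
Proof.
move=> hf; apply: (@holoC_primitive_except _ 0); first exact: holoC_fcont.
by move=> z z0 _; exact: hf.
Qed.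

Lemma rint_eq f g (x1 x2 y1 y2 : R) : (forall t, f (pt t y1) = g (pt t y1)) ->
  (forall t, f (pt t y2) = g (pt t y2)) -> (forall t, f (pt x1 t) = g (pt x1 t)) ->
  (forall t, f (pt x2 t) = g (pt x2 t)) -> rint f x1 x2 y1 y2 = rint g x1 x2 y1 y2.
Proof.
move=> h1 h2 h3 h4; rewrite /rint /hint /vint.
by rewrite (funext h1) (funext h2) (funext h3) (funext h4).
Qed.

Lemma is_derive_diff_quotient (f : C -> C) (a z l : C) : z != a -> is_derive z 1 f l ->
  exists m, is_derive z 1 (fun w => (f w - f a) * (w - a)^-1) m.
Proof.
move=> za [df _].
have d1 := derivableB df (derivable_cst (f a) z 1).
have d2 := derivableB (@derivable_id C C z 1) (derivable_cst a z 1).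
have n0 : (id - cst a : C -> C) z != 0 by rewrite /GRing.add /= subr_eq0.
have d4 := derivableM d1 (derivableV n0 d2).
by exists ('D_1 (fun w => (f w - f a) * (w - a)^-1) z); apply: DeriveDef.
Qed.

Lemma is_derive_parts (f : C -> C) (z l : C) :
  is_derive z 1 f l -> derivable f z 1 /\ 'D_1 f z = l.
Proof. by case. Qed.

Lemma is_derive_mulC (f g : C -> C) (z l m : C) : is_derive z 1 f l -> is_derive z 1 g m ->
  is_derive z 1 (fun w => f w * g w) (l * g z + f z * m).
Proof.
move=> hf hg; apply: is_derive_eq (is_deriveM hf hg) _.
by rewrite /GRing.scale /= addrC [l * _]mulrC.
Qed.

Lemma is_derive_subC (f g : C -> C) (z l m : C) : is_derive z 1 f l -> is_derive z 1 g m ->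
  is_derive z 1 (fun w => f w - g w) (l - m).
Proof. by move=> hf hg; exact: is_deriveB hf hg. Qed.

Lemma is_derive_invC (f : C -> C) (z l : C) : f z != 0 -> is_derive z 1 f l ->
  is_derive z 1 (fun w => (f w)^-1) (- l / (f z * f z)).
Proof.
move=> f0 [df dfE]; apply: (DeriveDef (derivableV f0 df)).
by rewrite (deriveV f0 df) dfE /GRing.scale /= expr2 mulrC mulNr mulrN.
Qed.

Lemma is_derive_near (f g : C -> C) (z l : C) (d : R) : 0 < d ->
  (forall w, cabs (w - z) < d -> f w = g w) -> is_derive z 1 f l -> is_derive z 1 g l.
Proof.
move=> d0 h; apply: near_eq_is_derive; by apply/nbhs_cabsP; exists d.
Qed.

(** With [l] the derivative at [a], this is continuous at [a] and differentiable elsewhere, the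
    situation of [goursat_except]. *)
Definition dquot (f : C -> C) (a l z : C) := if z == a then l else (f z - f a) * (z - a)^-1.

Lemma dquot_derive f (a l z m : C) : z != a -> is_derive z 1 f m ->
  exists n, is_derive z 1 (dquot f a l) n.
Proof.
move=> za hf; have [n hn] := is_derive_diff_quotient za hf.
have d0 : 0 < cabs (a - z) by rewrite cabs_gt0 subr_eq0 eq_sym.
exists n; apply: (is_derive_near d0 _ hn) => w wd; rewrite /dquot; case: eqP => // wa.
by move: wd; rewrite wa ltxx.
Qed.

Lemma dquot_fcont f (a l z : C) : holoC f -> is_derive a 1 f l -> 0 < Im z -> fcont (dquot f a l) z.
Proof.
move=> hf hl z0; have [->|za] := eqVneq z a; last first.
  have [m hm] := hf z z0; have [n hn] := dquot_derive l za hm.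
  exact: is_derive_fcont hn.
move=> e e0; have e20 : 0 < e / 2 by rewrite divr_gt0.
have /is_derive_epsP /(_ _ e20)[d d0 hd'] := hl.
exists d => // w wd; rewrite /dquot eqxx; case: eqP => [_|/eqP wa].
  by rewrite subrr cabs0.
have wa0 : w - a != 0 by rewrite subr_eq0.
have -> : (f w - f a) * (w - a)^-1 - l = (f w - f a - l * (w - a)) * (w - a)^-1 by field.
rewrite cabsM cabsV ltr_pdivrMr ?cabs_gt0//; apply: le_lt_trans (hd' _ wd) _.
by rewrite ltr_pM2r ?cabs_gt0// ltr_pdivrMr// ltr_pMr// ltr1n.
Qed.

(** The integral of the difference quotient vanishes by [goursat_except], and on the boundary the
    quotient splits into the two Cauchy integrals. *)
Lemma cauchy_formula f (x1 x2 y1 y2 : R) (a : C) : 0 < y1 -> holoC f ->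
  interior4 x1 x2 y1 y2 a ->
  cauchy_int 1 x1 x2 y1 y2 f a = f a * cauchy_int 1 x1 x2 y1 y2 (fun=> 1) a.
Proof.
move=> y10 hf aQ.
case: (aQ) => /andP[a1 a2] /andP[a3 a4].
have y20 : 0 < y2 by apply: lt_trans y10 _; apply: lt_trans a4.
have ai : 0 < Im a := lt_trans y10 a3.
have [l hl] := hf a ai.
have bf : bcont f x1 x2 y1 y2 by apply: fcont_bcont => // z; exact: holoC_fcont.
have b1 : bcont (fun=> 1 : C) x1 x2 y1 y2 by split=> [t|t|t t0|t t0]; exact: ccont_cst.
have : rint (dquot f a l) x1 x2 y1 y2 = 0.
  apply: (@goursat_except _ _ a) => //; [exact: ltW (lt_trans a1 a2)|exact: ltW (lt_trans a3 a4)| |].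
    by move=> z z0; exact: dquot_fcont.
  by move=> z z0 za; have [m hm] := hf z z0; exact: dquot_derive hm.
pose g z := (- f a) * (1 * kz 1 a z) + f z * kz 1 a z.
have dE z : z != a -> dquot f a l z = g z.
  by move=> za; rewrite /dquot (negbTE za) /g /kz expr1; ring.
rewrite (@rint_eq _ g) => [|t|t|t|t].
- rewrite rint_lin//; try exact: interior_bcont_kz.
  rewrite -!/(cauchy_int _ _ _ _ _ _ _) mulNr addrC => /subr0_eq.
  by [].
- by apply: dE; apply/eqP => /(congr1 Im); rewrite Im_pt => E; move: a3; rewrite E ltxx.
- by apply: dE; apply/eqP => /(congr1 Im); rewrite Im_pt => E; move: a4; rewrite E ltxx.
- by apply: dE; apply/eqP => /(congr1 Re); rewrite Re_pt => E; move: a1; rewrite E ltxx.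
- by apply: dE; apply/eqP => /(congr1 Re); rewrite Re_pt => E; move: a2; rewrite E ltxx.
Qed.

Lemma interior_square (a : C) : 0 < Im a ->
  interior4 (Re a - 1) (Re a + 1) (Im a / 2) (Im a + 1) a.
Proof. by move=> a0; split; apply/andP; split; lra. Qed.

(** Near [a], [f] is the quotient [P 1 / N 1] of two Cauchy integrals over a fixed rectangle. Both
    can be differentiated twice, hence so can [f]. *)
Lemma holoC_deriv (f g : C -> C) : (forall z : C, 0 < Im z -> is_derive z 1 f (g z)) -> holoC g.
Proof.
move=> hfg a a0; have hf : holoC f by move=> z z0; exists (g z); exact: hfg.
have aQ := interior_square a0.
move: (Re a - 1) (Re a + 1) (Im a + 1) aQ => x1 x2 y2; set y1 := Im a / 2 => aQ.
have y10 : 0 < y1 by rewrite divr_gt0.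
have y20 : 0 < y2 by case: aQ => _ /andP[_]; exact: lt_trans.
have bf : bcont f x1 x2 y1 y2 by apply: fcont_bcont => // z; exact: holoC_fcont.
have b1 : bcont (fun=> 1 : C) x1 x2 y1 y2 by split=> [t|t|t t0|t t0]; exact: ccont_cst.
pose P n := cauchy_int n x1 x2 y1 y2 f; pose N n := cauchy_int n x1 x2 y1 y2 (fun=> 1).
have [r r0 [_ hr]] := interior_dist aQ.
have N0 b : cabs (b - a) < r -> N 1%N b != 0.
  by move=> /hr bQ; exact: cauchy_int1_neq0.
have derP n b : (n = 1%N \/ n = 2%N) -> cabs (b - a) < r ->
    is_derive b 1 (P n) (n%:R * P n.+1 b) /\ is_derive b 1 (N n) (n%:R * N n.+1 b).
  by move=> hn /hr bQ; split; exact: is_derive_cauchy_int.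
(* The quotient rule, where [P 2] and [N 2] are the derivatives of [P 1] and [N 1]. The derivative
   of [N 1] is kept because its constancy has not been established. *)
pose D b := (P 2%N b * N 1%N b - P 1%N b * N 2%N b) * (N 1%N b * N 1%N b)^-1.
have rI : cabs (a - a) < r by rewrite subrr cabs0.
have fE b : cabs (b - a) < r -> f b = P 1%N b * (N 1%N b)^-1.
  move=> br; have bQ := hr _ br; rewrite /P cauchy_formula// mulfK//.
  exact: N0.
have gD b : cabs (b - a) < r -> g b = D b.
  move=> br; have bQ := hr _ br; have b0 : 0 < Im b.
    by case: bQ => _ /andP[h _]; exact: lt_trans h.
  have n0 := N0 _ br.
  have [p1 n1] := derP 1%N b (or_introl erefl) br.
  have h1 := is_derive_mulC p1 (is_derive_invC n0 n1).
  have rb : 0 < r - cabs (b - a) by rewrite subr_gt0.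
  have h2 : is_derive b 1 f (1%:R * P 2 b * (N 1%N b)^-1 +
      P 1%N b * (- (1%:R * N 2 b) / (N 1%N b * N 1%N b))).
    apply: (is_derive_near rb _ h1) => w wd.
    rewrite fE//; have := cabsD (w - b) (b - a).
    by rewrite addrA subrK; move: wd; move: (cabs _) (cabs _) (cabs _) => ? ? ?; lra.
  rewrite -(is_derive_parts (hfg _ b0)).2 (is_derive_parts h2).2 /D.
  by move: (P 1%N b) (P 2 b) (N 2 b) (N 1%N b) n0 => p p' n' n0 *; field.
have [p1 n1] := derP 1%N a (or_introl erefl) rI.
have [p2 n2] := derP 2%N a (or_intror erefl) rI.
have n0 := N0 _ rI.
have n00 : N 1%N a * N 1%N a != 0 by rewrite mulf_neq0.
have dD := is_derive_mulC (is_derive_subC (is_derive_mulC p2 n1) (is_derive_mulC p1 n2))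
  (@is_derive_invC (fun b => N 1%N b * N 1%N b) a _ n00 (is_derive_mulC n1 n1)).
eexists; apply: (is_derive_near r0 _ dD) => w wr.
by rewrite gD.
Qed.

(** The constant depends only on the rectangle and the point; this uniformity in [f] is what allows
    powers of [f] to be inserted afterwards. *)
Lemma cauchy_bound (x1 x2 y1 y2 : R) (a : C) : 0 < y1 -> interior4 x1 x2 y1 y2 a ->
  exists2 K : R, 0 < K & forall f M, holoC f ->
    (forall z, boundary x1 x2 y1 y2 z -> cabs (f z) <= M) -> cabs (f a) <= K * M.
Proof.
move=> y10 aQ.
have [r r0 [hr _]] := interior_dist aQ.
case: (aQ) => /andP[a1 a2] /andP[a3 a4].
have x12 := ltW (lt_trans a1 a2); have y12 := ltW (lt_trans a3 a4).
have y20 : 0 < y2 by apply: lt_le_trans y12.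
have n0 : 0 < cabs (cauchy_int 1 x1 x2 y1 y2 (fun=> 1) a).
  by rewrite cabs_gt0; exact: cauchy_int1_neq0.
set N := cabs _ in n0.
have p0 : 0 < (x2 - x1) + (y2 - y1).
  by rewrite addr_gt0// subr_gt0; [exact: lt_trans a1 a2|exact: lt_trans a3 a4].
exists (2 * r^-1 * ((x2 - x1) + (y2 - y1)) / N).
  by rewrite divr_gt0// !mulr_gt0// invr_gt0.
move=> f M hf hM.
have bf : bcont f x1 x2 y1 y2 by apply: fcont_bcont => // z; exact: holoC_fcont.
have := cauchy_formula y10 hf aQ => /(congr1 (@cabs R)); rewrite cabsM -/N => E.
rewrite mulrAC ler_pdivlMr// -E.
have := @rint_le R (fun z => f z * kz 1 a z) (M / r) x1 x2 y1 y2 x12 y10 y12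
  (interior_bcont_kz 1 bf aQ).
have -> : 2 * (M / r) * (x2 - x1 + (y2 - y1)) = 2 / r * (x2 - x1 + (y2 - y1)) * M by ring.
apply=> z bz; rewrite cabsM /kz expr1; apply: ler_pM; rewrite ?cabs_ge0//; first exact: hM.
by rewrite cabsV lef_pV2 ?posrE//; [exact: hr|apply: lt_le_trans r0 (hr _ bz)].
Qed.

Lemma holoC_pow f n : holoC f -> holoC (fun z => f z ^+ n).
Proof.
move=> hf z z0; have [l hl] := hf z z0.
exists ('D_1 (f ^+ n) z).
have h : derivable (f ^+ n) z 1 by apply: derivableX; case: hl.
have E : (fun z => f z ^+ n) = f ^+ n.
  apply/funext => w; elim: n {h} => [|n IH]; first by rewrite !expr0.
  by rewrite !exprS IH.
by rewrite E; apply: DeriveDef.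
Qed.

(* Landau's trick: the constant of the crude Cauchy bound disappears when it is applied to powers. *)
Lemma max_modulus f M (x1 x2 y1 y2 : R) (a : C) : 0 < y1 -> interior4 x1 x2 y1 y2 a -> holoC f ->
  0 < M -> (forall z, boundary x1 x2 y1 y2 z -> cabs (f z) <= M) -> cabs (f a) <= M.
Proof.
move=> y10 aQ hf M0 hM; have [K K0 hK] := cauchy_bound y10 aQ.
rewrite leNgt; apply/negP => Mf.
pose q := cabs (f a) / M; have q1 : 1 < q by rewrite ltr_pdivlMr// mul1r.
have qK n : q ^+ n <= K.
  rewrite /q expr_div_n ler_pdivrMr ?exprn_gt0// -cabsX.
  apply: (hK (fun z => f z ^+ n)); first exact: holoC_pow.
  move=> z bz; rewrite cabsX lerXn2r ?nnegrE ?cabs_ge0 ?(ltW M0)//; exact: hM.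
(* Bernoulli's inequality: the powers of [q > 1] exceed any constant, against [qK]. *)
have bern n : 1 + n%:R * (q - 1) <= q ^+ n.
  elim: n => [|n IH]; first by rewrite mul0r addr0 expr0.
  rewrite exprS; apply: le_trans (ler_wpM2l (ltW (lt_trans ltr01 q1)) IH).
  rewrite -natr1; have -> : q * (1 + n%:R * (q - 1)) =
    1 + (n%:R + 1) * (q - 1) + n%:R * ((q - 1) * (q - 1)) by ring.
  by rewrite lerDl mulr_ge0// mulr_ge0// subr_ge0 ltW.
pose n := (Num.trunc (K / (q - 1))).+1.
have : K / (q - 1) < n%:R by apply: truncnS_gt.
rewrite ltr_pdivrMr ?subr_gt0// => h.
have := le_trans (bern n) (qK n); move: h; move: (n%:R * (q - 1)) => u; lra.
Qed.

(** Uniform approximation on rectangles gives continuity and vanishing rectangle integrals. By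
    Morera [f] then has a primitive, and the derivative of a holomorphic function is holomorphic. *)
Lemma weierstrass (f : hfun R) :
  (forall x1 x2 y1 y2 e : R, 0 < y1 -> 0 < e -> exists2 g : hfun R, holomorphic g &
    forall z, x1 <= Re (uhp_val z) <= x2 -> y1 <= Im (uhp_val z) <= y2 ->
      cabs (f z - g z) <= e) ->
  holomorphic f.
Proof.
move=> happ.
have extP (g : hfun R) : holomorphic g -> holoC (ext g).
  by move=> /holomorphicP hg z z0; exists (hderiv g (to_uhp z0)); exact: (hg (to_uhp z0)).
have extE (g : hfun R) z (z0 : 0 < Im z) : ext g z = g (to_uhp z0) by exact: (ext_uhp g (to_uhp z0)).
have cf (z : C) : 0 < Im z -> fcont (ext f) z.
  move=> z0 e e0; have e30 : 0 < e / 4 by rewrite divr_gt0.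
  have [g hg hfg] := happ (Re z - 1) (Re z + 1) (Im z / 2) (Im z + 1) (e / 4) (divr_gt0 z0 (ltr0n _ 2)) e30.
  have [d d0 hd'] := holoC_fcont (extP _ hg) z0 e30.
  exists (Num.min d (Num.min 1 (Im z / 2))) => [|w]; first by rewrite !lt_min d0 ltr01 divr_gt0.
  rewrite !lt_min => /andP[/hd' wd /andP[w1 w2]].
  have := ler_Re_cabs (w - z); have := ler_Im_cabs (w - z); rewrite ReB ImB.
  move=> /ler_normlP[i1 i2] /ler_normlP[r1 r2].
  have w0 : 0 < Im w by lra.
  have A : cabs (ext f w - ext g w) <= e / 4.
    by rewrite !(extE _ w w0); apply: hfg => /=; apply/andP; split; lra.
  have B : cabs (ext f z - ext g z) <= e / 4.
    by rewrite !(extE _ z z0); apply: hfg => /=; apply/andP; split; lra.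
  have -> : ext f w - ext f z = (ext f w - ext g w) + ((ext g w - ext g z) - (ext f z - ext g z)) by ring.
  apply: le_lt_trans (cabsD _ _) _; have := cabsD (ext g w - ext g z) (- (ext f z - ext g z)).
  rewrite cabsN; move: A B wd; clear -e0 => *; lra.
have rf (x1 x2 y1 y2 : R) : x1 <= x2 -> 0 < y1 -> y1 <= y2 -> rint (ext f) x1 x2 y1 y2 = 0.
  move=> x12 y10 y12; apply/eqP; rewrite -cabs_eq0 eq_le cabs_ge0 andbT.
  apply/ler_addgt0Pl => e e0; rewrite addr0.
  have y20 := lt_le_trans y10 y12.
  pose S := 2 * ((x2 - x1) + (y2 - y1)) + 1.
  have S0 : 0 < S by rewrite /S; lra.
  have [g hg hfg] := happ x1 x2 y1 y2 (e / S) y10 (divr_gt0 e0 S0).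
  have [G hG] := holoC_primitive (extP _ hg).
  have bg : bcont (ext g) x1 x2 y1 y2 by apply: fcont_bcont => // z; exact/holoC_fcont/extP.
  have bf : bcont (ext f) x1 x2 y1 y2 by apply: fcont_bcont.
  have E : rint (ext f) x1 x2 y1 y2 = rint (fun z => (-1) * ext g z + ext f z) x1 x2 y1 y2.
    by rewrite rint_lin// (rint_primitive x1 x2 y10 y20 hG) mulr0 add0r.
  rewrite E; apply: (@le_trans _ _ (2 * (e / S) * ((x2 - x1) + (y2 - y1)))).
    apply: rint_le => //; first exact: bcont_lin.
    move=> z bz; have [zr zi] : x1 <= Re z <= x2 /\ y1 <= Im z <= y2.
      by case: bz => -[h1 h2]; split => //; case: h2 => ->; rewrite lexx ?x12 ?y12.
    have z0 : 0 < Im z by apply: lt_le_trans y10 _; case/andP: zi.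
    by rewrite mulN1r addrC !(extE _ z z0); exact: hfg.
  have -> : 2 * (e / S) * (x2 - x1 + (y2 - y1)) = e * ((S - 1) / S) by rewrite /S; ring.
  rewrite ler_piMr ?(ltW e0)// ler_pdivrMr// mul1r; lra.
have [F hF] := morera_primitive cf rf.
have hf := holoC_deriv hF.
by move=> z; have [l []] := hf _ (uhp_val_gt0 z).
Qed.

Lemma holomorphic_holoC (g : hfun R) : holomorphic g -> holoC (ext g).
Proof.
by move=> /holomorphicP hg z z0; exists (hderiv g (to_uhp z0)); exact: (hg (to_uhp z0)).
Qed.

Lemma holomorphic_restr (F : C -> C) (G : C -> C) z :
  (forall z : C, 0 < Im z -> is_derive z 1 F (G z)) ->
  hd (fun z => F (uhp_val z)) z (G (uhp_val z)).
Proof.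
move=> h; have := hd_compC (h _ (uhp_val_gt0 z)) (hd_id z).
by rewrite mulr1.
Qed.

Lemma holomorphic_hderiv (f : hfun R) : holomorphic f -> holomorphic (hderiv f).
Proof.
move=> /holomorphicP hf; have h : holoC (ext (hderiv f)).
  apply: (@holoC_deriv (ext f)) => z z0.
  have := hf (to_uhp z0); rewrite /hd.
  by rewrite -(ext_uhp (hderiv f) (to_uhp z0)).
by move=> z; have [l []] := h _ (uhp_val_gt0 z).
Qed.

Lemma holomorphic_primitive (g : hfun R) : holomorphic g ->
  exists f : hfun R, forall z, hd f z (g z).
Proof.
move=> /holomorphic_holoC/holoC_primitive[F hF].
exists (fun z => F (uhp_val z)) => z.
by have := holomorphic_restr z hF; rewrite ext_uhp.
Qed.

(** The half-plane is convex, so [f] can be followed along the segment from [z] to [w]. *)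
Lemma hd_zero_cst (f : hfun R) : (forall z, hd f z 0) -> forall z w, f z = f w.
Proof.
move=> hf z w; pose g t : C := uhp_val z + (uhp_val w - uhp_val z) * ofR t.
have g0 t : 0 <= t <= 1 -> 0 < Im (g t).
  move=> /andP[t0 t1]; rewrite /g !ReImE mulr0 add0r.
  have := uhp_val_gt0 z; have := uhp_val_gt0 w.
  move: (Im _) (Im _) => x y x0 y0.
  have [->|tn] := eqVneq t 0; first by rewrite mulr0 addr0.
  have tp : 0 < t by rewrite lt_def tn.
  have : 0 < t * x by rewrite mulr_gt0.
  have : 0 <= (1 - t) * y by rewrite mulr_ge0 ?subr_ge0// ltW.
  lra.
have [] : ext f (g 1) - ext f (g 0) = (0 : C) - 0 /\ True.
  split=> //; apply: (@rd_diff_unique R (fun t => ext f (g t)) (fun=> 0) (fun=> 0)) => t t01.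
  split; last exact: rd_cst.
  have {}t01 : 0 <= t <= 1.
    by case/orP: t01 => // /andP[h1 h2]; have := le_trans h1 h2; rewrite leNgt ltr01.
  have h := hf (to_uhp (g0 _ t01)).
  apply: rd_eq (rd_comp (g := g) h (rd_affine _ _ _)) _.
  by rewrite mul0r.
rewrite subr0 /g ofR0 ofR1 mulr0 addr0 mulr1.
have -> : uhp_val z + (uhp_val w - uhp_val z) = uhp_val w by ring.
by rewrite !ext_uhp => /subr0_eq ->.
Qed.

End Cauchy.

(** * Reproducing kernel Hilbert spaces *)

Section Hilbert.
Context {R : realType}.
Local Notation C := (cplx R).
Local Notation Re := (@complex.Re R).

Definition hzero : hfun R := fun=> 0.
Definition hsub (f g : hfun R) : hfun R := lincomb (-1) g f.

Lemma lincomb1_hzero (f : hfun R) a : lincomb a f hzero = fun z => a * f z.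
Proof. by apply/funext => z; rewrite /lincomb addr0. Qed.

Section HilbertSpace.
Context (H : fspace R) (hH : is_hilbert H).
Local Notation ip := (fs_ip H).
Local Notation nrm := (fs_norm H).

Lemma mem_hzero : H hzero. Proof. by case: hH => -[]. Qed.
Lemma mem_lincomb a f g : H f -> H g -> H (lincomb a f g).
Proof. by case: hH => -[_ h] _ _ _ _; exact: h. Qed.
Lemma mem_hsub f g : H f -> H g -> H (hsub f g).
Proof. by move=> *; exact: mem_lincomb. Qed.
Lemma ip_linl a f g h : H f -> H g -> H h -> ip (lincomb a f g) h = a * ip f h + ip g h.
Proof. by case: hH => _ h0 _ _ _; exact: h0. Qed.
Lemma ip_conj f g : H f -> H g -> ip g f = cconj (ip f g).
Proof. by case: hH => _ _ h _ _; exact: h. Qed.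
Lemma ip_linr a f g h : H f -> H g -> H h -> ip h (lincomb a f g) = cconj a * ip h f + ip h g.
Proof.
move=> hf hg hh; rewrite (ip_conj (mem_lincomb a hf hg) hh) ip_linl// cconjD cconjM.
by rewrite -!ip_conj.
Qed.
Lemma ip_self f : H f -> ip f f = ofR (nrm f ^+ 2).
Proof.
move=> hf; have [h0 _] : 0 <= ip f f /\ (ip f f = 0 -> f = fun=> 0).
  by case: hH => _ _ _ h _; exact: h.
move: h0; rewrite lecE /= => /andP[/eqP i0 r0].
rewrite /fs_norm sqr_sqrtr//.
by apply: cplx_eq => //=.
Qed.
Lemma nrm_ge0 f : 0 <= nrm f. Proof. exact: sqrtr_ge0. Qed.
Lemma nrm_eq0 f : H f -> nrm f = 0 -> f = hzero.
Proof.
move=> hf n0; have [_] : 0 <= ip f f /\ (ip f f = 0 -> f = fun=> 0).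
  by case: hH => _ _ _ h _; exact: h.
by apply; rewrite ip_self// n0 expr0n ofR0.
Qed.
Lemma ip_0l f : H f -> ip hzero f = 0.
Proof.
move=> hf; have := ip_linl (-1) mem_hzero mem_hzero hf.
have -> : lincomb (-1) hzero hzero = hzero.
  by apply/funext => z; rewrite /lincomb mulr0 addr0.
by move=> ->; ring.
Qed.
Lemma ip_0r f : H f -> ip f hzero = 0.
Proof. by move=> hf; rewrite (ip_conj mem_hzero hf) ip_0l// cconj0. Qed.

Lemma ip_subl f g h : H f -> H g -> H h -> ip (hsub f g) h = ip f h - ip g h.
Proof. by move=> *; rewrite ip_linl//; ring. Qed.
Lemma ip_subr f g h : H f -> H g -> H h -> ip h (hsub f g) = ip h f - ip h g.
Proof. by move=> *; rewrite ip_linr// cconjN cconj1; ring. Qed.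

Lemma nrm_lincomb_sq a f g : H f -> H g ->
  nrm (lincomb a f g) ^+ 2 = cabs a ^+ 2 * nrm f ^+ 2 + nrm g ^+ 2 + 2 * Re (a * ip f g).
Proof.
move=> hf hg; have hl := mem_lincomb a hf hg.
have E := ip_self hl; apply: ofR_inj; rewrite -E.
rewrite ip_linl// !ip_linr// (ip_conj hf hg) !ip_self//.
have -> : a * (cconj a * ofR (nrm f ^+ 2) + ip f g) + (cconj a * cconj (ip f g) + ofR (nrm g ^+ 2)) =
  (a * cconj a) * ofR (nrm f ^+ 2) + ofR (nrm g ^+ 2) + (a * ip f g + cconj (a * ip f g)).
  by rewrite cconjM; ring.
rewrite mul_cconj -ofRM -ofRD; apply: cplx_eq; rewrite ?ReD ?ImD ?Re_conj ?Im_conj ?Re_ofR ?Im_ofR.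
  by ring.
by ring.
Qed.

Lemma cauchy_schwarz f g : H f -> H g -> cabs (ip f g) <= nrm f * nrm g.
Proof.
move=> hf hg; set N := nrm f; set M := nrm g; set D := ip f g.
have N0 : 0 <= N := nrm_ge0 f; have M0 : 0 <= M := nrm_ge0 g.
have key (t : R) : 0 <= t -> 0 <= t ^+ 2 * cabs D ^+ 2 * N ^+ 2 + M ^+ 2 - 2 * t * cabs D ^+ 2.
  move=> t0; have := nrm_lincomb_sq (- ofR t * cconj D) hf hg.
  rewrite -/D -/N -/M cabsM cabsN cabs_ofR cabs_conj ger0_norm// exprMn.
  rewrite -[- ofR t * cconj D * D]mulrA [cconj D * D]mulrC mul_cconj -ofRN -ofRM Re_ofR => E.
  have -> : t ^+ 2 * cabs D ^+ 2 * N ^+ 2 + M ^+ 2 - 2 * t * cabs D ^+ 2 =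
    t ^+ 2 * cabs D ^+ 2 * N ^+ 2 + M ^+ 2 + 2 * (- t * cabs D ^+ 2) by ring.
  by rewrite -E exprn_ge0 ?nrm_ge0.
have [->|D0] := eqVneq (cabs D) 0; first by rewrite mulr_ge0.
have Dp : 0 < cabs D by rewrite lt_def D0 cabs_ge0.
have [N00|N00] := eqVneq N 0.
  (* For [N = 0] the expression in [key] is affine and decreasing in [t]; this value of [t] makes it
     [- (M ^ 2 + 2)]. *)
  have := key ((M ^+ 2 + 1) / cabs D ^+ 2); rewrite N00 expr0n mulr0 add0r => h.
  have : 0 <= M ^+ 2 - 2 * ((M ^+ 2 + 1) / cabs D ^+ 2) * cabs D ^+ 2.
    apply: h; apply: divr_ge0; last by rewrite exprn_ge0 ?cabs_ge0.
    by apply: addr_ge0 => //; exact: exprn_ge0.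
  have -> : M ^+ 2 - 2 * ((M ^+ 2 + 1) / cabs D ^+ 2) * cabs D ^+ 2 = - (M ^+ 2 + 2) by field.
  by rewrite oppr_ge0 leNgt ltr_wpDl// exprn_ge0.
have Np : 0 < N by rewrite lt_def N00.
(* The minimizer of the quadratic in [t]. *)
have := key (1 / N ^+ 2); rewrite divr_ge0 ?exprn_ge0// => /(_ isT).
have -> : (1 / N ^+ 2) ^+ 2 * cabs D ^+ 2 * N ^+ 2 + M ^+ 2 - 2 * (1 / N ^+ 2) * cabs D ^+ 2 =
   M ^+ 2 - cabs D ^+ 2 / N ^+ 2 by field.
rewrite subr_ge0 ler_pdivrMr ?exprn_gt0// -exprMn mulrC => h.
by rewrite -(@ler_pXn2r _ 2)// ?nnegrE ?mulr_ge0 ?cabs_ge0// .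
Qed.

Lemma nrm_triangle a f g : H f -> H g -> nrm (lincomb a f g) <= cabs a * nrm f + nrm g.
Proof.
move=> hf hg; have N0 := nrm_ge0 f; have M0 := nrm_ge0 g; have a0 := cabs_ge0 a.
rewrite -(@ler_pXn2r _ 2)// ?nnegrE ?nrm_ge0 ?addr_ge0 ?mulr_ge0//.
rewrite nrm_lincomb_sq//.
have h : Re (a * ip f g) <= cabs a * (nrm f * nrm g).
  apply: le_trans (ler_norm _) _; apply: le_trans (ler_Re_cabs _) _.
  by rewrite cabsM; apply: ler_wpM2l => //; exact: cauchy_schwarz.
have -> : (cabs a * nrm f + nrm g) ^+ 2 =
  cabs a ^+ 2 * nrm f ^+ 2 + nrm g ^+ 2 + 2 * (cabs a * (nrm f * nrm g)) by ring.
by rewrite lerD2l ler_pM2l.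
Qed.

Lemma nrm_sub_sym f g : H f -> H g -> nrm (hsub f g) = nrm (hsub g f).
Proof.
move=> hf hg; apply/eqP; rewrite -(@eqrXn2 _ 2)// ?nrm_ge0//; apply/eqP.
by rewrite !nrm_lincomb_sq// cabsN cabs1 !mulN1r !ReN (ip_conj hf hg) Re_conj; ring.
Qed.

Lemma nrm_sub_triangle f g h : H f -> H g -> H h ->
  nrm (hsub f h) <= nrm (hsub f g) + nrm (hsub g h).
Proof.
move=> hf hg hh; have := nrm_triangle 1 (mem_hsub hf hg) (mem_hsub hg hh).
rewrite cabs1 mul1r; congr (_ <= _); congr nrm.
by apply/funext => z; rewrite /hsub /lincomb; ring.
Qed.

Definition hcvg (u : nat -> hfun R) (f : hfun R) := forall e : R, 0 < e ->
  exists N : nat, forall n, (N <= n)%N -> nrm (hsub (u n) f) < e.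

Lemma hilbert_complete (u : nat -> hfun R) : (forall n, H (u n)) ->
  (forall e : R, 0 < e -> exists N : nat, forall m n,
    (N <= m)%N -> (N <= n)%N -> nrm (hsub (u m) (u n)) < e) ->
  exists2 f, H f & hcvg u f.
Proof.
move=> hu hc; have [f hf] : exists2 f, H f & (fun n => fs_dist H (u n) f) @ \oo --> (0 : R).
  by case: hH => _ _ _ _; apply.
move=> /cvgrPdist_lt cf; exists f => // e /cf [N _ hN]; exists N => n /hN /=.
by rewrite sub0r normrN ger0_norm// nrm_ge0.
Qed.

Lemma hcvg_ip u f v g : (forall n, H (u n)) -> (forall n, H (v n)) -> H f -> H g ->
  hcvg u f -> hcvg v g -> forall e : R, 0 < e ->
  exists n, cabs (ip (u n) (v n) - ip f g) < e.
Proof.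
move=> hu hv hf hg cu cv e e0.
pose A := nrm f + 1; have A0 : 0 < A by rewrite ltr_wpDl ?nrm_ge0.
pose B := nrm g + 1; have B0 : 0 < B by rewrite ltr_wpDl ?nrm_ge0.
have [N1 h1] := cu (e / 2 / B) (divr_gt0 (divr_gt0 e0 (ltr0n _ 2)) B0).
have [N2 h2] := cv (e / 2 / A) (divr_gt0 (divr_gt0 e0 (ltr0n _ 2)) A0).
have [N3 h3] := cv 1 ltr01.
pose n := maxn N1 (maxn N2 N3).
have {}h1 : nrm (hsub (u n) f) < e / 2 / B by apply: h1; rewrite leq_maxl.
have {}h2 : nrm (hsub (v n) g) < e / 2 / A by apply: h2; rewrite /n maxnCA leq_maxl.
have {}h3 : nrm (hsub (v n) g) < 1 by apply: h3; rewrite /n maxnA leq_maxr.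
exists n.
have hun := mem_hsub (hu n) hf; have hvn := mem_hsub (hv n) hg.
have -> : ip (u n) (v n) - ip f g = ip (hsub (u n) f) (v n) + ip f (hsub (v n) g).
  by rewrite ip_subl// ip_subr//; ring.
apply: le_lt_trans (cabsD _ _) _; rewrite [e]splitr.
have vB : nrm (v n) <= B.
  have := nrm_triangle 1 hvn hg; rewrite cabs1 mul1r.
  have -> : lincomb 1 (hsub (v n) g) g = v n.
    by apply/funext => z; rewrite /hsub /lincomb; ring.
  by move/le_trans; apply; rewrite /B addrC lerD2l ltW.
apply: ltr_leD.
  apply: le_lt_trans (cauchy_schwarz hun (hv n)) _.
  apply: le_lt_trans (ler_wpM2l (nrm_ge0 _) vB) _.
  by rewrite -ltr_pdivlMr.
apply: le_trans (cauchy_schwarz hf hvn) _.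
apply: (@le_trans _ _ (A * nrm (hsub (v n) g))).
  by apply: ler_wpM2r; [exact: nrm_ge0|rewrite lerDl].
by rewrite mulrC -ler_pdivlMr// ltW.
Qed.

(* Riesz representation and orthogonal projection at once, by minimizing
   [|v|^2 - 2 Re l(v)] over the subspace [V]. *)
Lemma riesz_subspace (V : hfun R -> Prop) (l : hfun R -> C) (M : R) :
  (forall v, V v -> H v) -> V hzero ->
  (forall a f g, V f -> V g -> V (lincomb a f g)) ->
  (forall a f g, V f -> V g -> l (lincomb a f g) = a * l f + l g) ->
  (forall v, V v -> cabs (l v) <= M * nrm v) ->
  exists2 x, H x & (forall e : R, 0 < e -> exists2 v, V v & nrm (hsub v x) < e) /\
    forall v, V v -> l v = ip v x.
Proof.
move=> VH V0 Vl ll lM; pose J v := nrm v ^+ 2 - 2 * Re (l v).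
(* Completing the square in the norm of [v]. *)
have Jlb v : V v -> - M ^+ 2 <= J v.
  move=> hv; have : Re (l v) <= M * nrm v.
    by apply: le_trans (ler_norm _) _; apply: le_trans (ler_Re_cabs _) _; exact: lM.
  rewrite /J; have : 0 <= (nrm v - M) ^+ 2 by rewrite sqr_ge0.
  rewrite sqrrB; move: (nrm v) (Re _) => x y; rewrite -mulr_natl [M * x]mulrC.
  by move: (x * M) (x ^+ 2) (M ^+ 2) => p q r; lra.
pose E := [set J v | v in [set v | V v]].
have E0 : has_inf E.
  by split; [exists (J hzero), hzero|exists (- M ^+ 2) => _ [v hv <-]; exact: Jlb].
pose j := inf E.
have jle v : V v -> j <= J v by move=> hv; apply: ge_inf; [case: E0|exists v].
have ex n : exists v, V v /\ J v < j + n.+1%:R^-1.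
  have n0 : 0 < n.+1%:R^-1 :> R by rewrite invr_gt0.
  by have [_ [v hv <-] hj] := inf_adherent n0 E0; exists v.
have [u hu] := choice ex.
clearbody j.
have uV n : V (u n) := (hu n).1.
have uH n : H (u n) := VH _ (uV n).
(* The parallelogram law, with [J >= j] at the midpoint of [v] and [w]; it makes minimizing
   sequences Cauchy. *)
have par v w : V v -> V w -> nrm (hsub v w) ^+ 2 <= 2 * (J v - j) + 2 * (J w - j).
  move=> hv hw; have hm : V (lincomb (ofR 2^-1) (lincomb 1 v w) hzero) by do 2! apply: (Vl) => //.
  have := jle _ hm; rewrite /J.
  have lE : l (lincomb (ofR 2^-1) (lincomb 1 v w) hzero) = ofR 2^-1 * (l v + l w) + l hzero.
    by rewrite !ll// ?mul1r//; exact: Vl.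
  have l0 : l hzero = 0.
    have := ll (-1) _ _ V0 V0; have -> : lincomb (-1) hzero hzero = hzero.
      by apply/funext => z; rewrite /lincomb mulr0 addr0.
    by move=> ->; ring.
  have nE : nrm (lincomb (ofR 2^-1) (lincomb 1 v w) hzero) ^+ 2 =
      4^-1 * nrm (lincomb 1 v w) ^+ 2.
    rewrite nrm_lincomb_sq//; [|exact/VH/Vl|exact: mem_hzero].
    rewrite ip_0r; last exact/VH/Vl.
    rewrite mulr0 Re0 mulr0 addr0 cabs_ofR ger0_norm ?invr_ge0//.
    have -> : nrm hzero = 0.
      apply/eqP; rewrite -sqrf_eq0 -ofR_eq0 -ip_self; last exact: mem_hzero.
      by rewrite ip_0l//; exact: mem_hzero.
    by rewrite expr0n addr0; congr (_ * _); field.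
  rewrite nE lE l0 addr0 !nrm_lincomb_sq//; try exact: VH.
  have RE : Re (ip w v) = Re (ip v w) by rewrite (ip_conj (VH _ hv) (VH _ hw)) Re_conj.
  rewrite cabsN !cabs1 !expr1n !mul1r mulN1r ReN RE ReM Re_ofR Im_ofR mul0r subr0 ReD.
  move: (nrm v ^+ 2) (nrm w ^+ 2) (Re (ip v w)) (Re (l v)) (Re (l w)) => a b c d e.
  lra.
have small (e : R) : 0 < e -> exists N : nat, forall n, (N <= n)%N -> n.+1%:R^-1 < e.
  move=> e0; exists (Num.trunc e^-1).+1 => n Nn.
  rewrite -[e]invrK ltf_pV2 ?posrE ?invr_gt0//; apply: lt_trans (truncnS_gt _) _.
  by rewrite ltr_nat ltnS.
have cau (e : R) : 0 < e -> exists N : nat, forall m n, (N <= m)%N -> (N <= n)%N ->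
    nrm (hsub (u m) (u n)) < e.
  move=> e0; have [N hN] := small (e ^+ 2 / 4) (divr_gt0 (exprn_gt0 2 e0) (ltr0n _ 4)).
  exists N => m n /hN hm /hN hn; rewrite -(@ltr_pXn2r _ 2)// ?nnegrE ?nrm_ge0 ?(ltW e0)//.
  apply: le_lt_trans (par _ _ (uV m) (uV n)) _.
  have := (hu m).2; have := (hu n).2; move: hm hn.
  move: (J (u m)) (J (u n)) (e ^+ 2) (m.+1%:R^-1) (n.+1%:R^-1) => a b d p q; lra.
have [x hx cx] := hilbert_complete uH cau.
exists x => //; split=> [e e0|v hv].
  by have [N hN] := cx e e0; exists (u N) => //; exact: hN.
have vH := VH _ hv.
(* The first variation: [J] at [u n + t v] is at least [j], in the limit of the minimizing
   sequence. *)
have key (t : C) : 0 <= 2 * Re (t * (ip v x - l v)) + cabs t ^+ 2 * nrm v ^+ 2.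
  apply/ler_addgt0Pl => e e0.
  have e20 : 0 < e / 2 by rewrite divr_gt0.
  pose B := 2 * cabs t * nrm v + 1.
  have B0 : 0 < B by rewrite ltr_wpDl// !mulr_ge0 ?cabs_ge0 ?nrm_ge0.
  have [N1 h1] := cx (e / 2 / B) (divr_gt0 e20 B0).
  have [N2 h2] := small _ e20.
  pose n := maxn N1 N2.
  have {}h1 : nrm (hsub (u n) x) < e / 2 / B by apply: h1; rewrite leq_maxl.
  have {}h2 : n.+1%:R^-1 < e / 2 by apply: h2; rewrite leq_maxr.
  have := jle _ (Vl t _ _ hv (uV n)); rewrite /J nrm_lincomb_sq// ll// ReD.
  have := (hu n).2; rewrite /J.
  have : 2 * Re (t * (ip v (u n) - ip v x)) <= e / 2.
    apply: (@le_trans _ _ (2 * cabs t * (nrm v * nrm (hsub (u n) x)))).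
      rewrite -mulrA ler_pM2l//; apply: le_trans (ler_norm _) _.
      apply: le_trans (ler_Re_cabs _) _; rewrite cabsM -ip_subr//.
      by apply: ler_wpM2l; [exact: cabs_ge0|apply: cauchy_schwarz => //; exact: mem_hsub].
    apply: (@le_trans _ _ (B * nrm (hsub (u n) x))).
      by rewrite mulrA; apply: ler_wpM2r; [exact: nrm_ge0|rewrite lerDl].
    by rewrite mulrC -ler_pdivlMr// ltW.
  rewrite !mulrBr !ReB; move: h2.
  move: (nrm (u n) ^+ 2) (_ * nrm v ^+ 2) (Re (t * ip v (u n))) (Re (t * ip v x)) (Re (l (u n)))
    (Re (t * l v)) (n.+1%:R^-1) => a b c d f g q; lra.
pose D := ip v x - l v; pose s := (nrm v ^+ 2 + 1)^-1.
have N1 : 0 < nrm v ^+ 2 + 1 by rewrite ltr_wpDl// exprn_ge0// nrm_ge0.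
(* The linear term becomes [- 2 s] times the squared modulus of [D], and [s] is small enough for it
   to dominate the quadratic term unless [D = 0]. *)
have := key (- ofR s * cconj D); rewrite -/D.
rewrite -mulrA [cconj D * D]mulrC mul_cconj -ofRN -ofRM Re_ofR cabsM cabs_conj cabs_ofR normrN.
rewrite ger0_norm ?invr_ge0 ?(ltW N1)//.
have -> : 2 * (- s * cabs D ^+ 2) + (s * cabs D) ^+ 2 * nrm v ^+ 2 =
  - (cabs D ^+ 2 * (s * (2 - s * nrm v ^+ 2))) by ring.
rewrite oppr_ge0 => h.
have sp : 0 < s * (2 - s * nrm v ^+ 2).
  rewrite mulr_gt0 ?invr_gt0// subr_gt0 mulrC ltr_pdivrMr//.
  by move: N1; move: (nrm v ^+ 2) => y; lra.
have : cabs D ^+ 2 <= 0 by rewrite -(pmulr_lle0 _ sp).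
rewrite le_eqVlt ltNge exprn_ge0 ?cabs_ge0//= orbF sqrf_eq0 cabs_eq0 subr_eq0.
by move/eqP.
Qed.

Lemma riesz (l : hfun R -> C) (M : R) :
  (forall a f g, H f -> H g -> l (lincomb a f g) = a * l f + l g) ->
  (forall v, H v -> cabs (l v) <= M * nrm v) ->
  exists2 x, H x & forall v, H v -> l v = ip v x.
Proof.
move=> ll lM; have [|x hx [_ h]] := @riesz_subspace H l M (fun v h => h) mem_hzero _ ll lM.
  by move=> *; exact: mem_lincomb.
by exists x.
Qed.

End HilbertSpace.

Definition comb (p : uhp R -> hfun R) (s : seq (C * uhp R)) : hfun R :=
  foldr (fun c g => lincomb c.1 (p c.2) g) hzero s.

Lemma comb_lincomb p a s t :
  lincomb a (comb p s) (comb p t) = comb p ([seq (a * c.1, c.2) | c <- s] ++ t).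
Proof.
elim: s => [|c s IH] /=.
  by apply/funext => z; rewrite /lincomb mulr0 add0r.
by rewrite -IH; apply/funext => z; rewrite /lincomb; ring.
Qed.

Lemma mem_comb H p s : is_hilbert H -> (forall w, H (p w)) -> H (comb p s).
Proof.
move=> hH hp; elim: s => [|c s IH] /=; first exact: mem_hzero.
exact: mem_lincomb.
Qed.

Lemma ip_comb H H' p p' : is_hilbert H -> is_hilbert H' ->
  (forall w, H (p w)) -> (forall w, H' (p' w)) ->
  (forall z w, fs_ip H (p w) (p z) = fs_ip H' (p' w) (p' z)) ->
  forall s t, fs_ip H (comb p s) (comb p t) = fs_ip H' (comb p' s) (comb p' t).
Proof.
move=> hH hH' hp hp' E s t; elim: s => [|c s IH] /=.
  by rewrite !ip_0l//; exact: mem_comb.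
rewrite !ip_linl//; try exact: mem_comb.
rewrite IH; congr (_ * _ + _); elim: t {IH} => [|d t IH] /=.
  by rewrite !ip_0r.
by rewrite !ip_linr//; try exact: mem_comb; rewrite IH E.
Qed.

Section RKHS.
Context (H : fspace R) (K : uhp R -> uhp R -> C) (hK : is_rkhs H K).
Local Notation kw := (fun w : uhp R => (fun z => K z w) : hfun R).

Lemma rkhs_hilbert : is_hilbert H. Proof. by case: hK. Qed.
Lemma rkhs_kernel w : H (kw w). Proof. by case: hK. Qed.
Lemma rkhs_eval f w : H f -> f w = fs_ip H f (kw w).
Proof. by case: hK => _ _ _ h; exact: h. Qed.
Lemma rkhs_gram z w : fs_ip H (kw w) (kw z) = K z w.
Proof. by rewrite -rkhs_eval//; exact: rkhs_kernel. Qed.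

Lemma rkhs_eval_le f w : H f -> cabs (f w) <= fs_norm H f * fs_norm H (kw w).
Proof.
move=> hf; rewrite (rkhs_eval w hf).
by apply: (cauchy_schwarz rkhs_hilbert) => //; exact: rkhs_kernel.
Qed.

(** The projection of [f] onto the closed span of the kernels has the same inner product with every
    kernel, that is, the same values as [f]; hence it is [f]. *)
Lemma rkhs_dense f : H f -> exists s : nat -> seq (C * uhp R), hcvg H (fun n => comb kw (s n)) f.
Proof.
move=> hf; have hH := rkhs_hilbert.
pose V g := exists s, g = comb kw s.
have VH v : V v -> H v by move=> [s ->]; apply: mem_comb => // w; exact: rkhs_kernel.
have [||||x hx [cx ipx]] := @riesz_subspace H hH V (fun v => fs_ip H v f) (fs_norm H f) VH.
- by exists [::].
- by move=> a _ _ [s ->] [t ->]; rewrite comb_lincomb; eexists.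
- by move=> a g h /VH ? /VH ?; exact: ip_linl.
- by move=> v /VH hv; rewrite mulrC; exact: cauchy_schwarz.
have xf : x = f.
  apply/funext => w; rewrite (rkhs_eval w hx) (rkhs_eval w hf).
  have hkw := rkhs_kernel w.
  have Vk : V (kw w).
    exists [:: (1, w)] => /=; apply/funext => z.
    by rewrite /lincomb /= addr0 mul1r.
  by rewrite (ip_conj hH hkw hx) (ip_conj hH hkw hf) -ipx.
rewrite xf in cx.
have ex n : exists s, fs_norm H (hsub (comb kw s) f) < n.+1%:R^-1.
  have n0 : 0 < n.+1%:R^-1 :> R by rewrite invr_gt0.
  by have [_ [s ->] hs] := cx _ n0; exists s.
have [s hs] := choice ex; exists s => e e0.
exists (Num.trunc e^-1).+1 => n Nn; apply: lt_trans (hs n) _.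
rewrite -[e]invrK ltf_pV2 ?posrE ?invr_gt0//; apply: lt_trans (truncnS_gt _) _.
by rewrite ltr_nat ltnS.
Qed.

(** A family with the Gram matrix of the kernels determines an isometry on their span, hence by
    density on [H]. All later operators between the spaces [A s] are produced in this way. *)
Lemma rkhs_isometry (H' : fspace R) (p : uhp R -> hfun R) : is_hilbert H' ->
  (forall w, H' (p w)) -> (forall z w, fs_ip H' (p w) (p z) = K z w) ->
  exists S : hfun R -> hfun R, [/\ (forall f, H f -> H' (S f)),
    (forall f g, H f -> H g -> fs_ip H' (S f) (S g) = fs_ip H f g) &
    (forall w, S (kw w) = p w)].
Proof.
move=> hH' hp gr; have hH := rkhs_hilbert.
have mK s : H (comb kw s) by apply: mem_comb => // w; exact: rkhs_kernel.
have mp s : H' (comb p s) by apply: mem_comb.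
have E s t : fs_ip H' (comb p s) (comb p t) = fs_ip H (comb kw s) (comb kw t).
  by apply: ip_comb => // [w|z w]; [exact: rkhs_kernel|rewrite gr rkhs_gram].
have En s t : fs_norm H' (hsub (comb p s) (comb p t)) = fs_norm H (hsub (comb kw s) (comb kw t)).
  by rewrite /fs_norm /hsub !comb_lincomb E.
(* The closure of the graph on finite combinations. That it preserves inner products, shown next,
   makes the choice of [F] for given [f] harmless. *)
pose rel f F := [/\ H f, H' F & exists s : nat -> seq (C * uhp R),
  hcvg H (fun n => comb kw (s n)) f /\ hcvg H' (fun n => comb p (s n)) F].
have tot f : exists F, H f -> rel f F.
  have [hf|nf] := pselect (H f); last by exists f.
  have [s hs] := rkhs_dense hf.
  have [|e e0|F hF cF] := @hilbert_complete H' hH' (fun n => comb p (s n)).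
  - by move=> n; exact: mp.
  - have [N hN] := hs _ (divr_gt0 e0 (ltr0n _ 2)); exists N => m n /hN hm /hN hn.
    rewrite En; apply: le_lt_trans (nrm_sub_triangle hH (mK _) hf (mK _)) _.
    by rewrite [e]splitr ltrD// nrm_sub_sym.
  by exists F => _; split=> //; exists s.
have relip f g F G : rel f F -> rel g G -> fs_ip H' F G = fs_ip H f g.
  move=> [hf hF [s [cs cs']]] [hg hG [t [ct ct']]].
  apply/subr0_eq/eqP; rewrite -cabs_eq0 eq_le cabs_ge0 andbT.
  apply/ler_addgt0Pl => e e0; rewrite addr0.
  pose s2 n := s n; have e20 : 0 < e / 2 by rewrite divr_gt0.
  (* [hcvg_ip] supplies a single index, but here one index must serve both spaces. The first
     convergence is upgraded to a whole tail, by contradiction along a subsequence [b], and the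
     second is applied to the shifted sequences. *)
  have comm : forall e : R, 0 < e -> exists n,
      cabs (fs_ip H (comb kw (s n)) (comb kw (t n)) - fs_ip H f g) < e /\
      cabs (fs_ip H' (comb p (s n)) (comb p (t n)) - fs_ip H' F G) < e.
    move=> d d0.
    have tail (N : nat) (X : fspace R) (u : nat -> hfun R) (x : hfun R) : hcvg X u x -> hcvg X (fun n => u (N + n)%N) x.
      move=> cu c c0; have [N' hN'] := cu c c0; exists N' => n Nn; apply: hN'.
      by rewrite (leq_trans Nn)// leq_addl.
    have [N hN] : exists N : nat, forall n, (N <= n)%N ->
        cabs (fs_ip H (comb kw (s n)) (comb kw (t n)) - fs_ip H f g) < d.
      apply: contrapT => /forallNP hno.
      have {}hno N : exists n, (N <= n)%N /\ ~ (cabs (fs_ip H (comb kw (s n)) (comb kw (t n)) - fs_ip H f g) < d).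
        by have /existsNP[n /not_implyP hn] := hno N; exists n.
      have [b hb] := choice hno.
      have sub (X : fspace R) (u : nat -> hfun R) (x : hfun R) : hcvg X u x -> hcvg X (fun n => u (b n)) x.
        move=> cu c c0; have [N' hN'] := cu c c0; exists N' => n Nn; apply: hN'.
        by rewrite (leq_trans Nn)//; case: (hb n).
      have [n hn] := hcvg_ip hH (fun n => mK (s (b n))) (fun n => mK (t (b n))) hf hg (sub _ _ _ cs) (sub _ _ _ ct) d0.
      by case: (hb n) => _; apply.
    have [n hn] := hcvg_ip hH' (fun n => mp (s (N + n)%N)) (fun n => mp (t (N + n)%N)) hF hG (tail N _ _ _ cs') (tail N _ _ _ ct') d0.
    by exists (N + n)%N; split=> //; apply: hN; rewrite leq_addr.
  have [n [h1 h2]] := comm _ e20; rewrite E in h2.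
  have -> : fs_ip H' F G - fs_ip H f g =
    (fs_ip H (comb kw (s n)) (comb kw (t n)) - fs_ip H f g) -
    (fs_ip H (comb kw (s n)) (comb kw (t n)) - fs_ip H' F G) by ring.
  apply: le_trans (cabsD _ _) _; rewrite cabsN [e]splitr.
  by apply: lerD; exact: ltW.
have [S hS] := choice tot.
exists S; split=> [f hf|f g hf hg|w].
- by case: (hS f hf).
- exact: relip (hS f hf) (hS g hg).
have r1 := hS _ (rkhs_kernel w).
have r2 : rel (kw w) (p w).
  split=> //; first exact: rkhs_kernel.
  have one q : comb q [:: (1, w)] = q w.
    by apply/funext => z; rewrite /= /lincomb /= addr0 mul1r.
  have cst X (x : hfun R) : is_hilbert X -> X x -> hcvg X (fun=> x) x.
    move=> hX Xx e e0; exists 0%N => n _.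
    suff -> : fs_norm X (hsub x x) = 0 by [].
    have -> : hsub x x = hzero by apply/funext => z; rewrite /hsub /lincomb mulN1r addNr.
    by rewrite /fs_norm ip_0l//; [rewrite sqrtr0|exact: mem_hzero].
  exists (fun=> [:: (1, w)]); rewrite !one; split; apply: cst => //.
  exact: rkhs_kernel.
have [_ hF _] := r1.
(* All four inner products among the image of the kernel and [p w] coincide, so their difference has
   norm 0. *)
have := relip _ _ _ _ r1 r1; have := relip _ _ _ _ r1 r2; have := relip _ _ _ _ r2 r1.
have := relip _ _ _ _ r2 r2; set F := S _ in r1 hF * => e1 e2 e3 e4.
have : fs_norm H' (hsub F (p w)) = 0.
  rewrite /fs_norm ip_subl//; last exact: mem_hsub.
  by rewrite !ip_subr// e1 e2 e3 e4 subrr sqrtr0.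
move=> /(nrm_eq0 hH' (mem_hsub hH' hF (hp w))) /(congr1 (fun g : hfun R => g)) Z.
apply/funext => z; have := congr1 (fun g : hfun R => g z) Z.
by rewrite /hsub /lincomb mulN1r addrC => /subr0_eq.
Qed.

End RKHS.

(** The defect of linearity is orthogonal to the range of [S], and it is itself a combination of
    elements of that range. *)
Lemma isometry_linear (H H' : fspace R) (S : hfun R -> hfun R) :
  is_hilbert H -> is_hilbert H' -> (forall f, H f -> H' (S f)) ->
  (forall f g, H f -> H g -> fs_ip H' (S f) (S g) = fs_ip H f g) ->
  forall a f g, H f -> H g -> S (lincomb a f g) = lincomb a (S f) (S g).
Proof.
move=> hH hH' hS hip a f g hf hg.
have hl := mem_lincomb hH a hf hg.
have hSl := mem_lincomb hH' a (hS _ hf) (hS _ hg).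
pose D := hsub (S (lincomb a f g)) (lincomb a (S f) (S g)).
have hD : H' D by apply: mem_hsub => //; exact: hS.
have orth x : H x -> fs_ip H' D (S x) = 0.
  move=> hx; rewrite ip_subl//; try exact: hS.
  rewrite ip_linl//; try exact: hS.
  by rewrite !hip// ip_linl// subrr.
have DD : fs_ip H' D D = 0.
  rewrite {2}/D ip_subr//; last exact: hS.
  by rewrite ip_linr//; try exact: hS; rewrite !orth// mulr0 addr0 subrr.
have : fs_norm H' D = 0 by rewrite /fs_norm DD sqrtr0.
move=> /(nrm_eq0 hH' hD) Z; apply/funext => z; have := congr1 (fun g : hfun R => g z) Z.
by rewrite /D /hsub /lincomb mulN1r addrC => /subr0_eq.
Qed.

(* Invariance of the kernel under a change of variables with multiplier [j]
   makes the corresponding composition operator unitary. *)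
Lemma rkhs_covariant (H : fspace R) K (phi psi : uhp R -> uhp R) (j : hfun R) :
  is_rkhs H K -> cancel phi psi -> cancel psi phi -> (forall z, j z != 0) ->
  (forall z w, K (phi z) (phi w) * j z * cconj (j w) = K z w) ->
  (forall f, H f -> H (fun z => f (phi z) * j z)) /\
  (forall f g, H f -> H g ->
    fs_ip H (fun z => f (phi z) * j z) (fun z => g (phi z) * j z) = fs_ip H f g).
Proof.
move=> hK phiK psiK j0 inv.
have hH := rkhs_hilbert hK.
(* By the invariance of [K], this is the composition operator applied to the kernel at [w], written
   as a multiple of a kernel and so visibly in [H]. *)
pose p w : hfun R := lincomb (cconj (j (psi w)))^-1 (fun z => K z (psi w)) hzero.
have hp w : H (p w) by apply: mem_lincomb => //; [exact: rkhs_kernel|exact: mem_hzero].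
have pE w : p w = fun z => (cconj (j (psi w)))^-1 * K z (psi w) by exact: lincomb1_hzero.
have [|S [hS hip hSk]] := rkhs_isometry hK hH hp.
  move=> z w; rewrite ip_linl//; [|exact: rkhs_kernel|exact: mem_hzero].
  rewrite ip_linr//; [|exact: rkhs_kernel|exact: mem_hzero|exact: rkhs_kernel].
  rewrite ip_0r//; last exact: rkhs_kernel.
  rewrite ip_0l// !addr0 rkhs_gram//.
  rewrite -{1}[z]psiK -{1}[w]psiK -(inv (psi z) (psi w)) !psiK cconjV cconjK.
  by field; rewrite j0 cconj_eq0 j0.
have SE f : H f -> S f = fun z => f (phi z) * j z.
  move=> hf; apply/funext => z.
  rewrite (rkhs_eval hK z (hS _ hf)).
  have -> : (fun z0 => K z0 z) = lincomb (cconj (j z)) (S (fun x => K x (phi z))) hzero.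
    rewrite lincomb1_hzero hSk pE phiK; apply/funext => x.
    by rewrite mulrA divff ?mul1r// cconj_eq0.
  have hk := rkhs_kernel hK (phi z).
  rewrite ip_linr//; [|exact: hS|exact: mem_hzero|exact: hS].
  rewrite ip_0r//; last exact: hS.
  by rewrite cconjK addr0 hip// -(rkhs_eval hK) // mulrC.
split=> [f hf|f g hf hg]; first by rewrite -(SE f hf); exact: hS.
by rewrite -(SE f hf) -(SE g hg) hip.
Qed.

End Hilbert.

(** * The action of the affine group *)

Section Kernels.
Context {R : realType}.
Local Notation C := (cplx R).
Local Notation Re := (@complex.Re R).
Local Notation Im := (@complex.Im R).
Local Opaque cexp cpow.

(** The base of the power in [kern]. Its real part is the mean of the two imaginary parts, hence
    positive, and affine maps only rescale it. *)
Definition karg (z w : uhp R) : C := (uhp_val z - cconj (uhp_val w)) / (2 * ci).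

Lemma kernE (s : R) (z w : uhp R) : kern s z w = cpow (karg z w) (- s).
Proof. by []. Qed.

Lemma two_ci_neq0 : 2 * ci != 0 :> C.
Proof. by rewrite mulf_neq0// ?ci_neq0 ?pnatr_eq0. Qed.

Lemma inv_two_ci : (2 * ci)^-1 = - ci / 2 :> C.
Proof.
apply: (mulfI two_ci_neq0); rewrite divff ?two_ci_neq0//.
have -> : 2 * ci * (- ci / 2) = - (ci * ci) :> C by field.
by rewrite ciM opprK.
Qed.

Lemma kargE z w : karg z w = pt ((Im (uhp_val z) + Im (uhp_val w)) / 2)
  ((Re (uhp_val w) - Re (uhp_val z)) / 2).
Proof.
rewrite /karg inv_two_ci; have -> : (2 : C)^-1 = ofR 2^-1 by rewrite ofRV (ofR_nat 2).
by rewrite /pt; apply: cplx_eq; rewrite !ReImE; field.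
Qed.

Lemma Re_karg z w : Re (karg z w) = (Im (uhp_val z) + Im (uhp_val w)) / 2.
Proof. by rewrite kargE Re_pt. Qed.

Lemma Re_karg_gt0 z w : 0 < Re (karg z w).
Proof. by rewrite Re_karg divr_gt0// addr_gt0// uhp_val_gt0. Qed.

Lemma karg_neq0 z w : karg z w != 0.
Proof. by apply/eqP => E; have := Re_karg_gt0 z w; rewrite E Re0 ltxx. Qed.

Lemma karg_conj (z w : uhp R) : karg w z = cconj (karg z w).
Proof.
rewrite !kargE; apply: cplx_eq; rewrite ?Re_conj ?Im_conj ?Re_pt ?Im_pt; first by rewrite addrC.
by field.
Qed.

Lemma kern_conj (s : R) (z w : uhp R) : kern s w z = cconj (kern s z w).
Proof. by rewrite !kernE karg_conj cpow_conj// Re_karg_gt0. Qed.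

Lemma karg_diag (z : uhp R) : karg z z = ofR (Im (uhp_val z)).
Proof.
by rewrite kargE subrr mul0r /pt ofR0 mulr0 addr0 mulrDl -splitr.
Qed.

Lemma kern_diag (s : R) (z : uhp R) : kern s z z = ofR (Im (uhp_val z) `^ (- s)).
Proof. by rewrite kernE karg_diag cpow_ofR// uhp_val_gt0. Qed.

Lemma kern_neq0 (s : R) (z w : uhp R) : kern s z w != 0.
Proof. exact: cpow_neq0. Qed.

Lemma hd_karg (z w : uhp R) : hd (fun z => karg z w) z (2 * ci)^-1.
Proof.
apply: hd_eq (hdM (hdB (hd_id z) (hd_cst (cconj (uhp_val w)) z)) (hd_cst (2 * ci)^-1 z)) _.
by rewrite subr0 mul1r mulr0 addr0.
Qed.

Lemma uhp_val_aff (phi : aff R) z :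
  uhp_val (aff_act phi z) = ofR (aff_scale phi) * uhp_val z + ofR (aff_shift phi).
Proof. by []. Qed.

Lemma karg_aff (phi : aff R) (z w : uhp R) : karg (aff_act phi z) (aff_act phi w) = ofR (aff_scale phi) * karg z w.
Proof.
rewrite /karg !uhp_val_aff cconjD cconjM !cconj_ofR; field.
by rewrite ci_neq0.
Qed.

Lemma kern_aff (s : R) (phi : aff R) (z w : uhp R) :
  kern s (aff_act phi z) (aff_act phi w) = ofR (aff_scale phi `^ (- s)) * kern s z w.
Proof. by rewrite !kernE karg_aff cpowZ ?aff_scale_gt0// Re_karg_gt0. Qed.

Lemma hd_aff (phi : aff R) z : hd (fun z => uhp_val (aff_act phi z)) z (ofR (aff_scale phi)).
Proof.
apply: hd_eq (hdD (hdZ (ofR (aff_scale phi)) (hd_id z)) (hd_cst (ofR (aff_shift phi)) z)) _.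
by rewrite mulr1 addr0.
Qed.

Lemma UaffE s (phi : aff R) f :
  Uaff s phi f = fun z => f (aff_act (aff_inv phi) z) * ofR ((aff_scale phi)^-1 `^ (s / 2)).
Proof.
apply/funext => z; rewrite /Uaff /jac (hd_hderiv (hd_aff (aff_inv phi) (uhp_i R))).
by rewrite cabs_ofR ger0_norm// ltW// invr_gt0 aff_scale_gt0.
Qed.

Definition aff_to (w : uhp R) : aff R := Aff (Re (uhp_val w)) (uhp_val_gt0 w).

Lemma aff_toE w : aff_act (aff_to w) (uhp_i R) = w.
Proof.
apply: uhp_val_inj; rewrite uhp_val_aff (_ : uhp_val (uhp_i R) = ci)//.
by rewrite [RHS]cplxE /= addrC mulrC.
Qed.

Lemma rd_conj U (t : R) l : rd U t l -> rd (fun s => cconj (U s)) t (cconj l).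
Proof.
move=> [h1 h2]; split; rewrite !ReImE.
  by move: h1; congr is_derive; apply/funext => s; rewrite Re_conj.
have -> : (fun s => Im (cconj (U s))) = - (fun s => Im (U s)).
  by apply/funext => s; rewrite Im_conj.
exact: is_deriveN.
Qed.

Lemma rd_unique U (t : R) l m : rd U t l -> rd U t m -> l = m.
Proof.
move=> [[_ h1] [_ h2]] [[_ h3] [_ h4]]; apply: cplx_eq.
  by rewrite -h1 -h3.
by rewrite -h2 -h4.
Qed.

Lemma rdM U V (t : R) l m : rd U t l -> rd V t m ->
  rd (fun s => U s * V s) t (l * V t + U t * m).
Proof.
move=> [a b] [c d]; split.
  have -> : (fun s => Re (U s * V s)) = (fun s => Re (U s)) * (fun s => Re (V s)) -
      (fun s => Im (U s)) * (fun s => Im (V s)).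
    by apply/funext => s; rewrite ReM.
  apply: is_derive_eq (is_deriveB (is_deriveM a c) (is_deriveM b d)) _.
  by rewrite /GRing.scale /= ReD !ReM; ring.
have -> : (fun s => Im (U s * V s)) = (fun s => Re (U s)) * (fun s => Im (V s)) +
    (fun s => Im (U s)) * (fun s => Re (V s)).
  by apply/funext => s; rewrite ImM.
apply: is_derive_eq (is_deriveD (is_deriveM a d) (is_deriveM b c)) _.
by rewrite /GRing.scale /= ImD !ImM; ring.
Qed.

Lemma rd_hd (f : hfun R) (g : R -> uhp R) t l m : hd f (g t) l ->
  rd (fun s => uhp_val (g s)) t m -> rd (fun s => f (g s)) t (l * m).
Proof.
move=> hf hg; have := rd_comp (g := fun s => uhp_val (g s)) hf hg.
by congr rd; apply/funext => s; rewrite ext_uhp.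
Qed.

Lemma rd_expR (t c : R) : rd (fun s => ofR (expR (c * s))) t (ofR (c * expR (c * t))).
Proof.
split=> /=; last exact: is_derive_cst.
have h : is_derive t 1 (fun s => c * s) c.
  by have := is_deriveZ c (is_derive_id t 1); rewrite /GRing.scale /= mulr1.
have := @is_derive1_comp R expR (fun s => c * s) t _ _ (is_derive_expR (c * t)) h.
by rewrite mulrC.
Qed.

(* A sesquiholomorphic kernel homogeneous under the affine group satisfies a
   first-order equation in [z], obtained from its antiholomorphy in [w] at [i]. *)
Lemma homogeneous_kernel (G : uhp R -> uhp R -> C) (s : R) :
  (forall w, holomorphic (fun z => G z w)) ->
  (forall z w, G w z = cconj (G z w)) ->
  (forall phi z w, G (aff_act phi z) (aff_act phi w) = ofR (aff_scale phi `^ (- s)) * G z w) ->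
  forall z w, G z w = G (uhp_i R) (uhp_i R) * kern s z w.
Proof.
move=> holG herm cov; pose i := uhp_i R; pose g z := G z i.
have hg : forall z, hd g z (hderiv g z) by apply/holomorphicP; exact: holG.
have ode z : (uhp_val z + ci) * hderiv g z = - ofR s * g z.
  (* By symmetry [cconj (F w) = G z w], so the conjugate of [F'] governs the dependence on the
     second argument. Translations give [e1], dilations [e2]; eliminating [F'] between them leaves
     an equation for [g] alone. *)
  pose F w := G w z; have hF := (holomorphicP F).1 (holG z) i.
  set F' := hderiv F i in hF.
  pose tr t := Aff t ltr01 : aff R.
  pose dil t := Aff 0 (expR_gt0 t) : aff R.
  have trE t w : uhp_val (aff_act (tr t) w) = uhp_val w + 1 * ofR t.
    by rewrite uhp_val_aff /= ofR1; ring.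
  have dilE t w : uhp_val (aff_act (dil t) w) = ofR (expR (1 * t)) * uhp_val w.
    by rewrite uhp_val_aff /= ofR0 mul1r addr0.
  have tr0 w : aff_act (tr 0) w = w by apply: uhp_val_inj; rewrite trE ofR0; ring.
  have dil0 w : aff_act (dil 0) w = w.
    by apply: uhp_val_inj; rewrite dilE mulr0 expR0 ofR1 mul1r.
  have rtr w : rd (fun t => uhp_val (aff_act (tr t) w)) 0 1.
    have := rd_affine (uhp_val w) 1 (0 : R).
    by congr rd; apply/funext => t; rewrite trE.
  have rdil w (c : R) : rd (fun t => uhp_val (aff_act (dil (c * t)) w)) 0 (ofR c * uhp_val w).
    have := rdZ (uhp_val w) (rd_expR (0 : R) c); rewrite mulr0 expR0 mulr1 mulrC.
    by congr rd; apply/funext => t; rewrite dilE mul1r mulrC.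
  have e1 : cconj F' = - hderiv g z.
    have a1 : rd (fun t => cconj (F (aff_act (tr t) i))) 0 (cconj (F' * 1)).
      by apply: rd_conj; apply: (rd_hd (f := F) (g := fun t => aff_act (tr t) i) _ (rtr i)); rewrite tr0.
    have a2 : rd (fun t => g (aff_act (tr (- t)) z)) 0 (hderiv g z * (-1)).
      have rr : rd (fun t => uhp_val (aff_act (tr (- t)) z)) 0 (-1).
        have := rd_affine (uhp_val z) (-1) (0 : R).
        by congr rd; apply/funext => t; rewrite trE ofRN mul1r mulN1r.
      have z0 : aff_act (tr (- 0)) z = z by rewrite oppr0; exact: tr0.
      have hz : hd g (aff_act (tr (- 0)) z) (hderiv g z) by rewrite z0; exact: hg.
      exact: (@rd_hd g (fun t => aff_act (tr (- t)) z) 0 _ _ hz rr).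
    have E : (fun t => cconj (F (aff_act (tr t) i))) = (fun t => g (aff_act (tr (- t)) z)).
      apply/funext => t; rewrite /F -herm.
      have -> : z = aff_act (tr t) (aff_act (tr (- t)) z).
        by apply: uhp_val_inj; rewrite !trE ofRN; ring.
      rewrite cov /= powR1 ofR1 mul1r; congr G; apply: uhp_val_inj; rewrite !trE ofRN; ring.
    rewrite E in a1.
    exact: etrans (congr1 cconj (esym (mulr1 F'))) (etrans (rd_unique a1 a2) (mulrN1 _)).
  have e2 : cconj (F' * ci) = - ofR s * g z - uhp_val z * hderiv g z.
    have a1 : rd (fun t => cconj (F (aff_act (dil (1 * t)) i))) 0 (cconj (F' * (ofR 1 * ci))).
      by apply: rd_conj; apply: (rd_hd (f := F) (g := fun t => aff_act (dil (1 * t)) i) _ (rdil i 1)); rewrite mulr0 dil0.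
    have zd0 : aff_act (dil (-1 * 0)) z = z by rewrite (mulr0 (-1 : R)); exact: dil0.
    have b1 : rd (fun t => g (aff_act (dil ((-1) * t)) z)) 0 (hderiv g z * (ofR (-1) * uhp_val z)).
      have hz : hd g (aff_act (dil (-1 * 0)) z) (hderiv g z) by rewrite zd0; exact: hg.
      exact: (@rd_hd g (fun t => aff_act (dil (-1 * t)) z) 0 _ _ hz (rdil z (-1))).
    have b2 : rd (fun t => ofR (expR (- s * t))) 0 (ofR (- s)).
      by have := rd_expR (0 : R) (- s); rewrite mulr0 expR0 mulr1.
    have a2 : rd (fun t => ofR (expR (- s * t)) * g (aff_act (dil ((-1) * t)) z)) 0
        (ofR (- s) * g z + hderiv g z * (ofR (-1) * uhp_val z)).
      apply: rd_eq (rdM b2 b1) _; rewrite zd0.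
      have -> : ofR (expR (- s * 0)) = 1 :> C by rewrite (mulr0 (- s)) expR0.
      by congr (_ + _); exact: mul1r.
    have E : (fun t => cconj (F (aff_act (dil (1 * t)) i))) =
        (fun t => ofR (expR (- s * t)) * g (aff_act (dil ((-1) * t)) z)).
      apply/funext => t; rewrite /F -herm mul1r mulN1r.
      have {1}-> : z = aff_act (dil t) (aff_act (dil (- t)) z).
        by apply: uhp_val_inj; rewrite !dilE mulrA -ofRM -expRD !mul1r addrN expR0 ofR1 mul1r.
      by rewrite cov /= -expRM [t * - s]mulrC.
    rewrite E in a1.
    have e3 : F' * (ofR 1 * ci) = F' * ci by exact: congr1 (mul1r ci).
    have e4 : ofR (- s) * g z + hderiv g z * (ofR (-1) * uhp_val z) =
        - ofR s * g z - uhp_val z * hderiv g z.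
      by rewrite (ofRN s) (ofRN 1); ring.
    exact: etrans (congr1 cconj (esym e3)) (etrans (rd_unique a1 a2) e4).
  move: e2; rewrite cconjM e1 cconj_i => e2.
  have -> : (uhp_val z + ci) * hderiv g z = uhp_val z * hderiv g z + (- hderiv g z * - ci) by ring.
  by rewrite e2; ring.
have gE z : g z = g i * kern s z i.
  (* The quotient of [g] by the kernel; [ode] says that its derivative vanishes. *)
  pose h z := g z * cpow (karg z i) s.
  have kz z' : karg z' i * (2 * ci) = uhp_val z' + ci.
    by rewrite /karg (divfK two_ci_neq0) (_ : uhp_val i = ci)// cconj_i opprK.
  have zi0 z' : uhp_val z' + ci != 0 :> C.
    by have := mulf_neq0 (karg_neq0 z' i) two_ci_neq0; rewrite kz.
  have hh z' : hd h z' 0.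
    apply: hd_eq (hdM (hg z') (hd_cpow (f := fun z => karg z i) s (Re_karg_gt0 z' i) (hd_karg z' i))) _.
    have -> : ofR s * cpow (karg z' i) s / karg z' i * (2 * ci)^-1 =
        ofR s * cpow (karg z' i) s / (uhp_val z' + ci).
      by rewrite -kz; field; rewrite karg_neq0 ci_neq0.
    have := ode z'; move: (zi0 z') (hderiv g z') (g z') => n0 a b E.
    have -> : a = - ofR s * b / (uhp_val z' + ci) by rewrite -E mulrAC divff ?mul1r.
    by field.
  have := hd_zero_cst hh z i; rewrite /h.
  have -> : karg i i = 1 by rewrite karg_diag.
  have -> : cpow (1 : C) s = 1 by rewrite -ofR1 cpow_ofR// powR1.
  rewrite mulr1 kernE cpowN => <-.
  by rewrite mulfK// cpow_neq0.
(* The affine map taking [i] to [w] carries the formula from the second argument [i] to [w]. *)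
move=> z w; have := cov (aff_to w) (aff_act (aff_inv (aff_to w)) z) i.
rewrite aff_actKV aff_toE -/(g _) gE => ->.
have := kern_aff s (aff_to w) (aff_act (aff_inv (aff_to w)) z) i.
by rewrite aff_actKV aff_toE => ->; exact: mulrCA.
Qed.

End Kernels.

(** * Integrals over the whole line *)

Section ImproperIntegrals.
Context {R : realType}.
Local Notation C := (cplx R).
Local Notation Re := (@complex.Re R).
Local Notation Im := (@complex.Im R).
Local Opaque cexp cpow.

(** The intervals with centre [v t] and radius [E t] meet pairwise, so the supremum of their left
    endpoints lies in all of them. *)
Lemma real_tail_limit (v E : R -> R) :
  (forall s t, 0 <= s -> 0 <= t -> `|v s - v t| <= E s + E t) ->
  exists L, forall t, 0 <= t -> `|v t - L| <= E t.
Proof.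
move=> h; pose A := [set v s - E s | s in [set s : R | 0 <= s]].
have ub t : 0 <= t -> ubound A (v t + E t).
  move=> t0 _ [s /= s0 <-]; have /ler_normlP[h1 h2] := h s t s0 t0; lra.
have hs : has_sup A.
  split; first by exists (v 0 - E 0), 0 => /=.
  by exists (v 0 + E 0); exact: ub.
exists (sup A) => t t0.
have h1 : v t - E t <= sup A by apply: ub_le_sup; [exists (v 0 + E 0); exact: ub|exists t].
have h2 : sup A <= v t + E t.
  by apply: ge_sup (ub t t0); exists (v 0 - E 0), 0 => /=.
rewrite ler_norml; apply/andP; split; lra.
Qed.

Lemma tail_limit (U : R -> C) (E : R -> R) :
  (forall s t, 0 <= s -> 0 <= t -> cabs (U s - U t) <= E s + E t) ->
  exists L, forall t, 0 <= t -> cabs (U t - L) <= 2 * E t.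
Proof.
move=> h.
have [|p hp] := @real_tail_limit (fun t => Re (U t)) E.
  by move=> s t s0 t0; rewrite -ReB; apply: le_trans (ler_Re_cabs _) (h _ _ s0 t0).
have [|q hq] := @real_tail_limit (fun t => Im (U t)) E.
  by move=> s t s0 t0; rewrite -ImB; apply: le_trans (ler_Im_cabs _) (h _ _ s0 t0).
exists (p +i* q)%C => t t0; apply: le_trans (cabs_ReIm _) _; rewrite ReB ImB /=.
by have := lerD (hp _ t0) (hq _ t0); rewrite mulr_natl mulr2n.
Qed.

Definition tends (U : R -> C) (P : C) := forall e : R, 0 < e ->
  exists T, forall t, T <= t -> cabs (U t - P) < e.

Lemma tends_unique U P Q : tends U P -> tends U Q -> P = Q.
Proof.
move=> h1 h2; apply/subr0_eq/eqP; rewrite -cabs_eq0 eq_le cabs_ge0 andbT.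
apply/ler_addgt0Pl => e e0; rewrite addr0.
have e20 : 0 < e / 2 by rewrite divr_gt0.
have [T1 k1] := h1 _ e20; have [T2 k2] := h2 _ e20.
have {}k1 := k1 (Num.max T1 T2); rewrite le_max lexx in k1.
have {}k2 := k2 (Num.max T1 T2); rewrite le_max lexx orbT in k2.
have -> : P - Q = (U (Num.max T1 T2) - Q) - (U (Num.max T1 T2) - P) by ring.
apply: le_trans (cabsD _ _) _; rewrite cabsN [e]splitr.
by apply: lerD; apply: ltW; auto.
Qed.

Lemma tends_lin c U V P Q : tends U P -> tends V Q -> tends (fun t => c * U t + V t) (c * P + Q).
Proof.
move=> h1 h2 e e0; pose A := cabs c + 1.
have A0 : 0 < A by rewrite ltr_wpDl ?cabs_ge0.
have [T1 k1] := h1 (e / 2 / A) (divr_gt0 (divr_gt0 e0 (ltr0n _ 2)) A0).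
have [T2 k2] := h2 (e / 2) (divr_gt0 e0 (ltr0n _ 2)).
exists (Num.max T1 T2) => t; rewrite ge_max => /andP[/k1 a /k2 b].
have -> : c * U t + V t - (c * P + Q) = c * (U t - P) + (V t - Q) by ring.
apply: le_lt_trans (cabsD _ _) _; rewrite [e]splitr; apply: ler_ltD => //.
rewrite cabsM; apply: (@le_trans _ _ (A * cabs (U t - P))).
  by apply: ler_wpM2r; [exact: cabs_ge0|rewrite lerDl].
by rewrite mulrC -ler_pdivlMr// ltW.
Qed.

(* [L] is the integral of [u] over the whole line. *)
Definition improper (u : R -> C) (L : C) := exists U : R -> C, antider setT u U /\
  exists P Q, [/\ L = P - Q, tends U P & tends (fun t => U (- t)) Q].

Lemma improper_unique u L L' : improper u L -> improper u L' -> L = L'.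
Proof.
move=> [U [hU [P [Q [-> h1 h2]]]]] [V [hV [P' [Q' [-> h3 h4]]]]].
have D t s : U t - U s = V t - V s.
  by apply: (@rd_diff_unique R U V u) => x _; split; [exact: hU|exact: hV].
have E1 := tends_lin (-1) h2 h1; have E2 := tends_lin (-1) h4 h3.
have : (fun t => -1 * U (- t) + U t) = (fun t => -1 * V (- t) + V t).
  by apply/funext => t; rewrite !mulN1r addrC [RHS]addrC D.
move=> E; rewrite E in E1; have := tends_unique E1 E2.
by rewrite !mulN1r addrC [RHS]addrC.
Qed.

Lemma improper_lin c u v L L' : improper u L -> improper v L' ->
  improper (fun t => c * u t + v t) (c * L + L').
Proof.
move=> [U [hU [P [Q [-> h1 h2]]]]] [V [hV [P' [Q' [-> h3 h4]]]]].
exists (fun t => c * U t + V t); split.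
  by move=> t _; apply: rdD; [apply: rdZ; exact: hU|exact: hV].
exists (c * P + P'), (c * Q + Q'); split; first by ring.
  exact: tends_lin.
exact: (tends_lin c h2 h4).
Qed.

Lemma improper_shift u L r : improper u L -> improper (fun t => u (t + r)) L.
Proof.
move=> [U [hU [P [Q [-> h1 h2]]]]].
exists (fun t => U (t + r)); split.
  move=> t _; have hr : is_derive t 1 (fun t => t + r) 1.
    have := is_deriveD (is_derive_id t 1) (is_derive_cst r t 1).
    by rewrite addr0.
  have := rd_reparam (g := fun t => t + r) (hU (t + r) I) hr.
  by rewrite ofR1 mulr1.
exists P, Q; split=> // e e0.
  have [T hT] := h1 e e0; exists (T - r) => t; rewrite lerBlDr; exact: hT.
have [T hT] := h2 e e0; exists (T + r) => t h.
have -> : - t + r = - (t - r) by ring.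
by apply: hT; rewrite lerBrDr.
Qed.

Lemma improper_conj u L : improper u L -> improper (fun t => cconj (u t)) (cconj L).
Proof.
move=> [U [hU [P [Q [-> h1 h2]]]]].
have tc V X : tends V X -> tends (fun t => cconj (V t)) (cconj X).
  move=> h e e0; have [T hT] := h e e0; exists T => t /hT.
  by rewrite -cconjN -cconjD cabs_conj.
exists (fun t => cconj (U t)); split; first by move=> t _; apply: rd_conj; exact: hU.
by exists (cconj P), (cconj Q); split; [rewrite cconjD cconjN|exact: tc|exact: tc].
Qed.

Lemma improper_exists (u : R -> C) (M k : R) : (forall t, ccont u t) -> 0 < k -> 0 <= M ->
  (forall t, cabs (u t) <= M * expR (- (k * `|t|))) ->
  exists2 L, improper u L & cabs L <= 4 * M / k.
Proof.
move=> cu k0 M0 dom; have [U hU] := antider_exists open_itvT (fun t _ => cu t).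
(* The integral of the majorant from [t] to infinity. Each half-line has limit error [2 * E 0],
   whence the bound [4 * M / k] for the two together. *)
pose E t := M / k * expR (- (k * t)).
have E0 t : 0 <= E t by rewrite mulr_ge0 ?divr_ge0 ?expR_ge0 ?(ltW k0).
have dE (t : R) : is_derive t 1 (fun t => - E t) (M * expR (- (k * t))).
  have d1 : is_derive t 1 (fun t => - (k * t)) (- k).
    have := is_deriveZ (- k) (is_derive_id t 1).
    rewrite /GRing.scale /= mulr1; congr is_derive; apply/funext => x.
    exact: mulNr.
  have d2 := @is_derive1_comp R expR (fun t => - (k * t)) t _ _ (is_derive_expR (- (k * t))) d1.
  have d3 := is_deriveZ (- (M / k)) d2.
  have -> : (fun t => - E t) = - (M / k) *: (expR \o (fun t => - (k * t))).
    by apply/funext => x; rewrite /E -mulNr.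
  apply: is_derive_eq d3 _; rewrite /GRing.scale /=.
  by field; rewrite gt_eqF.
have tail (V v : R -> C) : (forall t, rd V t (v t)) ->
    (forall t, cabs (v t) <= M * expR (- (k * `|t|))) ->
    exists2 P, tends V P & cabs (V 0 - P) <= 2 * (M / k).
  move=> hV hv.
  have one s t : 0 <= s -> s <= t -> cabs (V t - V s) <= E s.
    move=> s0 st; apply: le_trans (@rd_mean_value R V v (fun t => - E t) (fun t => M * expR (- (k * t))) s t st _ _ _) _ => //.
      by move=> x /andP[sx _]; have := hv x; rewrite ger0_norm// (le_trans s0).
    by rewrite opprK addrC gerDl oppr_le0.
  have [|P hP] := @tail_limit V E.
    move=> s t s0 t0; have [st|/ltW ts] := leP s t.
      by rewrite cabsB; apply: le_trans (one _ _ s0 st) _; rewrite lerDl.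
    by apply: le_trans (one _ _ t0 ts) _; rewrite lerDr.
  exists P; last by have := hP 0 (lexx 0); rewrite /E mulr0 oppr0 expR0 mulr1.
  move=> e e0.
  have [T hT] : exists T : R, forall t, T <= t -> 0 <= t /\ 2 * E t < e.
    pose q := e / (2 * (M / k) + 1).
    have B0 : 0 < 2 * (M / k) + 1 by rewrite ltr_wpDl// mulr_ge0// divr_ge0// ltW.
    have q0 : 0 < q by rewrite divr_gt0.
    exists (Num.max 0 (- ln q / k)) => t; rewrite ge_max => /andP[t0 tq]; split=> //.
    have : expR (- (k * t)) <= q.
      rewrite -[q]lnK ?posrE// ler_expR -[ln q]opprK lerN2 mulrC.
      by rewrite -ler_pdivrMr.
    move=> hq; apply: (@le_lt_trans _ _ (2 * (M / k) * q)).
      by rewrite /E mulrA; apply: ler_wpM2l => //; rewrite mulr_ge0// divr_ge0// ltW.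
    rewrite /q mulrC mulrAC ltr_pdivrMr// ltr_pM2l// ltrDl.
    exact: ltr01.
  by exists T => t /hT[t0 he]; apply: le_lt_trans (hP _ t0) he.
have [P tP P0] := tail U u (fun t => hU t I) dom.
have [|t|Q tQ Q0] := tail (fun t => U (- t)) (fun t => u (- t) * ofR (-1)).
- move=> t; have hN : is_derive t 1 (fun t : R => - t) (-1) := is_deriveN (is_derive_id t 1).
  exact: (rd_reparam (g := fun t => - t) (hU (- t) I) hN).
- by rewrite cabsM cabs_ofR normrN1 mulr1 -[`|t|]normrN; exact: dom.
exists (P - Q); first by exists U; split=> //; exists P, Q.
have -> : P - Q = (U (- 0) - Q) - (U 0 - P) by rewrite oppr0; ring.
apply: le_trans (cabsD _ _) _; rewrite cabsN.
have -> : 4 * M / k = 2 * (M / k) + 2 * (M / k) by ring.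
exact: lerD.
Qed.

Lemma improper_gt0 u L : improper u L -> (forall t, 0 < Re (u t)) -> 0 < Re L.
Proof.
move=> [U [hU [P [Q [-> h1 h2]]]]] hu.
have mono a b : a <= b -> exists c, Re (U b) - Re (U a) = Re (u c) * (b - a).
  move=> ab; have [||c _ E] := @MVT_segment R (fun t => Re (U t)) (fun t => Re (u t)) a b ab.
  - by move=> t _; case: (hU t I).
  - by apply: derivable_within_continuous => t _; case: (hU t I) => -[].
  by exists c.
have [c hc] := mono 0 1 ler01; rewrite subr0 mulr1 in hc.
set m := Re (u c) in hc; have m0 : 0 < m := hu c.
(* [Re U] is increasing and gains [m] on [[0, 1]]; approximating each of its limits within [m / 4]
   cannot undo this. *)
have m2 : 0 < m / 4 by rewrite divr_gt0.
have [T1 k1] := h1 _ m2; have [T2 k2] := h2 _ m2.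
pose t := Num.max 1 (Num.max T1 T2).
have [t1 t2 t3] : [/\ 1 <= t, T1 <= t & T2 <= t].
  by rewrite /t !le_max !lexx !orbT.
have {}k1 := le_lt_trans (ler_Re_cabs _) (k1 _ t2).
have {}k2 := le_lt_trans (ler_Re_cabs _) (k2 _ t3).
have [c1 hc1] := mono 1 t t1; have [|c2 hc2] := mono (- t) 0; first lra.
have p1 : 0 <= Re (u c1) * (t - 1) by rewrite mulr_ge0 ?subr_ge0// ltW.
have p2 : 0 <= Re (u c2) * (0 - - t) by rewrite mulr_ge0 ?(ltW (hu _))//; lra.
rewrite -hc1 in p1; rewrite -hc2 in p2.
move: k1 k2; rewrite !ReB => /ltr_normlP[a1 a2] /ltr_normlP[b1 b2].
by move: hc p1 p2 a1 a2 b1 b2 m0; clear; lra.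
Qed.

End ImproperIntegrals.

(** * Fractional integration as a covariant family of functionals *)

Section Intertwiner.
Context {R : realType}.
Local Notation C := (cplx R).
Local Notation Re := (@complex.Re R).
Local Notation Im := (@complex.Im R).
Local Opaque cexp cpow.

Definition isom (H H' : fspace R) (S : hfun R -> hfun R) :=
  (forall f, H f -> H' (S f)) /\
  (forall f g, H f -> H g -> fs_ip H' (S f) (S g) = fs_ip H f g).

Lemma isom_norm_hsub H H' S : is_hilbert H -> is_hilbert H' -> isom H H' S ->
  forall f g, H f -> H g -> fs_norm H' (hsub (S f) (S g)) = fs_norm H (hsub f g).
Proof.
move=> hH hH' [mS iS] f g hf hg.
rewrite /hsub -(isometry_linear hH hH' mS iS)// /fs_norm iS//; exact: mem_lincomb.
Qed.

Lemma isom_comb H H' S p s : is_hilbert H -> is_hilbert H' -> isom H H' S ->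
  (forall w, H (p w)) -> S (comb p s) = comb (fun w => S (p w)) s.
Proof.
move=> hH hH' [mS iS] hp; elim: s => [|c s IH] /=.
  have h0 := mem_hzero hH.
  have := isometry_linear hH hH' mS iS (-1) h0 h0.
  have -> : lincomb (-1) hzero hzero = hzero :> hfun R.
    by apply/funext => z; rewrite /lincomb mulr0 addr0.
  move=> /(congr1 (fun F : hfun R => F)) E; apply/funext => z.
  by have := congr1 (fun F : hfun R => F z) E; rewrite /lincomb mulN1r addNr.
by rewrite (isometry_linear hH hH' mS iS) ?IH//; exact: mem_comb.
Qed.

(** Isometries are continuous and the kernels span a dense subspace; this is the test by which
    operator identities are proved below. *)
Lemma isom_agree H K H' S1 S2 : is_rkhs H K -> is_hilbert H' -> isom H H' S1 -> isom H H' S2 ->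
  (forall w, S1 (fun z => K z w) = S2 (fun z => K z w)) -> forall f, H f -> S1 f = S2 f.
Proof.
move=> hK hH' i1 i2 E f hf; have hH := rkhs_hilbert hK.
have [s cs] := rkhs_dense hK hf.
have mc n : H (comb (fun w z => K z w) (s n)) by apply: mem_comb => // w; exact: (rkhs_kernel hK).
have m1 := i1.1 _ hf; have m2 := i2.1 _ hf.
have Z : fs_norm H' (hsub (S1 f) (S2 f)) = 0.
  apply/eqP; rewrite eq_le nrm_ge0 andbT; apply/ler_addgt0Pl => e e0; rewrite addr0.
  have [N hN] := cs _ (divr_gt0 e0 (ltr0n _ 2)); have {hN} h := hN _ (leqnn N).
  have Ec : S1 (comb (fun w z => K z w) (s N)) = S2 (comb (fun w z => K z w) (s N)).
    rewrite (isom_comb _ hH hH' i1) ?(isom_comb _ hH hH' i2)//; try exact: (rkhs_kernel hK).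
    by congr comb; apply/funext => w.
  have mS := i1.1 _ (mc N).
  apply: le_trans (nrm_sub_triangle hH' m1 mS m2) _.
  rewrite {2}Ec nrm_sub_sym// (isom_norm_hsub hH hH' i1)// (isom_norm_hsub hH hH' i2)//.
  by rewrite [e]splitr; apply: lerD; exact: ltW.
apply/funext => z; have := congr1 (fun F : hfun R => F z) (nrm_eq0 hH' (mem_hsub hH' m1 m2) Z).
by rewrite /hsub /lincomb mulN1r addrC => /subr0_eq.
Qed.

Lemma aff_actVK (phi : aff R) z : aff_act (aff_inv (aff_inv phi)) z = aff_act phi z.
Proof. by rewrite -{1}[z](aff_actK phi) aff_actK. Qed.

Lemma powRhalf_sq (x s : R) : 0 < x -> x `^ (s / 2) * x `^ (s / 2) = x `^ s.
Proof.
move=> x0; rewrite -powRD; first by rewrite -splitr.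
by rewrite (gt_eqF x0) implybT.
Qed.

Lemma ler_powR_neg (x y a : R) : 0 < x -> x <= y -> a <= 0 -> y `^ a <= x `^ a.
Proof.
move=> x0 xy a0; rewrite /powR !gt_eqF ?(lt_le_trans x0)// ler_expR.
by apply: ler_wnM2l => //; rewrite ler_ln ?posrE// (lt_le_trans x0).
Qed.

Context (A : R -> fspace R) (hA : forall s : R, 0 <= s -> is_rkhs (A s) (kern s)).

Lemma Uaff_isom s phi : 0 <= s -> isom (A s) (A s) (Uaff s phi).
Proof.
move=> s0; pose a := (aff_scale phi)^-1.
have a0 : 0 < a by rewrite invr_gt0 aff_scale_gt0.
have [||m i] := @rkhs_covariant R (A s) (kern s) (aff_act (aff_inv phi)) (aff_act phi)
    (fun=> ofR (a `^ (s / 2))) (hA s0) (aff_actKV phi) (aff_actK phi).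
- by move=> _; rewrite ofR_eq0 gt_eqF// powR_gt0.
- move=> z w; rewrite kern_aff cconj_ofR; change (aff_scale (aff_inv phi)) with a.
  set q := a `^ (s / 2).
  have E : a `^ (- s) * (q * q) = 1.
    by have -> : q * q = a `^ s := powRhalf_sq s a0; rewrite powRN mulVf// gt_eqF// powR_gt0.
  transitivity (ofR (a `^ (- s) * (q * q)) * kern s z w); first by rewrite !ofRM; ring.
  rewrite E; exact: mul1r.
by split=> [f hf|f g hf hg]; rewrite !UaffE; [exact: m|exact: i].
Qed.

Lemma UaffK (s : R) (phi : aff R) (f : hfun R) : Uaff s (aff_inv phi) (Uaff s phi f) = f.
Proof.
rewrite !UaffE; apply/funext => z /=.
rewrite aff_actVK aff_actK -mulrA -ofRM invrK.
have r0 := aff_scale_gt0 phi; set r := aff_scale phi in r0 *.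
have -> : r^-1 `^ (s / 2) * r `^ (s / 2) = 1.
  by rewrite -powRM ?invr_ge0 ?ltW// mulVf ?gt_eqF// powR1.
exact: mulr1.
Qed.

Lemma UaffVK (s : R) (phi : aff R) (f : hfun R) : Uaff s phi (Uaff s (aff_inv phi) f) = f.
Proof.
rewrite !UaffE; apply/funext => z /=.
rewrite aff_actVK aff_actKV -mulrA -ofRM invrK.
have r0 := aff_scale_gt0 phi; set r := aff_scale phi in r0 *.
have -> : r `^ (s / 2) * r^-1 `^ (s / 2) = 1.
  by rewrite -powRM ?invr_ge0 ?ltW// divff ?gt_eqF// powR1.
exact: mulr1.
Qed.

(** Since [Uaff s phi] is unitary, it can be moved across the inner product; the two arguments
    contribute one factor [c] each. *)
Lemma covariant_family s (p : uhp R -> hfun R) (c : R -> R) : 0 <= s -> (forall w, A s (p w)) ->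
  (forall phi w f, A s f -> fs_ip (A s) f (p (aff_act phi w)) =
    ofR (c (aff_scale phi)) * fs_ip (A s) (Uaff s (aff_inv phi) f) (p w)) ->
  forall phi z w, fs_ip (A s) (p (aff_act phi w)) (p (aff_act phi z)) =
    ofR (c (aff_scale phi) * c (aff_scale phi)) * fs_ip (A s) (p w) (p z).
Proof.
move=> s0 mp hp phi z w; have hH := rkhs_hilbert (hA s0).
have [mV iV] := Uaff_isom (aff_inv phi) s0; have [mU iU] := Uaff_isom phi s0.
rewrite (hp phi z _ (mp _)) (ip_conj hH (mp z)); last exact: mV.
have E : fs_ip (A s) (p z) (Uaff s (aff_inv phi) (p (aff_act phi w))) =
    fs_ip (A s) (Uaff s phi (p z)) (p (aff_act phi w)).
  have := iV _ _ (mU _ (mp z)) (mp (aff_act phi w)); by rewrite UaffK.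
rewrite {}E; have {}hp := hp _ w _ (mU _ (mp z)).
rewrite hp UaffK cconjM cconj_ofR.
have E : cconj (fs_ip (A s) (p z) (p w)) = fs_ip (A s) (p w) (p z).
  by rewrite -(ip_conj hH).
by rewrite E ofRM mulrA.
Qed.

Lemma kern_norm s w : 0 <= s ->
  fs_norm (A s) (fun z => kern s z w) = Im (uhp_val w) `^ (- s / 2).
Proof.
move=> s0; rewrite /fs_norm (rkhs_gram (hA s0)) kern_diag Re_ofR.
rewrite -(powRhalf_sq (- s) (uhp_val_gt0 w)) -expr2 sqrtr_sqr ger0_norm//.
exact: powR_ge0.
Qed.

Lemma up_subproof (w : uhp R) (t : R) : 0 < Im (uhp_val w + ci * ofR (expR t)).
Proof.
by rewrite !ReImE mul0r add0r mul1r addr_gt0 ?uhp_val_gt0 ?expR_gt0.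
Qed.
(** The vertical half-line above [w], in the logarithmic parameter that turns it into the whole line
    and dilations into shifts. *)
Definition up w t : uhp R := to_uhp (up_subproof w t).

Lemma Im_up w t : Im (uhp_val (up w t)) = Im (uhp_val w) + expR t.
Proof. by rewrite /= !ReImE mul0r add0r mul1r. Qed.

Lemma uhp_val_up w t : uhp_val (up w t) = uhp_val w + ci * ofR (expR t).
Proof. by []. Qed.

Lemma rd_up w t : rd (fun s => uhp_val (up w s)) t (ci * ofR (expR t)).
Proof.
have := rdD (rd_cst (uhp_val w) t) (rdZ ci (rd_expR t 1)).
rewrite !mul1r add0r; congr rd; apply/funext => s.
by rewrite mul1r.
Qed.

Section FractionalIntegral.
Context (s a : R) (a0 : 0 < a) (as2 : a < s / 2).

Let s0 : 0 < s. Proof. by move: a0 as2; lra. Qed.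
Let s0' : 0 <= s := ltW s0.
Let H := A s.
Let hK := hA s0'.
Let hH := rkhs_hilbert hK.

(* [\int_0^oo y^(a - 1) f(w + i y) dy] with [y = e^t]. *)
Definition integrand (f : hfun R) (w : uhp R) (t : R) : C := ofR (expR (a * t)) * f (up w t).
(** The rate of decay at both ends: [a] comes from [exp (a t)] at minus infinity, and [s / 2 - a]
    from the norm of evaluation, a power [- s / 2] of the height, at plus infinity. *)
Definition kappa := Num.min a (s / 2 - a).
(** The power bounds the integrand for [t < 0], the summand 1 for [t >= 0]. *)
Definition ibound (w : uhp R) := Im (uhp_val w) `^ (- s / 2) + 1.

Lemma kappa_gt0 : 0 < kappa.
Proof. by rewrite lt_min a0 subr_gt0. Qed.

Lemma integrand_ccont f w t : holomorphic f -> ccont (integrand f w) t.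
Proof.
move=> /holomorphicP hf; apply: ccontM; first exact: rd_ccont (rd_expR t a).
exact: rd_ccont (rd_hd (g := fun t => up w t) (hf _) (rd_up w t)).
Qed.

Lemma integrand_le f w t : H f ->
  cabs (integrand f w t) <= fs_norm H f * ibound w * expR (- (kappa * `|t|)).
Proof.
move=> hf; rewrite /integrand cabsM cabs_ofR ger0_norm ?expR_ge0//.
have n0 := nrm_ge0 H f.
have hv := rkhs_eval_le hK (up w t) hf; rewrite kern_norm// Im_up in hv.
set y := Im (uhp_val w) in hv *; have y0 : 0 < y := uhp_val_gt0 w.
have k1 : kappa <= a by rewrite ge_min lexx.
have k2 : kappa <= s / 2 - a by rewrite ge_min lexx orbT.
have ns : - s / 2 <= 0 by rewrite mulNr oppr_le0 divr_ge0.
suff h : expR (a * t) * (y + expR t) `^ (- s / 2) <= ibound w * expR (- (kappa * `|t|)).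
  apply: le_trans (ler_wpM2l (expR_ge0 _) hv) _; rewrite mulrCA -mulrA.
  exact: ler_wpM2l.
have [t0|t0] := leP 0 t.
  rewrite ger0_norm//; apply: (@le_trans _ _ (1 * expR (- (kappa * t)))); last first.
    by apply: ler_wpM2r; [exact: expR_ge0|rewrite /ibound lerDr powR_ge0].
  rewrite mul1r; apply: (@le_trans _ _ (expR (a * t) * expR t `^ (- s / 2))).
    apply: ler_wpM2l; first exact: expR_ge0.
    by apply: ler_powR_neg; rewrite ?expR_gt0// lerDr ltW.
  rewrite -expRM -expRD ler_expR -mulNr [t * _]mulrC -mulrDl; apply: ler_wpM2r => //.
  by rewrite mulNr lerNr opprD opprK addrC.
rewrite ltr0_norm// mulrN opprK.
rewrite mulrC; apply: ler_pM; rewrite ?powR_ge0 ?expR_ge0//.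
  apply: (@le_trans _ _ (y `^ (- s / 2))); last by rewrite /ibound lerDl.
  by apply: ler_powR_neg => //; rewrite lerDl expR_ge0.
by rewrite ler_expR; apply: ler_wnM2r => //; exact: ltW.
Qed.

Definition ell (w : uhp R) (f : hfun R) : C := xget 0 [set L | improper (integrand f w) L].

Lemma ell_exists f w : H f -> exists2 L, improper (integrand f w) L &
  cabs L <= 4 * (fs_norm H f * ibound w) / kappa.
Proof.
move=> hf; apply: improper_exists kappa_gt0 _ _ => [t||t].
- by apply: integrand_ccont; case: hK => _ h _ _; exact: h.
- by rewrite mulr_ge0 ?nrm_ge0// addr_ge0// powR_ge0.
exact: integrand_le.
Qed.

Lemma ell_improper f w : H f -> improper (integrand f w) (ell w f).
Proof.
move=> hf; have [L hL _] := ell_exists w hf.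
exact: (xgetPex (0 : C) (ex_intro [set L | improper (integrand f w) L] L hL)).
Qed.

Lemma ell_eq f w L : H f -> improper (integrand f w) L -> ell w f = L.
Proof. by move=> hf; apply: improper_unique; exact: ell_improper. Qed.

Lemma ell_le f w : H f -> cabs (ell w f) <= (4 * ibound w / kappa) * fs_norm H f.
Proof.
move=> hf; have [L hL] := ell_exists w hf; rewrite (ell_eq hf hL).
by move/le_trans; apply; rewrite le_eqVlt; apply/orP; left; apply/eqP; ring.
Qed.

Lemma ell_lin w c f g : H f -> H g -> ell w (lincomb c f g) = c * ell w f + ell w g.
Proof.
move=> hf hg; apply: ell_eq; first exact: mem_lincomb.
have := improper_lin c (ell_improper w hf) (ell_improper w hg).
by congr improper; apply/funext => t; rewrite /integrand /lincomb; ring.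
Qed.

Lemma frac_vector_exists w : exists p, H p /\ forall f, H f -> ell w f = fs_ip H f p.
Proof.
have [p hp ipp] := riesz hH (@ell_lin w) (@ell_le ^~ w).
by exists p.
Qed.

Definition frac_vector w : hfun R := projT1 (cid (frac_vector_exists w)).
Local Notation psi := frac_vector.

Lemma frac_vector_mem w : H (psi w).
Proof. by rewrite /psi; case: cid => p []. Qed.
Lemma frac_vectorP w f : H f -> ell w f = fs_ip H f (psi w).
Proof. by rewrite /psi; case: cid => p [_ h] /=; exact: h. Qed.

(** The substitution [y = r y'] gives [r ^ a] and the normalization of [Uaff] gives [r ^ (- s / 2)]:
    the functional has the weight of evaluation in [A (s - 2 a)]. *)
Lemma ell_aff phi w f : H f -> ell (aff_act phi w) f =
  ofR (aff_scale phi `^ (- (s - 2 * a) / 2)) * ell w (Uaff s (aff_inv phi) f).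
Proof.
move=> hf; set r := aff_scale phi; have r0 : 0 < r := aff_scale_gt0 phi.
have hV : H (Uaff s (aff_inv phi) f) by apply: (Uaff_isom _ s0').1.
apply: ell_eq => //.
(* Multiplication by a scalar is obtained from [improper_lin] by adding an integrand that vanishes
   identically, built from [hzero]. *)
have := improper_shift (- ln r) (improper_lin (ofR (r `^ (- (s - 2 * a) / 2)))
  (ell_improper w hV) (improper_lin 0 (ell_improper w hV) (ell_improper w (mem_hzero hH)))).
have -> : ell w hzero = 0.
  have h0 := mem_hzero hH; have := ell_lin w (-1) h0 h0.
  have -> : lincomb (-1) hzero hzero = hzero :> hfun R.
    by apply/funext => z; rewrite /lincomb mulr0 addr0.
  by move=> ->; ring.
rewrite mul0r !addr0; congr improper; apply/funext => t.
rewrite /integrand /hzero mul0r mulr0 !addr0 UaffE /= aff_actVK invrK.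
have -> : aff_act phi (up w (t - ln r)) = up (aff_act phi w) t.
  apply: uhp_val_inj; rewrite uhp_val_up uhp_val_aff uhp_val_aff uhp_val_up -/r.
  have -> : ofR (expR t) = ofR r * ofR (expR (t - ln r)) :> C.
    by rewrite -ofRM expRB lnK ?posrE// mulrC divfK// gt_eqF.
  by ring.
have -> : ofR (expR (a * t)) = ofR (r `^ (- (s - 2 * a) / 2)) * ofR (expR (a * (t - ln r))) * ofR (r `^ (s / 2)) :> C.
  rewrite -!ofRM; congr ofR; rewrite /powR gt_eqF//.
  by rewrite -!expRD; congr expR; field.
by ring.
Qed.

Lemma integrand_kern u z t : integrand (fun x => kern s x u) z t =
  cconj (integrand (fun x => kern s x z) u t).
Proof.
rewrite /integrand cconjM cconj_ofR -kern_conj; congr (_ * _).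
have E : karg (up z t) u = karg z (up u t).
  rewrite (kargE (up z t)) (kargE z) !Im_up !uhp_val_up; congr pt; first by ring.
  by rewrite !ReImE; field.
by rewrite (kernE s (up z t)) (kernE s z) E.
Qed.

(** The kernel does not see which of its arguments is moved upwards, up to conjugation. So, as a
    function of [z], the functional on a kernel is an element of [H], in particular holomorphic. *)
Lemma ell_kern u z : ell z (fun x => kern s x u) = psi u z.
Proof.
rewrite (rkhs_eval hK z (frac_vector_mem u)) (ip_conj hH (rkhs_kernel hK z) (frac_vector_mem u)).
rewrite -frac_vectorP; last exact: (rkhs_kernel hK z).
apply: ell_eq; first exact: (rkhs_kernel hK u).
have := improper_conj (ell_improper u (rkhs_kernel hK z)).
by congr improper; apply/funext => t; rewrite -integrand_kern.
Qed.

Lemma hd_lincomb_holo c (f g : hfun R) : holomorphic f -> holomorphic g -> holomorphic (lincomb c f g).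
Proof.
move=> /holomorphicP hf /holomorphicP hg.
by apply: (@hd_holomorphic _ _ (fun z => c * hderiv f z + hderiv g z)) => z; exact: hdD (hdZ c (hf z)) (hg z).
Qed.

(** No differentiation under the integral sign: the claim holds for kernels by [ell_kern], and
    passes to [f] by density, because the norm of the functional is bounded where the height is at
    least [y1]. *)
Lemma ell_holomorphic f : H f -> holomorphic (fun z => ell z f).
Proof.
move=> hf; have holH g : H g -> holomorphic g by case: hK => _ h _ _; exact: h.
have comb_holo t : holomorphic (fun z => ell z (comb (fun w z => kern s z w) t)).
  elim: t => [|c t IH].
    apply: (@hd_holomorphic _ _ (fun=> 0)) => z.
    have -> : (fun z => ell z (comb (fun w z => kern s z w) [::])) = (fun=> 0) :> hfun R.
      apply/funext => x /=; have h0 := mem_hzero hH; have := ell_lin x (-1) h0 h0.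
      have -> : lincomb (-1) hzero hzero = hzero :> hfun R.
        by apply/funext => y; rewrite /lincomb mulr0 addr0.
      by move=> ->; ring.
    exact: hd_cst.
  have -> : (fun z => ell z (comb (fun w z => kern s z w) (c :: t))) =
      lincomb c.1 (psi c.2) (fun z => ell z (comb (fun w z => kern s z w) t)).
    apply/funext => z /=; rewrite ell_lin; [|exact: (rkhs_kernel hK)|].
      by rewrite ell_kern.
    by apply: mem_comb => // w; exact: (rkhs_kernel hK).
  exact: hd_lincomb_holo (holH _ (frac_vector_mem _)) IH.
apply: weierstrass => x1 x2 y1 y2 e y10 e0.
have [t ct] := rkhs_dense hK hf.
pose B := 4 * (y1 `^ (- s / 2) + 1) / kappa.
have B0 : 0 < B by rewrite divr_gt0 ?kappa_gt0// mulr_gt0// ltr_wpDl// powR_ge0.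
have [N hN] := ct _ (divr_gt0 e0 B0); have {hN} h := hN _ (leqnn N).
have mc : H (comb (fun w z => kern s z w) (t N)) by apply: mem_comb => // w; exact: (rkhs_kernel hK).
exists (fun z => ell z (comb (fun w z => kern s z w) (t N))) => // z _ /andP[zy _].
have -> : ell z f - ell z (comb (fun w z => kern s z w) (t N)) =
    ell z (hsub f (comb (fun w z => kern s z w) (t N))).
  by rewrite ell_lin// mulN1r addrC.
apply: le_trans (ell_le z (mem_hsub hH hf mc)) _.
rewrite nrm_sub_sym//; apply: (@le_trans _ _ (B * fs_norm H (hsub (comb (fun w z => kern s z w) (t N)) f))).
  apply: ler_wpM2r; first exact: nrm_ge0.
  rewrite /B; apply: ler_wpM2r; first by rewrite invr_ge0 ltW// kappa_gt0.
  apply: ler_wpM2l => //; rewrite /ibound lerD2r; apply: ler_powR_neg => //.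
  by rewrite mulNr oppr_le0 divr_ge0.
by rewrite mulrC -ler_pdivlMr// ltW.
Qed.

(** Sesquiholomorphy and covariance of the Riesz vectors leave only a constant free in their Gram
    matrix; it is a squared norm. *)
Lemma frac_gram : exists2 c : R, 0 < c &
  forall z w, fs_ip H (psi w) (psi z) = ofR c * kern (s - 2 * a) z w.
Proof.
pose G z w := fs_ip H (psi w) (psi z).
have hG : forall z w, G z w = G (uhp_i R) (uhp_i R) * kern (s - 2 * a) z w.
  apply: homogeneous_kernel => [w|z w|phi z w].
  - have := ell_holomorphic (frac_vector_mem w); congr holomorphic.
    by apply/funext => z; rewrite frac_vectorP//; exact: frac_vector_mem.
  - by rewrite /G -(ip_conj hH)//; exact: frac_vector_mem.
  - rewrite /G (@covariant_family s psi (fun r => r `^ (- (s - 2 * a) / 2)))//.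
    + by rewrite powRhalf_sq// aff_scale_gt0.
    + exact: frac_vector_mem.
    + move=> phi' w' f hf; rewrite -!frac_vectorP//; last by apply: (Uaff_isom _ s0').1.
      exact: ell_aff.
have Gi : G (uhp_i R) (uhp_i R) = ofR (fs_norm H (psi (uhp_i R)) ^+ 2).
  by rewrite /G (ip_self hH)//; exact: frac_vector_mem.
exists (fs_norm H (psi (uhp_i R)) ^+ 2); last by move=> z w; rewrite -Gi -hG.
(* If the Riesz vector at [i] vanished, so would the integral of the kernel at [i] along the
   imaginary axis, where that kernel is positive. *)
rewrite exprn_gt0// lt_def nrm_ge0 andbT; apply/eqP => n0.
have pz := nrm_eq0 hH (frac_vector_mem (uhp_i R)) n0.
have hk := rkhs_kernel hK (uhp_i R).
have := improper_gt0 (ell_improper (uhp_i R) hk).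
rewrite frac_vectorP// pz ip_0r// Re0 ltxx.
suff h t : 0 < Re (integrand (fun x => kern s x (uhp_i R)) (uhp_i R) t) by move/(_ h).
rewrite /integrand kernE kargE.
have -> : (Re (uhp_val (uhp_i R)) - Re (uhp_val (up (uhp_i R) t))) / 2 = 0.
  by rewrite uhp_val_up !ReImE /=; field.
have y0 : 0 < (Im (uhp_val (up (uhp_i R) t)) + Im (uhp_val (uhp_i R))) / 2.
  by rewrite divr_gt0// addr_gt0// uhp_val_gt0.
rewrite /pt ofR0 mulr0 addr0 (cpow_ofR _ y0).
by rewrite -ofRM Re_ofR mulr_gt0 ?expR_gt0// powR_gt0.
Qed.

End FractionalIntegral.

End Intertwiner.

(** * Equivalence of the affine representations *)

Section AffineEquivalence.
Context {R : realType}.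
Local Notation C := (cplx R).
Local Opaque cexp cpow.

Definition hscale (c : C) (f : hfun R) : hfun R := fun z => c * f z.

Lemma hscaleE c (f : hfun R) : hscale c f = lincomb c f hzero.
Proof. by rewrite lincomb1_hzero. Qed.

Lemma hscaleA c d (f : hfun R) : hscale c (hscale d f) = hscale (c * d) f.
Proof. by apply/funext => z; exact: mulrA. Qed.

Lemma hscale1 (f : hfun R) : hscale 1 f = f.
Proof. by apply/funext => z; exact: mul1r. Qed.

Section Scaling.
Context (H : fspace R) (hH : is_hilbert H).

Lemma mem_hscale c f : H f -> H (hscale c f).
Proof. by rewrite hscaleE => hf; exact: mem_lincomb (mem_hzero hH). Qed.

Lemma ip_scalel c f g : H f -> H g -> fs_ip H (hscale c f) g = c * fs_ip H f g.
Proof.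
move=> hf hg; rewrite hscaleE (ip_linl hH _ hf (mem_hzero hH) hg) (ip_0l hH hg).
exact: addr0.
Qed.

Lemma ip_scaler c f g : H f -> H g -> fs_ip H g (hscale c f) = cconj c * fs_ip H g f.
Proof.
move=> hf hg; rewrite (ip_conj hH (mem_hscale c hf) hg) (ip_scalel c hf hg) cconjM.
by rewrite -(ip_conj hH hf hg).
Qed.

Lemma nrm_scale c f : H f -> fs_norm H (hscale c f) = cabs c * fs_norm H f.
Proof.
move=> hf; have m := mem_hscale c hf.
have E : ofR (fs_norm H (hscale c f) ^+ 2) = ofR ((cabs c * fs_norm H f) ^+ 2) :> C.
  rewrite -(ip_self hH m) (ip_scalel c hf m) (ip_scaler c hf hf) (ip_self hH hf) exprMn.
  rewrite (ofRM (cabs c ^+ 2)) -(mul_cconj c); exact: mulrA.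
apply/eqP; rewrite -(@eqrXn2 _ 2)// ?nrm_ge0// ?mulr_ge0 ?cabs_ge0 ?nrm_ge0//.
by apply/eqP; exact: ofR_inj E.
Qed.

End Scaling.

Lemma isom_comp (H H' H'' : fspace R) S S' : isom H H' S -> isom H' H'' S' ->
  isom H H'' (fun f => S' (S f)).
Proof.
move=> [m i] [m' i']; split=> [f hf|f g hf hg]; first exact: m' (m _ hf).
by rewrite (i' _ _ (m _ hf) (m _ hg)); exact: i.
Qed.

Lemma isom_id (H : fspace R) : isom H H (fun f => f).
Proof. by []. Qed.

Lemma isom_scale (H H' : fspace R) S c f : is_hilbert H -> is_hilbert H' -> isom H H' S ->
  H f -> S (hscale c f) = hscale c (S f).
Proof.
move=> hH hH' iS hf; have := isom_comb (p := fun=> f) [:: (c, uhp_i R)] hH hH' iS (fun=> hf).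
by rewrite /= -!hscaleE.
Qed.

Lemma isom_inj (H H' : fspace R) S f g : is_hilbert H -> is_hilbert H' -> isom H H' S ->
  H f -> H g -> S f = S g -> f = g.
Proof.
move=> hH hH' iS hf hg E.
have n0 : fs_norm H (hsub f g) = 0.
  rewrite -(isom_norm_hsub hH hH' iS hf hg) E; have -> : hsub (S g) (S g) = hzero.
    by apply/funext => z; rewrite /hsub /lincomb mulN1r addNr.
  by rewrite /fs_norm (ip_0l hH' (mem_hzero hH')) Re0 sqrtr0.
apply/funext => z; have := congr1 (fun F : hfun R => F z) (nrm_eq0 hH (mem_hsub hH hf hg) n0).
by rewrite /hsub /lincomb mulN1r addrC => /subr0_eq.
Qed.

(** Unitary equivalence on the function spaces themselves, to which the statement about quotients
    reduces once derivatives are taken. *)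
Definition intertwined (G : Type) (H : fspace R) (U : G -> hfun R -> hfun R)
    (H' : fspace R) (U' : G -> hfun R -> hfun R) :=
  exists S, [/\ isom H H' S, (forall h, H' h -> exists2 f, H f & S f = h) &
    forall x f, H f -> S (U x f) = U' x (S f)].

Lemma intertwined_refl (G : Type) H (U : G -> hfun R -> hfun R) : intertwined H U H U.
Proof. by exists (fun f => f); split => // h hh; exists h. Qed.

Lemma intertwined_sym (G : Type) H (U : G -> hfun R -> hfun R) H' U' :
  is_hilbert H -> is_hilbert H' -> (forall x f, H f -> H (U x f)) ->
  intertwined H U H' U' -> intertwined H' U' H U.
Proof.
move=> hH hH' mU [S [iS sS cS]].
have /choice [T hT] : forall h, exists f, H' h -> H f /\ S f = h.
  move=> h; have [hh|nh] := pselect (H' h); last by exists hzero.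
  by have [f hf Sf] := sS h hh; exists f.
have inj := isom_inj hH hH' iS.
exists T; split.
- split=> [f /hT[]//|f g hf hg].
  have [tf Sf] := hT f hf; have [tg Sg] := hT g hg.
  by rewrite -{2}Sf -{2}Sg (iS.2 _ _ tf tg).
- move=> h hh; exists (S h); first exact: iS.1.
  have [t E] := hT (S h) (iS.1 _ hh); exact: inj t hh E.
move=> x f hf; have [t E] := hT f hf.
have m : H' (U' x f) by rewrite -E -(cS _ _ t); exact: iS.1 (mU _ _ t).
have [t' E'] := hT _ m; apply: (inj _ _ t' (mU _ _ t)).
by rewrite E' (cS _ _ t) E.
Qed.

Context (A : R -> fspace R) (hA : forall s : R, 0 <= s -> is_rkhs (A s) (kern s)).

Definition skern (s : R) (w : uhp R) : hfun R := fun z => kern s z w.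

Lemma Uaff_skern s phi w : Uaff s phi (skern s w) =
  hscale (ofR (aff_scale phi `^ (s / 2))) (skern s (aff_act phi w)).
Proof.
rewrite UaffE; apply/funext => z; rewrite /hscale /skern.
have := kern_aff s (aff_inv phi) z (aff_act phi w); rewrite aff_actK => ->.
change (aff_scale (aff_inv phi)) with (aff_scale phi)^-1.
have r0 := aff_scale_gt0 phi; set r := aff_scale phi in r0 *.
have E : r^-1 `^ (- s) * r^-1 `^ (s / 2) = r `^ (s / 2).
  rewrite -powR_inv1 ?ltW// -!powRrM -powRD; last by rewrite (gt_eqF r0) implybT.
  by congr (r `^ _); field.
by rewrite -E ofRM; ring.
Qed.

Lemma covariant_vector s (p : uhp R -> hfun R) (c : R -> R) : 0 <= s -> (forall w, A s (p w)) ->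
  (forall phi w f, A s f -> fs_ip (A s) f (p (aff_act phi w)) =
    ofR (c (aff_scale phi)) * fs_ip (A s) (Uaff s (aff_inv phi) f) (p w)) ->
  forall phi w, p (aff_act phi w) = hscale (ofR (c (aff_scale phi))) (Uaff s phi (p w)).
Proof.
move=> s0 mp hp phi w; have hK := hA s0; have hH := rkhs_hilbert hK; apply/funext => z.
have [mV iV] := Uaff_isom hA (aff_inv phi) s0; have [mU iU] := Uaff_isom hA phi s0.
have mz := rkhs_kernel hK z.
rewrite /hscale (rkhs_eval hK z (mp _)) (rkhs_eval hK z (mU _ (mp w))).
rewrite (ip_conj hH mz (mp _)) (hp _ _ _ mz) cconjM cconj_ofR; congr (_ * _).
rewrite -(ip_conj hH (mV _ mz) (mp w)).
by have := iV _ _ (mU _ (mp w)) mz; rewrite UaffK.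
Qed.

Lemma gram_isometry s (H' : fspace R) (p : uhp R -> hfun R) c : 0 <= s -> is_hilbert H' ->
  0 < c -> (forall w, H' (p w)) -> (forall z w, fs_ip H' (p w) (p z) = ofR c * kern s z w) ->
  exists2 S, isom (A s) H' S & forall w, S (skern s w) = hscale (ofR (Num.sqrt c)^-1) (p w).
Proof.
move=> s0 hH' c0 mp gr; set d := (Num.sqrt c)^-1.
have E : d * d * c = 1.
  have q0 : Num.sqrt c != 0 by rewrite gt_eqF// sqrtr_gt0.
  by rewrite -[c in _ * c](sqr_sqrtr (ltW c0)) /d; field.
have mq w : H' (hscale (ofR d) (p w)) := mem_hscale hH' _ (mp w).
have grq z w : fs_ip H' (hscale (ofR d) (p w)) (hscale (ofR d) (p z)) = kern s z w.
  rewrite (ip_scalel hH' _ (mp w) (mq z)) (ip_scaler hH' _ (mp z) (mp w)) cconj_ofR gr.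
  transitivity (ofR (d * d * c) * kern s z w); first by rewrite !ofRM; ring.
  rewrite E ofR1; exact: mul1r.
by have [S [m i k]] := rkhs_isometry (hA s0) hH' mq grq; exists S.
Qed.

Section Descent.
Context (s a : R) (a0 : 0 < a) (as2 : a < s / 2).
Local Notation s' := (s - 2 * a).
Let s0 : 0 <= s. Proof. by move: a0 as2; lra. Qed.
Let s'0 : 0 <= s'. Proof. by move: a0 as2; lra. Qed.
Let hK := hA s0.
Let hK' := hA s'0.
Let hH := rkhs_hilbert hK.
Let hH' := rkhs_hilbert hK'.
Local Notation psi := (frac_vector hA a0 as2).

Lemma frac_intertwiner : exists2 S, isom (A s') (A s) S &
  forall phi f, A s' f -> S (Uaff s' phi f) = Uaff s phi (S f).
Proof.
have [c c0 gr] := frac_gram hA a0 as2.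
have mp w : A s (psi w) by exact: frac_vector_mem.
have [S iS SK] := gram_isometry s'0 hH c0 mp gr.
(* Both composites are compared on kernels, where covariance of [psi] produces the powers [s' / 2]
   and [- s' / 2] of the scale, which cancel. *)
exists S => // phi; apply: (isom_agree hK' hH
  (isom_comp (Uaff_isom hA phi s'0) iS) (isom_comp iS (Uaff_isom hA phi s0))) => w.
rewrite -/(skern s' w) SK Uaff_skern.
rewrite (isom_scale _ hH' hH iS (rkhs_kernel hK' _)) SK.
have -> : psi (aff_act phi w) =
    hscale (ofR (aff_scale phi `^ (- s' / 2))) (Uaff s phi (psi w)).
  apply: (@covariant_vector s psi (fun r => r `^ (- s' / 2)) s0 mp) => phi' w' f hf.
  rewrite -(frac_vectorP hA a0 as2 w' ((Uaff_isom hA (aff_inv phi') s0).1 _ hf)).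
  by rewrite -(frac_vectorP hA a0 as2 _ hf); exact: (ell_aff hA a0 as2 phi' w' hf).
rewrite (isom_scale _ hH hH (Uaff_isom hA phi s0) (mp w)) !hscaleA; congr hscale.
have r0 := aff_scale_gt0 phi; set r := aff_scale phi in r0 *.
have E : r `^ (s' / 2) * r `^ (- s' / 2) = 1.
  rewrite -powRD; last by rewrite (gt_eqF r0) implybT.
  by rewrite mulNr subrr powRr0.
by rewrite mulrAC -ofRM E; exact: mul1r.
Qed.

(* The Riesz vectors [p w] of [f |-> S f w] have Gram matrix [c * kern s] and define an isometry [T]
   with [S (T h) = sqrt c * h]; comparing norms, [c = 1], so that [S] is onto. *)
Lemma frac_intertwined : intertwined (A s') (Uaff s') (A s) (Uaff s).
Proof.
have [S iS cS] := frac_intertwiner; exists S; split => //.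
have ex w : exists2 p, A s' p & forall f, A s' f -> S f w = fs_ip (A s') f p.
  apply: (riesz hH' (M := fs_norm (A s) (skern s w))) => [c f g hf hg|f hf].
    by rewrite (isometry_linear hH' hH iS.1 iS.2 c hf hg).
  apply: le_trans (rkhs_eval_le hK w (iS.1 _ hf)) _.
  by rewrite {1}/fs_norm (iS.2 _ _ hf hf) mulrC.
have /choice [p hp] : forall w, exists p, A s' p /\ forall f, A s' f -> S f w = fs_ip (A s') f p.
  by move=> w; have [p] := ex w; exists p.
have mp w : A s' (p w) := (hp w).1; have Sp w f : A s' f -> S f w = fs_ip (A s') f (p w) := (hp w).2 f.
pose G z w := fs_ip (A s') (p w) (p z).
have hG : forall z w, G z w = G (uhp_i R) (uhp_i R) * kern s z w.
  apply: homogeneous_kernel => [w|z w|phi z w].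
  (* [G z w] is the value at [z] of [S (p w)], an element of [A s]. *)
  - have hol : holomorphic (S (p w)) by case: hK => _ h _ _; exact: h (iS.1 _ (mp w)).
    by move: hol; congr holomorphic; apply/funext => z; rewrite Sp.
  - by rewrite /G -(ip_conj hH' (mp w) (mp z)).
  rewrite /G (@covariant_family _ _ hA s' p (fun r => r `^ (- s / 2)) s'0 mp).
    by rewrite powRhalf_sq// aff_scale_gt0.
  move=> phi' w' f hf; have mf := (Uaff_isom hA (aff_inv phi') s'0).1 _ hf.
  rewrite -(Sp _ _ hf) -(Sp _ _ mf) (cS _ _ hf) UaffE /= aff_actVK invrK mulrCA -ofRM.
  have r0 := aff_scale_gt0 phi'; set r := aff_scale phi' in r0 *.
  have -> : r `^ (- s / 2) * r `^ (s / 2) = 1.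
    rewrite -powRD; last by rewrite (gt_eqF r0) implybT.
    by rewrite mulNr addNr powRr0.
  by rewrite mulr1.
have Gi : G (uhp_i R) (uhp_i R) = ofR (fs_norm (A s') (p (uhp_i R)) ^+ 2) by exact: ip_self.
rewrite {}Gi in hG; set c := (_ ^+ 2 : R) in hG.
have kii : kern s' (uhp_i R) (uhp_i R) = 1 by rewrite kern_diag /= powR1 ofR1.
(* If [c = 0], all [p w] vanish and [S] annihilates a kernel, against the isometry. *)
have c0 : 0 < c.
  rewrite lt_def sqr_ge0 andbT; apply/eqP => c0.
  have p0 w : p w = hzero.
    have : fs_norm (A s') (p w) ^+ 2 = 0.
      apply: (@ofR_inj R); rewrite -(ip_self hH' (mp w)) -/(G w w) hG c0 ofR0; exact: mul0r.
    by move/eqP; rewrite sqrf_eq0 => /eqP n0; exact: (nrm_eq0 hH' (mp w) n0).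
  have mk := rkhs_kernel hK' (uhp_i R).
  have S0 : S (skern s' (uhp_i R)) = hzero.
    apply/funext => w; rewrite (Sp _ _ mk) p0.
    by rewrite (ip_conj hH' (mem_hzero hH') mk) (ip_0l hH' mk) cconj0.
  have := iS.2 _ _ mk mk; rewrite S0 (ip_0l hH (mem_hzero hH)) (rkhs_gram hK') kii => /eqP.
  by rewrite eq_sym oner_eq0.
have [T iT TK] := gram_isometry s0 hH' c0 mp hG.
have STK w : S (T (skern s w)) = hscale (ofR (Num.sqrt c)) (skern s w).
  rewrite TK (isom_scale _ hH' hH iS (mp w)); apply/funext => z; rewrite /hscale (Sp _ _ (mp w)).
  rewrite -/(G z w) hG mulrA -ofRM; congr (ofR _ * _).
  by rewrite -{2}(sqr_sqrtr (ltW c0)) expr2 mulrA mulVf ?mul1r// gt_eqF// sqrtr_gt0.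
have c1 : Num.sqrt c = 1.
  have mk := rkhs_kernel hK (uhp_i R).
  have iST := isom_comp iT iS.
  have E := iST.2 _ _ mk mk; rewrite STK in E.
  have n : fs_norm (A s) (hscale (ofR (Num.sqrt c)) (skern s (uhp_i R))) = fs_norm (A s) (skern s (uhp_i R)).
    by rewrite /fs_norm E.
  move: n; rewrite (nrm_scale hH _ mk) cabs_ofR ger0_norm ?sqrtr_ge0//.
  rewrite /skern (kern_norm hA _ s0) /= powR1.
  by move=> <-; rewrite mulr1.
move=> h hh; exists (T h); first exact: iT.1.
apply: (isom_agree hK hH (isom_comp iT iS) (isom_id (A s)) _ hh) => w.
by rewrite -/(skern s w) STK c1 ofR1 hscale1.
Qed.

End Descent.

Lemma affine_intertwined s s' : 0 < s -> 0 < s' -> intertwined (A s) (Uaff s) (A s') (Uaff s').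
Proof.
move=> s0 s'0.
have main t t' : 0 < t' -> t' < t -> intertwined (A t') (Uaff t') (A t) (Uaff t).
  move=> t'0 tt; have a0 : 0 < (t - t') / 2 by move: t'0 tt; lra.
  have a2 : (t - t') / 2 < t / 2 by move: t'0 tt; lra.
  have := frac_intertwined a0 a2; have -> // : t - 2 * ((t - t') / 2) = t' by field.
have [ss|ss|->] := ltgtP s s'; [exact: main| |exact: intertwined_refl].
have h := main _ _ s'0 ss; apply: intertwined_sym h.
- exact: rkhs_hilbert (hA (ltW s'0)).
- exact: rkhs_hilbert (hA (ltW s0)).
- by move=> x f hf; exact: (Uaff_isom hA x (ltW s'0)).1.
Qed.

End AffineEquivalence.

(** * Derivatives and quotients by polynomials *)

Section Quotients.
Context {R : realType}.
Local Notation C := (cplx R).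
Local Notation D := (@hderiv R).
Local Opaque cexp cpow.

Lemma holomorphic_iterD k (f : hfun R) : holomorphic f -> holomorphic (iter k D f).
Proof. by move=> hf; elim: k => [|k IH]; [exact: hf|exact: holomorphic_hderiv IH]. Qed.

Lemma hderiv_lincomb c (f g : hfun R) : holomorphic f -> holomorphic g ->
  D (lincomb c f g) = lincomb c (D f) (D g).
Proof.
move=> /holomorphicP hf /holomorphicP hg; apply: hd_hderivE => z.
exact: hdD (hdZ c (hf z)) (hg z).
Qed.

Lemma iterD_lincomb k c (f g : hfun R) : holomorphic f -> holomorphic g ->
  iter k D (lincomb c f g) = lincomb c (iter k D f) (iter k D g).
Proof.
move=> hf hg; elim: k => [//|k IH]; rewrite !iterS IH.
exact: (hderiv_lincomb c) (holomorphic_iterD hf) (holomorphic_iterD hg).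
Qed.

Lemma iterD_surj k (g : hfun R) : holomorphic g -> exists2 f, holomorphic f & iter k D f = g.
Proof.
elim: k g => [|k IH] g hg; first by exists g.
have [h hh] := holomorphic_primitive hg.
have [f hf fE] := IH h (hd_holomorphic hh); exists f => //=.
by rewrite fE; exact: hd_hderivE.
Qed.

Lemma hd_horner (p : {poly C}) z : hd (fun z => p.[uhp_val z]) z p^`().[uhp_val z].
Proof.
elim/poly_ind: p => [|p c IH].
  rewrite deriv0 horner0; have := hd_cst (0 : C) z.
  by congr hd; apply/funext => w; rewrite horner0.
have := hdD (hdM IH (hd_id z)) (hd_cst c z).
have -> : (fun z => (p * 'X + c%:P).[uhp_val z]) = (fun z => p.[uhp_val z] * uhp_val z + c).
  by apply/funext => w; rewrite hornerMXaddC.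
move/hd_eq; apply; rewrite derivMXaddC hornerD hornerMX; ring.
Qed.

Lemma polys_iterD k (q : hfun R) : polys k q -> holomorphic q /\ iter k D q = hzero.
Proof.
elim: k q => [|k IH] q [p sp ->].
  have -> : p = 0 by apply/eqP; rewrite -size_poly_leq0.
  have E : (fun z : uhp R => (0 : {poly C}).[uhp_val z]) = hzero.
    by apply/funext => z; rewrite horner0.
  by rewrite E; split=> //; exact: hd_holomorphic (hd_cst 0).
split; first exact: hd_holomorphic (hd_horner p).
rewrite iterSr (hd_hderivE (hd_horner p)); apply: (IH _ _).2.
exists p^`() => //; rewrite -ltnS; have [->|p0] := eqVneq p 0; first by rewrite deriv0 size_poly0.
exact: leq_trans (lt_size_deriv p0) sp.
Qed.

Lemma iterD_polys k (f : hfun R) : holomorphic f -> iter k D f = hzero -> polys k f.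
Proof.
elim: k f => [|k IH] f hf /=.
  by move=> ->; exists 0; [rewrite size_poly0|apply/funext => z; rewrite horner0].
move=> E; have [|p sp pE] := IH (D f) (holomorphic_hderiv hf); first by rewrite -iterSr.
(* The termwise antiderivative. At [i = 0] the coefficient is a division by 0, hence 0; the right
   constant term is added in the witness below. *)
pose P := \poly_(i < k.+1) (p`_i.-1 / i%:R) : {poly C}.
have dP : P^`() = p.
  apply/polyP => i; rewrite coef_deriv coef_poly ltnS.
  case: ltnP => ik; last by rewrite mul0rn nth_default// (leq_trans sp).
  rewrite -(mulr_natr (p`_i / i.+1%:R)); apply: divfK; by rewrite pnatr_eq0.
have hz z : hd (fun z => f z + - P.[uhp_val z]) z 0.
  have h1 := (holomorphicP f).1 hf z; rewrite {1}pE in h1.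
  apply: hd_eq (hdD h1 (hdN (hd_horner P z))) _.
  by rewrite dP subrr.
exists (P + (f (uhp_i R) - P.[uhp_val (uhp_i R)])%:P).
  rewrite (leq_trans (size_polyD _ _))// geq_max size_poly /= (leq_trans (size_polyC_leq1 _))//.
apply/funext => z; rewrite hornerD hornerC -(hd_zero_cst hz z) addrC.
by rewrite subrK.
Qed.

(* The elements of the quotients are the sets of this form. *)
Definition fib k (u : hfun R) : set (hfun R) := [set h | holomorphic h /\ iter k D h = u].

Lemma coset_fib k (f : hfun R) : holomorphic f -> coset k f = fib k (iter k D f).
Proof.
move=> hf; apply/seteqP; split=> [_ [q /polys_iterD[hq q0] <-]|h [hh hE]].
  split; first exact: hd_lincomb_holo.
  rewrite iterD_lincomb// q0; apply/funext => z; rewrite /lincomb /hzero addr0; exact: mul1r.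
exists (lincomb (-1) f h).
  apply: iterD_polys; first exact: hd_lincomb_holo.
  rewrite iterD_lincomb// hE; apply/funext => z; rewrite /lincomb /hzero; ring.
by apply/funext => z; rewrite /lincomb; ring.
Qed.

Lemma fib_inj k (u v : hfun R) : holomorphic u -> fib k u = fib k v -> u = v.
Proof.
move=> hu E; have [f hf fE] := iterD_surj k hu.
have [_ <-] : fib k v f by rewrite -E.
by rewrite fE.
Qed.

Lemma set_lincomb_fib k a (u v : hfun R) : holomorphic u -> holomorphic v ->
  set_lincomb a (fib k u) (fib k v) = fib k (lincomb a u v).
Proof.
move=> hu hv; apply/seteqP; split=> [_ [f [hf <-] [g [hg <-] <-]]|h [hh hE]].
  by split; [exact: hd_lincomb_holo|rewrite iterD_lincomb].
have [f hf fE] := iterD_surj k hu.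
exists f => //; exists (lincomb (- a) f h).
  split; first exact: hd_lincomb_holo.
  rewrite iterD_lincomb// hE fE; apply/funext => z; rewrite /lincomb; ring.
by apply/funext => z; rewrite /lincomb; ring.
Qed.

(** The [k]-th derivative carries [U] to [U1]. Surjectivity of [U x] and injectivity of [U1 x] are
    included so that [U x] maps a fibre onto a whole fibre, as in [image_fib]. *)
Definition deriv_action (G : Type) k (U U1 : G -> hfun R -> hfun R) := forall x,
  [/\ (forall f, holomorphic f -> holomorphic (U x f) /\ iter k D (U x f) = U1 x (iter k D f)),
      (forall h, holomorphic h -> exists2 f, holomorphic f & U x f = h) &
      (forall f g, U1 x f = U1 x g -> f = g)].

Lemma image_fib (G : Type) k (U U1 : G -> hfun R -> hfun R) x u :
  deriv_action k U U1 -> U x @` fib k u = fib k (U1 x u).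
Proof.
move=> /(_ x)[dU sU iU]; apply/seteqP; split=> [_ [f [hf <-] <-]|h [hh hE]].
  by have [] := dU f hf.
have [f hf fE] := sU h hh; exists f => //; split => //.
by apply: iU; rewrite -(dU f hf).2 fE.
Qed.

Section Equivalence.
Context (A : R -> fspace R) (hA : forall s : R, 0 <= s -> is_rkhs (A s) (kern s)).
Context (G : Type) (s s' : R) (k k' : nat) (U U1 U' U1' : G -> hfun R -> hfun R).
Local Notation sg := (s + 2 * k%:R).
Local Notation sg' := (s' + 2 * k'%:R).
Hypotheses (sg0 : 0 <= sg) (sg'0 : 0 <= sg').
Hypotheses (dU : deriv_action k U U1) (dU' : deriv_action k' U' U1').

Let hol u : A sg u -> holomorphic u.
Proof. by case: (hA sg0) => _ h _ _; exact: h. Qed.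
Let hol' u : A sg' u -> holomorphic u.
Proof. by case: (hA sg'0) => _ h _ _; exact: h. Qed.

Lemma hatspP t n X : (forall u, A (t + 2 * n%:R) u -> holomorphic u) ->
  hatsp n (Ask A t n) X <-> exists2 u, A (t + 2 * n%:R) u & X = fib n u.
Proof.
move=> h; split=> [[f [hf mf] <-]|[u mu ->]].
  by exists (iter n D f) => //; exact: coset_fib.
have [f hf fE] := iterD_surj n (h _ mu).
by exists f; [split; rewrite ?fE|rewrite coset_fib// fE].
Qed.

Lemma equivalent_of_intertwined : intertwined (A sg) U1 (A sg') U1' ->
  unitarily_equivalent k (Ask A s k) U k' (Ask A s' k') U'.
Proof.
move=> [S [iS sS cS]]; have hH := rkhs_hilbert (hA sg0); have hH' := rkhs_hilbert (hA sg'0).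
(* All elements of a fibre have the same [k]-th derivative, so [T] sends the fibre of [u] to the
   fibre of [S u] without a choice of representatives. *)
pose T X : set (hfun R) := [set h | holomorphic h /\ exists2 f, X f & iter k' D h = S (iter k D f)].
have TE u : A sg u -> T (fib k u) = fib k' (S u).
  move=> mu; apply/seteqP; split=> [h [hh [f [hf <-] E]]|h [hh hE]]; first by [].
  by have [f hf fE] := iterD_surj k (hol mu); split=> //; exists f => //; rewrite fE.
exists T; split.
- split.
  + move=> X /hatspP-/(_ hol)[u mu ->]; apply/(hatspP _ hol').
    by exists (S u); [exact: iS.1|exact: TE].
  + move=> X Y /set_mem/hatspP-/(_ hol)[u mu ->] /set_mem/hatspP-/(_ hol)[v mv ->].
    rewrite !TE// => /(fib_inj (hol' (iS.1 _ mu))) E; congr fib.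
    exact: isom_inj hH hH' iS mu mv E.
  + move=> Y /hatspP-/(_ hol')[v mv ->]; have [u mu uE] := sS v mv.
    by exists (fib k u); [apply/(hatspP _ hol); exists u|rewrite TE// uE].
- move=> a X Y /hatspP-/(_ hol)[u mu ->] /hatspP-/(_ hol)[v mv ->].
  rewrite !TE// !set_lincomb_fib; [|exact: hol'(iS.1 _ mu)|exact: hol'(iS.1 _ mv)|exact: hol|exact: hol].
  rewrite TE; last exact: mem_lincomb.
  by rewrite (isometry_linear hH hH' iS.1 iS.2).
- move=> X Y /hatspP-/(_ hol)[u mu ->] /hatspP-/(_ hol)[v mv ->] f g f' g'.
  by rewrite !TE// => -[_ fE] [_ gE] [_ f'E] [_ g'E]; rewrite /= fE gE f'E g'E; exact: iS.2.
- move=> x X /hatspP-/(_ hol)[u mu ->].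
  rewrite TE// (image_fib x u dU) (image_fib x _ dU') -cS//.
  apply/seteqP; split=> [h [hh [f [hf <-] E]]|h [hh hE]]; first by [].
  have [f0 hf0 f0E] := iterD_surj k (hol mu).
  have [d _ _] := dU x; have [d1 d2] := d _ hf0.
  by split=> //; exists (U x f0); [split=> //; rewrite d2 f0E|rewrite hE d2 f0E].
Qed.

Lemma intertwined_of_equivalent : unitarily_equivalent k (Ask A s k) U k' (Ask A s' k') U' ->
  intertwined (A sg) U1 (A sg') U1'.
Proof.
move=> [T [[T1 T2 T3] _ Ti Tc]].
(* For [u] in the space, [T (fib k u)] is a fibre of the [k']-th derivative, so whichever element
   [xget] picks yields the same [S u]. *)
pose S u : hfun R := iter k' D (xget hzero (T (fib k u))).
have mX u : A sg u -> hatsp k (Ask A s k) (fib k u) by move=> mu; apply/(hatspP _ hol); exists u.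
have TE u : A sg u -> A sg' (S u) /\ T (fib k u) = fib k' (S u).
  move=> mu; have /hatspP-/(_ hol')[v mv E] := T1 _ (mX u mu).
  have [h hh hE] := iterD_surj k' (hol' mv).
  have ST : S u = v by rewrite /S E; case: xgetP => [g _ [_ ->//]|/(_ h) []].
  by rewrite ST.
have iS : isom (A sg) (A sg') S.
  split=> [u /TE[]//|u v mu mv].
  have [su uE] := TE u mu; have [sv vE] := TE v mv.
  have [f hf fE] := iterD_surj k (hol mu); have [g hg gE] := iterD_surj k (hol mv).
  have [f' hf' f'E] := iterD_surj k' (hol' su); have [g' hg' g'E] := iterD_surj k' (hol' sv).
  have := Ti _ _ (mX u mu) (mX v mv) f g f' g'; rewrite uE vE /= fE gE f'E g'E.
  by apply; split.
exists S; split=> //.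
- move=> v mv; have [|X hX XE] := T3 (fib k' v); first by apply/(hatspP _ hol'); exists v.
  move: hX => /hatspP-/(_ hol)[u mu uE]; exists u => //.
  by apply: (fib_inj (k := k')); [exact: hol' (iS.1 _ mu)|rewrite -XE uE (TE u mu).2].
move=> x u mu; have := Tc x _ (mX u mu).
rewrite (TE u mu).2 (image_fib x u dU) (image_fib x _ dU') => E; rewrite {1}/S E.
have [su uE] := TE u mu.
have [f0 hf0 f0E] := iterD_surj k' (hol' su).
case: xgetP => [g _ [_ ->//]|/(_ (U' x f0)) []].
by have [d _ _] := dU' x; have [d1 d2] := d _ hf0; split=> //; rewrite d2 f0E.
Qed.

End Equivalence.

(** Each derivative brings out one more factor, the inverse scale, which raises the weight by 2. *)
Lemma Uaff_deriv_action (s : R) k : deriv_action k (Uaff s) (Uaff (s + 2 * k%:R)).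
Proof.
have hU (t : R) phi (f : hfun R) z l : hd f (aff_act (aff_inv phi) z) l ->
    hd (Uaff t phi f) z (ofR ((aff_scale phi)^-1 `^ (t / 2 + 1)) * l).
  move=> hf; rewrite UaffE.
  have r0 : 0 < (aff_scale phi)^-1 by rewrite invr_gt0 aff_scale_gt0.
  have := hdM (hd_comp hf (hd_aff (aff_inv phi) z)) (hd_cst (ofR ((aff_scale phi)^-1 `^ (t / 2))) z).
  move/hd_eq; apply; change (aff_scale (aff_inv phi)) with (aff_scale phi)^-1.
  rewrite powRD; last by rewrite (gt_eqF r0) implybT.
  by rewrite powRr1 ?ltW// ofRM; ring.
have holU t phi (f : hfun R) : holomorphic f -> holomorphic (Uaff t phi f).
  move=> /holomorphicP hf.
  exact: hd_holomorphic (fun z => hU t phi f z _ (hf (aff_act (aff_inv phi) z))).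
move=> phi; split.
- move=> f hf; split; first exact: holU.
  elim: k => [|k IH] /=; first by rewrite mulr0 addr0.
  rewrite IH; apply: hd_hderivE => z.
  have /holomorphicP hg := holomorphic_iterD (k := k) hf.
  have := hU (s + 2 * k%:R) phi _ z _ (hg (aff_act (aff_inv phi) z)).
  move/hd_eq; apply; rewrite UaffE mulrC; congr (_ * ofR (_ `^ _)).
  by rewrite -[k.+1]addn1 natrD; field.
- by move=> h hh; exists (Uaff s (aff_inv phi) h); [exact: holU|exact: UaffVK].
by move=> f g /(congr1 (Uaff (s + 2 * k%:R) (aff_inv phi))); rewrite !UaffK.
Qed.

Lemma affine_equivalence (A : R -> fspace R) (s s' : R) k k' :
  (forall s : R, 0 <= s -> is_rkhs (A s) (kern s)) ->
  0 < s + 2 * k%:R -> 0 < s' + 2 * k'%:R ->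
  unitarily_equivalent k (Ask A s k) (Uaff s) k' (Ask A s' k') (Uaff s').
Proof.
move=> hA s0 s'0; apply: (equivalent_of_intertwined hA (ltW s0) (ltW s'0)).
- exact: Uaff_deriv_action.
- exact: Uaff_deriv_action.
exact: affine_intertwined.
Qed.

End Quotients.

(** * Automorphisms of the half-plane *)

Section Automorphisms.
Context {R : realType}.
Local Notation C := (cplx R).
Local Notation Re := (@complex.Re R).
Local Notation Im := (@complex.Im R).
Local Opaque cexp cpow.

Lemma removable (f : C -> C) (a l : C) : holoC f -> is_derive a 1 f l -> 0 < Im a ->
  holoC (dquot f a l).
Proof.
move=> hf hl a0; have [|z z0 za|F hF] := @holoC_primitive_except _ (dquot f a l) a.
- by move=> z z0; exact: dquot_fcont.
- by have [m hm] := hf z z0; refine (dquot_derive l za hm).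
exact: holoC_deriv hF.
Qed.

Lemma uhp_val_i : uhp_val (uhp_i R) = ci.
Proof. by []. Qed.

Lemma addi_neq0 (z : uhp R) : uhp_val z + ci != 0.
Proof.
apply/eqP => /(congr1 Im); rewrite ImD Im0 => h.
have : 0 < Im (uhp_val z) + Im (ci : C) by rewrite addr_gt0 ?uhp_val_gt0 ?ltr01.
by rewrite h ltxx.
Qed.

Definition cayley : hfun R := fun z => (uhp_val z - ci) / (uhp_val z + ci).

Lemma cayley_i : cayley (uhp_i R) = 0.
Proof. by rewrite /cayley uhp_val_i subrr mul0r. Qed.

Lemma hd_cayley z : hd cayley z (2 * ci / (uhp_val z + ci) ^+ 2).
Proof.
have n0 := addi_neq0 z.
have h1 := hdB (hd_id z) (hd_cst (ci : C) z); have h2 := hdD (hd_id z) (hd_cst (ci : C) z).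
apply: hd_eq (hdM h1 (hdV n0 h2)) _; field; exact: n0.
Qed.

Lemma cabs_cayley_sq z : cabs (cayley z) ^+ 2 = 1 - 4 * Im (uhp_val z) / cabs (uhp_val z + ci) ^+ 2.
Proof.
have n0 : cabs (uhp_val z + ci) ^+ 2 != 0 by rewrite expf_neq0// cabs_eq0 addi_neq0.
rewrite cabsM cabsV exprMn exprVn.
have -> : cabs (uhp_val z - ci) ^+ 2 = cabs (uhp_val z + ci) ^+ 2 - 4 * Im (uhp_val z).
  by rewrite !cabs_sq !ReImE; ring.
by rewrite mulrBl divff.
Qed.

Lemma cabs_cayley_le1 z : cabs (cayley z) <= 1.
Proof.
rewrite -(@ler_pXn2r _ 2) ?nnegrE ?cabs_ge0// expr1n cabs_cayley_sq lerBlDr lerDl.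
by apply: divr_ge0; [apply: mulr_ge0 => //; exact: ltW (uhp_val_gt0 z)|exact: sqr_ge0].
Qed.

Lemma cayley_inj (z w : uhp R) : cayley z = cayley w -> z = w.
Proof.
have z0 := addi_neq0 z; have w0 := addi_neq0 w.
rewrite /cayley => /eqP; rewrite eqr_div// => /eqP E; apply: uhp_val_inj.
apply/eqP; rewrite -subr_eq0; apply/eqP.
have : 2 * ci * (uhp_val z - uhp_val w) = 0.
  transitivity ((uhp_val z - ci) * (uhp_val w + ci) - (uhp_val w - ci) * (uhp_val z + ci)); first by ring.
  by rewrite E subrr.
by move/eqP; rewrite mulf_eq0 (negPf two_ci_neq0) => /eqP.
Qed.

(** The maximum principle is available on rectangles only; these exhaust the half-plane, and on
    their boundaries the Cayley transform is nearly unimodular. *)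
Lemma boundary_cayley (N : R) z : 4 < N -> boundary (- N) N N^-1 N (uhp_val z) ->
  1 - 4 / N <= cabs (cayley z).
Proof.
move=> N4 bz; have N0 : 0 < N by move: N4; lra.
have y0 := uhp_val_gt0 z; have n1 := cabs_cayley_le1 z.
have D0 : 0 < cabs (uhp_val z + ci) ^+ 2 by rewrite exprn_gt0// cabs_gt0 addi_neq0.
apply: (@le_trans _ _ (cabs (cayley z) ^+ 2)); last first.
  by rewrite expr2 ler_piMl ?cabs_ge0.
rewrite cabs_cayley_sq lerD2l lerN2 ler_pdivrMr// mulrAC ler_pdivlMr// -mulrA ler_pM2l//.
move: D0 bz; rewrite !cabs_sq !ReImE /boundary.
set x := Re (uhp_val z); set y := Im (uhp_val z) in y0 *; move=> _.
have x2 := sqr_ge0 x; have NV : N^-1 * N = 1 by rewrite mulVf// gt_eqF.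
case=> [[_ [->|->]]|[/andP[_ yN] [->|->]]]; rewrite ?NV; move: N0 N4 x2 y0; nra.
Qed.


(** The Schwarz lemma in half-plane coordinates: the quotient of [cayley] after [phi] by [cayley]
    extends across [i], and is bounded by 1 through the maximum principle on growing rectangles. *)
Lemma schwarz_quotient (phi : uhp R -> uhp R) : holomorphic (fun z => uhp_val (phi z)) ->
  phi (uhp_i R) = uhp_i R -> exists h : hfun R, [/\ holomorphic h,
    (forall z, h z * cayley z = cayley (phi z)), h (uhp_i R) = jac phi (uhp_i R) &
    (forall z, cabs (h z) <= 1)].
Proof.
move=> /holomorphicP hphi phii; pose g : hfun R := fun z => cayley (phi z); pose f := ext g.
have hg z : hd g z (2 * ci / (uhp_val (phi z) + ci) ^+ 2 * jac phi z).
  exact: hd_comp (hd_cayley (phi z)) (hphi z).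
have hf : holoC f by apply: holomorphic_holoC; exact: hd_holomorphic hg.
pose l := jac phi (uhp_i R) / (2 * ci).
have hl : is_derive ci 1 f l.
  have := hg (uhp_i R); rewrite phii uhp_val_i => h; apply: is_derive_eq h _.
  rewrite /l; have c0 : ci != 0 :> C := ci_neq0; move: (jac _ _) => J.
  by field; rewrite c0 -mulr2n -mulr_natr mulf_neq0// pnatr_eq0.
have fi : f ci = 0 by rewrite /f -uhp_val_i ext_uhp /g phii cayley_i.
have hq := removable hf hl (uhp_val_gt0 (uhp_i R)).
(* As [f] vanishes at [ci], this is the desired quotient with its singularity removed. *)
pose H z := dquot f ci l z * (z + ci).
have hH : holoC H.
  move=> z z0; have [m hm] := hq z z0; eexists.
  exact: is_derive_mulC hm (is_deriveD (is_derive_id z 1) (is_derive_cst ci z 1)).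
have Hb z : H (uhp_val z) * cayley z = g z.
  have n0 := addi_neq0 z; rewrite /H /dquot; case: eqP => [E|/eqP E].
    have -> : z = uhp_i R by apply: uhp_val_inj.
    by rewrite /g phii cayley_i; exact: mulr0.
  rewrite fi /f ext_uhp /cayley; move: (g z) => G; field.
  by rewrite n0 subr_eq0 E.
exists (fun z => H (uhp_val z)); split => //.
- move=> z; have [m hm] := hH _ (uhp_val_gt0 z); by have [] := hd_compC hm (hd_id z).
- rewrite uhp_val_i /H /dquot eqxx /l; have c0 : ci != 0 :> C := ci_neq0; move: (jac _ _) => J.
  by field; rewrite c0.
move=> a; apply/ler_addgt0Pl => e e0; set x := Re (uhp_val a); set y := Im (uhp_val a).
have y0 : 0 < y := uhp_val_gt0 a.
(* The first three terms put [a] inside the rectangle, the fourth gives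
   [(1 + e) * (1 - 4 / N) >= 1], and 5 ensures [4 < N]. *)
pose N := `|x| + y + y^-1 + 4 * (1 + e) / e + 5.
have a0 : 0 < y^-1 by rewrite invr_gt0.
have b0 : 0 < 4 * (1 + e) / e by rewrite divr_gt0// mulr_gt0// addr_gt0.
have n0 := normr_ge0 x; have N4 : 4 < N by rewrite /N; move: y0 a0 b0 n0; lra.
have N0 : 0 < N by move: N4; lra.
apply: (@max_modulus _ H (e + 1) (- N) N N^-1 N (uhp_val a)) => //.
- by rewrite invr_gt0.
- split; first by rewrite -ltr_norml /N; move: y0 a0 b0 n0; lra.
  apply/andP; split; last by rewrite /N; move: y0 a0 b0 n0; lra.
  by rewrite -[Im _]invrK ltf_pV2 ?posrE//; rewrite /N; move: y0 a0 b0 n0; lra.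
- by rewrite addr_gt0.
move=> z bz; have z0 : 0 < Im z.
  have NV : 0 < N^-1 by rewrite invr_gt0.
  by case: bz => [[_ [->|->]]|[/andP[h _] _]] //; exact: lt_le_trans h.
have := boundary_cayley (z := to_uhp z0) N4 bz; have := cabs_cayley_le1 (phi (to_uhp z0)).
rewrite -/(g _) -Hb cabsM; change (uhp_val (to_uhp z0)) with z.
have h0 := cabs_ge0 (H z); move: (cabs (H z)) (cabs (cayley _)) h0 => h c h0 hc cN.
have eN : (1 + e) * (4 / N) <= e.
  rewrite mulrA ler_pdivrMr// -ler_pdivrMl// mulrC [(1 + e) * 4]mulrC /N.
  by move: y0 a0 b0 n0; lra.
have h1 : h * (1 - 4 / N) <= 1 by apply: le_trans hc; exact: ler_wpM2l.
have p0 : 0 < 1 - 4 / N by rewrite subr_gt0 ltr_pdivrMr// mul1r.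
rewrite -(ler_pM2r p0); apply: le_trans h1 _.
by move: eN; move: (4 / N) => q; lra.
Qed.

(** The first-order part of the maximum principle: with a nonzero derivative, [h] could be increased
    radially beyond modulus 1. *)
Lemma unimodular_deriv (h : hfun R) z l : hd h z l -> (forall w, cabs (h w) <= 1) ->
  cabs (h z) = 1 -> l = 0.
Proof.
move=> /hdP hh h1 hz; apply/eqP; apply: contraT => l0.
have L0 : 0 < cabs l by rewrite cabs_gt0.
have [d d0 hd'] := hh _ (divr_gt0 L0 (ltr0n _ 2)).
have y0 := uhp_val_gt0 z; pose m := Num.min d (Im (uhp_val z)) / 2.
have m0 : 0 < m by rewrite divr_gt0// lt_min d0.
have md : m < d.
  rewrite /m; have : Num.min d (Im (uhp_val z)) <= d by rewrite ge_min lexx.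
  by move: d0; lra.
have my : m < Im (uhp_val z).
  rewrite /m; have : Num.min d (Im (uhp_val z)) <= Im (uhp_val z) by rewrite ge_min lexx orbT.
  by move: y0; lra.
pose t := m * cabs l; have t0 : 0 < t by rewrite mulr_gt0.
(* The step of length [m] for which [l * u = t * h z], so that [h] moves to [(1 + t) * h z] up to an
   error [t / 2]. *)
pose u := ofR t * h z / l.
have um : cabs u = m by rewrite !cabsM cabsV cabs_ofR hz gtr0_norm// mulr1 mulfK// gt_eqF.
have w0 : 0 < Im (uhp_val z + u).
  rewrite ImD; have := ler_Im_cabs u; rewrite um ler_norml => /andP[+ _]; move: my; lra.
have := hd' (to_uhp w0); rewrite [uhp_val (to_uhp w0)]/= addrAC subrr add0r um => /(_ md).
have -> : l * u = ofR t * h z by rewrite /u; field.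
have -> : h (to_uhp w0) - h z - ofR t * h z = h (to_uhp w0) - ofR (1 + t) * h z.
  by rewrite ofRD ofR1; ring.
have := cabs_dist (h (to_uhp w0)) (ofR (1 + t) * h z); rewrite cabsM cabs_ofR hz mulr1.
have t1 : 0 < 1 + t by move: t0; lra.
rewrite [`|1 + t|]gtr0_norm//.
have := h1 (to_uhp w0); move: (cabs (h _)) (cabs (_ - _)) => A B A1.
rewrite ler_norml => /andP[h2 _] h3.
have : t <= t / 2 by move: h3 h2 A1; rewrite /t; lra.
by move: t0; lra.
Qed.

End Automorphisms.

(** * Multipliers of automorphisms and Bol's lemma *)

Section Moebius.
Context {R : realType}.
Local Notation C := (cplx R).
Local Notation D := (@hderiv R).
Local Opaque cexp cpow.

Definition mfactor (g d : C) : hfun R := fun z => g * uhp_val z + d.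

(** The linear fractional map is recorded through its normalized denominator [q], by the two
    identities that derivatives and kernels call for. They determine [q] up to sign. *)
Definition mobius (phi : uhp R -> uhp R) (g d : C) :=
  [/\ (forall z, mfactor g d z != 0),
      (forall z, hd (fun z => uhp_val (phi z)) z (mfactor g d z ^- 2)) &
      (forall z w, (uhp_val (phi z) - cconj (uhp_val (phi w))) *
         mfactor g d z * cconj (mfactor g d w) = uhp_val z - cconj (uhp_val w))].

Lemma pair_le1 (x y : R) : 0 <= x -> x <= 1 -> y <= 1 -> x * y = 1 -> x = 1.
Proof.
move=> x0 x1 y1 E; apply/eqP; rewrite eq_le x1 /= -E; exact: ler_piMr.
Qed.

(** The Schwarz quotients of [phi] and of its inverse are bounded by 1 and multiply to 1. Hence they
    are unimodular, with derivative 0, hence constant. *)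
Lemma rotation_of_fixed (phi : uhp R -> uhp R) : biholomorphism phi -> phi (uhp_i R) = uhp_i R ->
  exists2 c : C, cabs c = 1 & forall z, cayley (phi z) = c * cayley z.
Proof.
move=> [hphi [psi [phiK psiK hpsi]]] fi.
have gi : psi (uhp_i R) = uhp_i R by rewrite -{1}fi phiK.
have [h [hh hE hi h1]] := schwarz_quotient hphi fi.
have [k [hk kE ki k1]] := schwarz_quotient hpsi gi.
have kh z : k (phi z) * h z = 1.
  have [->|zi] := pselect (z = uhp_i R); last first.
    have c0 : cayley z != 0.
      by apply/eqP => c0; apply: zi; apply: cayley_inj; rewrite cayley_i.
    apply: (mulIf c0); rewrite -mulrA hE kE phiK; exact/esym/mul1r.
  (* At [i] the Cayley factors cannot be cancelled; there the product is the derivative of [psi]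
     after [phi], the identity. *)
  rewrite fi hi ki; apply: (@hd_unique _ (@uhp_val R) (uhp_i R)); last exact: hd_id.
  have /holomorphicP hp := hphi; have /holomorphicP hq := hpsi.
  have := hd_comp (phi := phi) (hq (phi (uhp_i R))) (hp (uhp_i R)); rewrite fi.
  by congr hd; apply/funext => w; rewrite phiK.
have hu z : cabs (h z) = 1.
  apply: (@pair_le1 _ (cabs (k (phi z)))); [exact: cabs_ge0|exact: h1|exact: k1|].
  by rewrite mulrC -cabsM kh cabs1.
have /holomorphicP hd0 := hh.
have h0 z : hd h z 0.
  have := hd0 z; have -> // : hderiv h z = 0; exact: unimodular_deriv (hd0 z) h1 (hu z).
exists (h (uhp_i R)); first exact: hu.
by move=> z; rewrite -(hd_zero_cst h0 z) hE.
Qed.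

Lemma sqrt_unit (c : C) : cabs c = 1 -> exists2 k : C, k ^+ 2 * c = 1 & k * cconj k = 1.
Proof.
move=> c1; have c0 : c != 0 by rewrite -cabs_gt0 c1.
exists (sqrtC (c^-1 : R[i])).
  have -> : sqrtC (c^-1 : R[i]) ^+ 2 = c^-1 :> C by exact: sqrtCK.
  exact: mulVf.
rewrite mul_cconj -cabsX.
have -> : sqrtC (c^-1 : R[i]) ^+ 2 = c^-1 :> C by exact: sqrtCK.
by rewrite cabsV c1 invr1 ofR1.
Qed.

Lemma mobius_of_rotation (phi : uhp R -> uhp R) c : cabs c = 1 ->
  holomorphic (fun z => uhp_val (phi z)) -> (forall z, cayley (phi z) = c * cayley z) ->
  exists g d, mobius phi g d.
Proof.
move=> c1 /holomorphicP hphi E; have [k kc kk] := sqrt_unit c1.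
pose N (x c : C) : C := (x + ci) + c * (x - ci); pose d (x c : C) : C := (x + ci) - c * (x - ci).
have i0 : ci != 0 :> C := ci_neq0; have i2 : ci * ci = -1 :> C := ciM.
have c0 : c != 0 by rewrite -cabs_gt0 c1.
have rel z : uhp_val (phi z) * d (uhp_val z) c = ci * N (uhp_val z) c.
  have z0 := addi_neq0 z; have p0 := addi_neq0 (phi z).
  move/eqP: (E z); rewrite /cayley mulrA eqr_div// => /eqP e; rewrite /d /N.
  move: (uhp_val z) (uhp_val (phi z)) e => x y e.
  have : (y - ci) * (x + ci) - c * (x - ci) * (y + ci) = 0 by rewrite e subrr.
  by move=> e'; apply/eqP; rewrite -subr_eq0; apply/eqP; apply: etrans e'; ring.
have d0 z : d (uhp_val z) c != 0.
  apply/eqP => dz; have := rel z; rewrite dz mulr0 => /esym/eqP; rewrite mulf_eq0 (negPf i0) /=.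
  have -> : N (uhp_val z) c = 2 * (uhp_val z + ci) - d (uhp_val z) c by rewrite /N /d; ring.
  by rewrite dz subr0 mulf_eq0 (negPf (addi_neq0 z)) orbF pnatr_eq0.
have k0 : k != 0 by apply/eqP => e; move/eqP: kc; rewrite e expr0n mul0r eq_sym oner_eq0.
(* These make [q] equal to [- ci / 2 * k * d]. Solving the rotation equation gives
   [phi' = - 4 c / d ^ 2], which is [q ^ -2] because [k ^ 2 * c = 1]. *)
exists (- ci / 2 * k * (1 - c)), (k * (1 + c) / 2).
have qE z : mfactor (- ci / 2 * k * (1 - c)) (k * (1 + c) / 2) z = - ci / 2 * k * d (uhp_val z) c.
  rewrite /mfactor /d; move: (uhp_val z) => x; apply/eqP; rewrite -subr_eq0; apply/eqP.
  transitivity ((1 + ci * ci) * (k * (1 + c)) / 2); first by field.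
  by rewrite i2 subrr !mul0r.
have q0 z : mfactor (- ci / 2 * k * (1 - c)) (k * (1 + c) / 2) z != 0.
  by rewrite qE !mulf_neq0// ?invr_eq0 ?oppr_eq0 ?pnatr_eq0.
split => // z.
  rewrite qE; have h := hphi z; apply: (hd_eq h); set J := hderiv _ _ in h *.
  have e1 := hd_comp (hd_cayley (phi z)) h.
  have e2 : hd (fun w => cayley (phi w)) z (c * (2 * ci / (uhp_val z + ci) ^+ 2)).
    have := hdZ c (hd_cayley z); congr hd; by apply/funext => w; rewrite E.
  have {e1 e2} e := hd_unique e1 e2.
  have z0 := addi_neq0 z; have p0 := addi_neq0 (phi z).
  have pE : (uhp_val (phi z) + ci) * d (uhp_val z) c = 2 * ci * (uhp_val z + ci).
    rewrite mulrDl rel /N /d; ring.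
  have pE' : uhp_val (phi z) + ci = 2 * ci * (uhp_val z + ci) / d (uhp_val z) c.
    by rewrite -pE mulfK.
  have JE : J = c * (uhp_val (phi z) + ci) ^+ 2 / (uhp_val z + ci) ^+ 2.
    have n0 : 2 * ci / (uhp_val (phi z) + ci) ^+ 2 != 0 by rewrite !mulf_neq0// ?invr_eq0 ?expf_neq0// pnatr_eq0.
    apply: (mulfI n0); rewrite e; field; by rewrite z0 p0.
  rewrite JE pE'; have dz := d0 z; move: (d _ _) dz => dz dz0.
  move: (uhp_val z + ci) z0 => x x0.
  have -> : (- ci / 2 * k * dz) ^+ 2 = (ci * ci) * k ^+ 2 * dz ^+ 2 / 4 by field.
  transitivity ((ci * ci) * 4 * c / dz ^+ 2).
    by field; rewrite dz0 x0.
  rewrite i2; have -> : c = (k ^+ 2)^-1.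
    by apply: (mulfI (expf_neq0 2 k0)); rewrite kc divff// expf_neq0.
  by field; rewrite dz0 k0.
move=> w; rewrite !qE !cconjM cconjN cconj_i.
have -> : cconj (2^-1 : C) = 2^-1.
  by have -> : (2 : C)^-1 = ofR 2^-1; [rewrite ofRV (ofR_nat 2)|rewrite cconj_ofR].
have relw := congr1 cconj (rel w); move: relw; rewrite !cconjM cconj_i.
have cc : c * cconj c = 1 by rewrite mul_cconj c1 expr1n ofR1.
have dE x : cconj (d x c) = (cconj x - ci) - cconj c * (cconj x + ci).
  by rewrite /d cconjD cconjN !cconjD cconjM cconjD cconjN cconj_i; ring.
have NE x : cconj (N x c) = (cconj x - ci) + cconj c * (cconj x + ci).
  by rewrite /N !cconjD cconjM cconjD cconjN cconj_i; ring.
move: (rel z) (dE (uhp_val w)) (NE (uhp_val w)).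
move: (cconj (d _ _)) (cconj (N _ _)) (cconj (uhp_val (phi w))) (uhp_val (phi z)).
move=> d' N' y' x rz d'E N'E rw.
transitivity ((k * cconj k) * (- (ci * ci)) / 4 *
   ((x * d (uhp_val z) c) * d' - (y' * d') * d (uhp_val z) c)); first by field.
rewrite kk i2 rz rw d'E N'E /N /d; move: (uhp_val z) (cconj (uhp_val w)) => a b.
transitivity (ci * (2 * ((a + ci) * (b - ci) - (c * cconj c) * ((a - ci) * (b + ci)))) / 4).
  by field.
rewrite cc; transitivity (- (ci * ci) * (a - b)); first by field.
by rewrite i2 opprK; exact: mul1r.
Qed.

Lemma mobius_aff (alpha : aff R) (phi : uhp R -> uhp R) g d : mobius phi g d ->
  exists g' d', mobius (fun z => aff_act alpha (phi z)) g' d'.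
Proof.
move=> [q0 hq K]; set r := aff_scale alpha; have r0 : 0 < r := aff_scale_gt0 alpha.
pose k := (Num.sqrt r)^-1; have k0 : 0 < k by rewrite invr_gt0 sqrtr_gt0.
have kr : r * (k * k) = 1.
  by rewrite -expr2 /k exprVn sqr_sqrtr ?ltW// divff// gt_eqF.
have kn : ofR k != 0 :> C by rewrite ofR_eq0 gt_eqF.
have rn : ofR r != 0 :> C by rewrite ofR_eq0 gt_eqF.
have krC : ofR r * (ofR k * ofR k) = 1 :> C by rewrite -!ofRM kr ofR1.
exists (ofR k * g), (ofR k * d).
have qE z : mfactor (ofR k * g) (ofR k * d) z = ofR k * mfactor g d z by rewrite /mfactor; ring.
split=> [z|z|z w]; rewrite ?qE.
- by rewrite mulf_neq0.
- apply: hd_eq (hd_comp (hd_aff alpha (phi z)) (hq z)) _; rewrite -/r.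
  have qz := q0 z; move: (mfactor g d z) qz => q qz.
  have -> : ofR r = (ofR k * ofR k)^-1.
    by apply: (mulIf (mulf_neq0 kn kn)); rewrite krC mulVf// mulf_neq0.
  by field; rewrite kn qz.
rewrite !uhp_val_aff cconjM cconjD cconjM !cconj_ofR -/r -K.
rewrite -[RHS]mul1r -krC; ring.
Qed.

(** An affine map brings the image of [i] back to [i], which leaves a rotation. *)
Lemma automorphism_mobius (phi : uhp R -> uhp R) : biholomorphism phi -> exists g d, mobius phi g d.
Proof.
move=> [hphi [psi [phiK psiK hpsi]]]; pose al := aff_to (phi (uhp_i R)).
pose phi0 z := aff_act (aff_inv al) (phi z).
have hA (be : aff R) : holomorphic (fun z => uhp_val (aff_act be z)) := hd_holomorphic (hd_aff be).
have hcomp (f g : uhp R -> uhp R) : holomorphic (fun z => uhp_val (f z)) -> holomorphic (fun z => uhp_val (g z)) ->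
    holomorphic (fun z => uhp_val (f (g z))).
  move=> /holomorphicP hf /holomorphicP hg.
  exact: (hd_holomorphic (fun z => hd_comp (hf (g z)) (hg z))).
have b0 : biholomorphism phi0.
  split; first exact: (hcomp _ _ (hA (aff_inv al)) hphi).
  exists (fun z => psi (aff_act al z)); split.
  - by move=> z; rewrite /phi0 aff_actKV phiK.
  - by move=> z; rewrite /phi0 psiK aff_actK.
  exact: (hcomp _ _ hpsi (hA al)).
have f0 : phi0 (uhp_i R) = uhp_i R by rewrite /phi0 -[X in aff_act _ X]aff_toE aff_actK.
have [c c1 cE] := rotation_of_fixed b0 f0.
have [g [d m]] := mobius_of_rotation c1 b0.1 cE.
have := mobius_aff al m; have -> // : (fun z => aff_act al (phi0 z)) = phi.
by apply/funext => z; rewrite /phi0 aff_actKV.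
Qed.

Lemma hd_mfactor g d z : hd (mfactor g d) z g.
Proof.
apply: hd_eq (hdD (hdM (hd_cst g z) (hd_id z)) (hd_cst d z)) _.
by rewrite mul0r add0r addr0 mulr1.
Qed.

Lemma leibniz_mfactor g d n (f : hfun R) : holomorphic f ->
  iter n.+1 D (fun z => mfactor g d z * f z) =
  fun z => mfactor g d z * iter n.+1 D f z + n.+1%:R * g * iter n D f z.
Proof.
move=> hf; have hk k := (holomorphicP _).1 (holomorphic_iterD (k := k) hf).
elim: n => [|n IH]; apply: hd_hderivE => z.
  apply: hd_eq (hdM (hd_mfactor g d z) (hk 0 z)) _; rewrite /=; ring.
rewrite -iterS IH.
apply: hd_eq (hdD (hdM (hd_mfactor g d z) (hk n.+1 z)) (hdZ (n.+1%:R * g) (hk n z))) _.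
have -> : n.+2%:R = n.+1%:R + 1 :> C by rewrite natr1.
rewrite !iterS; move: (n.+1%:R : C) (D (D (iter n D f)) z) (D (iter n D f) z) (mfactor g d z).
by move=> N a b q; ring.
Qed.

(** Induction on [n], splitting off one factor [q]. As [q] is affine, the Leibniz formula has two
    terms, and the one with the lower derivative of [f] cancels against the derivative of
    [q ^ (- n - 2)]. *)
Lemma bol (phi : uhp R -> uhp R) g d n (f : hfun R) : mobius phi g d -> holomorphic f ->
  iter n.+1 D (fun z => mfactor g d z ^+ n * f (phi z)) =
  fun z => mfactor g d z ^- n.+2 * iter n.+1 D f (phi z).
Proof.
move=> [q0 hphi _] hf; have hk k := (holomorphicP _).1 (holomorphic_iterD (k := k) hf).
have hF m : holomorphic (fun z => mfactor g d z ^+ m * f (phi z)).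
  exact: (hd_holomorphic (fun z => hdM (hdX m (hd_mfactor g d z)) (hd_comp (hk 0 (phi z)) (hphi z)))).
elim: n => [|n IH].
  apply: hd_hderivE => z.
  apply: hd_eq (hdM (hd_cst 1 z) (hd_comp (hk 0 (phi z)) (hphi z))) _ => /=; ring.
have -> : (fun z => mfactor g d z ^+ n.+1 * f (phi z)) =
    (fun z => mfactor g d z * (mfactor g d z ^+ n * f (phi z))).
  by apply/funext => z; rewrite exprS mulrA.
rewrite (leibniz_mfactor g d n.+1 (hF n)) IH.
have -> : iter n.+2 D (fun z => mfactor g d z ^+ n * f (phi z)) = fun z =>
    mfactor g d z ^- n.+4 * iter n.+2 D f (phi z)
    - n.+2%:R * g * mfactor g d z ^- n.+3 * iter n.+1 D f (phi z).
  rewrite iterS IH; apply: hd_hderivE => z; have qz := q0 z.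
  have h1 := hdX n.+2 (hdV qz (hd_mfactor g d z)).
  have e : (fun w => (mfactor g d w)^-1 ^+ n.+2) = (fun w => mfactor g d w ^- n.+2).
    by apply/funext => w; rewrite exprVn.
  rewrite e in h1; apply: hd_eq (hdM h1 (hd_comp (hk n.+1 (phi z)) (hphi z))) _.
  rewrite !iterS; move: (D (D (iter n D f)) (phi z)) (D (iter n D f) (phi z)) => a b.
  move: (mfactor g d z) (n.+2%:R : C) qz => q N qz; clear -qz.
  rewrite [n.+2.-1]/= !exprS exprVn; set Q := q ^+ n; have Q0 : Q != 0 by apply: expf_neq0.
  by field; rewrite qz Q0.
apply/funext => z; rewrite !iterS; move: (D (D (iter n D f)) (phi z)) (D (iter n D f) (phi z)) => a b.
have := q0 z; move: (mfactor g d z) (n.+2%:R : C) => q N qz; clear -qz.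
rewrite !exprS; set Q := q ^+ n; have Q0 : Q != 0 by apply: expf_neq0.
by field; rewrite qz Q0.
Qed.

End Moebius.

(** * The universal covering group *)

Section CountableRange.
Context {R : realType}.
Local Notation C := (cplx R).
Local Notation Re := (@complex.Re R).
Local Notation Im := (@complex.Im R).
Local Opaque cexp cpow.

Lemma nbhs_uhpP (z : uhp R) (P : set (uhp R)) :
  nbhs z P <-> exists2 d : R, 0 < d & forall w : uhp R, cabs (uhp_val w - uhp_val z) < d -> P w.
Proof.
split=> [|[d d0 h]].
  rewrite nbhsE => -[U [[V oV <-] Vz] UP].
  have : nbhs (uhp_val z) V by apply: open_nbhs_nbhs.
  move=> h1; have [d d0 h] := (nbhs_cabsP _ _).1 h1; exists d => // w /h Vw; exact: UP.
have c : (@uhp_val R) @ z --> uhp_val z by exact: initial_continuous.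
have h1 : nbhs (uhp_val z) [set w | cabs (w - uhp_val z) < d] by apply/nbhs_cabsP; exists d.
have h2 : nbhs z ((@uhp_val R) @^-1` [set w | cabs (w - uhp_val z) < d]) := c _ h1.
have := @filterS _ (nbhs z) (nbhs_filter (z : uhp R)) ((@uhp_val R) @^-1` [set w | cabs (w - uhp_val z) < d]) P.
by apply => // w; exact: h.
Qed.

Lemma holomorphic_continuous (f : hfun R) : holomorphic f -> continuous (f : uhp R -> C).
Proof.
move=> /holomorphicP hf z.
apply/(@cvgCP _ _ (nbhs z) (nbhs_filter (z : uhp R))) => e e0; apply/nbhs_uhpP.
by have [d d0 h] := hd_cont (hf z) e0; exists d.
Qed.

(** Otherwise the range would contain a nontrivial interval, which has positive Lebesgue measure and
    so is not countable. *)
Lemma countable_range_real (f : R -> R) (S : set R) : countable S ->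
  {within `[0, 1], continuous f} -> (forall t, t \in `[0, 1] -> S (f t)) -> f 0 = f 1.
Proof.
move=> cS cf hS; apply/eqP; apply: contraT => ne.
pose a := Num.min (f 0) (f 1); pose b := Num.max (f 0) (f 1).
have ab : a < b by rewrite /a /b; move: ne; case: (ltgtP (f 0) (f 1)).
have sub : `[a, b]%classic `<=` S.
  move=> v /=; rewrite in_itv /= => vab.
  by have [t t01 <-] := IVT ler01 cf vab; exact: hS.
have := countable_lebesgue_measure0 (sub_countable (subset_card_le sub) cS).
rewrite lebesgue_measure_itv /= lte_fin ab => /eqP.
by rewrite -EFinD eqe subr_eq0 gt_eqF.
Qed.

Lemma countable_range_path (c : R -> C) (S : set C) : countable S ->
  {within `[0, 1], continuous c} -> (forall t, t \in `[0, 1] -> S (c t)) -> c 0 = c 1.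
Proof.
move=> cS cc hS.
have part (g : C -> R) : continuous g -> g (c 0) = g (c 1).
  move=> cg; apply: (@countable_range_real (g \o c) (g @` S)).
  - exact: sub_countable (card_image_le g S) cS.
  - by move=> t; exact: (@continuous_comp _ _ _ (from_subspace `[0, 1] c) g t (cc t) (cg _)).
  - by move=> t /hS h; exists (c t).
by apply: cplx_eq; apply: part => w; [exact: Re_cvg|exact: Im_cvg].
Qed.

Lemma countable_range_ccont (c : R -> C) (S : set C) : countable S ->
  (forall t, ccont c t) -> (forall t, S (c t)) -> forall t, c t = c 0.
Proof.
move=> cS cc hS t; have := @countable_range_path (fun s => c (t * s)) S cS.
rewrite mulr0 mulr1 => -> //; apply: continuous_subspaceT => s.
apply/cvgCP => e e0; have [d d0 h] := cc (t * s) e e0.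
have n0 : 0 < d / (`|t| + 1) by rewrite divr_gt0// ltr_wpDl.
near=> u; apply: h; rewrite -mulrBr normrM.
have : `|u - s| < d / (`|t| + 1).
  by rewrite distrC; near: u; apply: cvgr_dist_lt => //; exact: cvg_id.
rewrite ltr_pdivlMr ?ltr_wpDl//; apply: le_lt_trans; rewrite mulrC.
by apply: ler_wpM2l => //; rewrite lerDl.
Unshelve. all: by end_near. Qed.

Lemma upath_subproof (z w : uhp R) (t : R) : 0 < Im (pt (Re (uhp_val z) + (Re (uhp_val w) - Re (uhp_val z)) * t)
  (Im (uhp_val z) * expR ((ln (Im (uhp_val w)) - ln (Im (uhp_val z))) * t))).
Proof. by rewrite Im_pt mulr_gt0 ?uhp_val_gt0 ?expR_gt0. Qed.

(** Affine in the real part and geometric in the imaginary part, so that it stays in the half-plane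
    for every real [t]. *)
Definition upath z w t : uhp R := to_uhp (upath_subproof z w t).

Lemma uhp_val_upath z w t : uhp_val (upath z w t) =
  pt (Re (uhp_val z) + (Re (uhp_val w) - Re (uhp_val z)) * t)
     (Im (uhp_val z) * expR ((ln (Im (uhp_val w)) - ln (Im (uhp_val z))) * t)).
Proof. by []. Qed.

Lemma upath0 z w : upath z w 0 = z.
Proof.
by apply: uhp_val_inj; rewrite uhp_val_upath !mulr0 expR0 mulr1 addr0 [RHS]cplxE.
Qed.

Lemma upath1 z w : upath z w 1 = w.
Proof.
apply: uhp_val_inj; rewrite uhp_val_upath !mulr1 [RHS]cplxE /pt; congr (ofR _ + ci * ofR _); first by ring.
by rewrite expRB !lnK ?posrE ?uhp_val_gt0// mulrC divfK// gt_eqF// uhp_val_gt0.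
Qed.

Lemma upath_continuous z w : continuous (upath z w).
Proof.
move=> t P /nbhs_uhpP[d d0 h]; pose a := Re (uhp_val w) - Re (uhp_val z).
pose b := ln (Im (uhp_val w)) - ln (Im (uhp_val z)).
have h1 := rdD (rd_affine (ofR (Re (uhp_val z))) (ofR a) t) (rdZ (ci * ofR (Im (uhp_val z))) (rd_expR t b)).
have [d' d'0 h'] := rd_ccont h1 d0.
suff : \forall s \near t, P (upath z w s) by [].
near=> s; apply: h.
have E u : uhp_val (upath z w u) = ofR (Re (uhp_val z)) + ofR a * ofR u + ci * ofR (Im (uhp_val z)) * ofR (expR (b * u)).
  by rewrite uhp_val_upath /pt ofRD !ofRM mulrA.
rewrite !E; apply: h'; rewrite distrC; near: s; apply: cvgr_dist_lt => //; exact: cvg_id.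
Unshelve. all: by end_near. Qed.

Lemma countable_range_uhp (F : uhp R -> C) (S : set C) : countable S -> continuous F ->
  (forall z, S (F z)) -> forall z w, F z = F w.
Proof.
move=> cS cF hS z w; have := @countable_range_path (fun t => F (upath z w t)) S cS.
rewrite upath0 upath1; apply=> //; apply: continuous_subspaceT => t.
apply: continuous_comp; [exact: upath_continuous|exact: cF].
Qed.

Lemma continuous_slice (G : topologicalType) (F : G * uhp R -> C) h :
  continuous F -> continuous (fun u => F (h, u)).
Proof.
move=> cF u.
have cp : (fun u : uhp R => (h, u)) @ u --> (h, u).
  apply: (@cvg_pair _ _ _ (nbhs u) (nbhs h) (nbhs u) (nbhs_filter (u : uhp R)) (nbhs_filter h)
    (nbhs_filter (u : uhp R)) (fun=> h) id); last exact: cvg_id.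
  exact: (@cvg_cst _ h _ (nbhs u) (nbhs_filter (u : uhp R))).
exact: (@continuous_comp _ _ _ (fun u : uhp R => (h, u)) F u cp (cF _)).
Qed.

Lemma countable_range_group (G : topologicalType) (F : G * uhp R -> C) (S : set C) :
  simply_connected R G -> countable S -> continuous F ->
  (forall x, S (F x)) -> forall x y, F x = F y.
Proof.
move=> [conn _] cS cF hS [g z] [h w].
transitivity (F (h, z)).
  have [c [cc c0 c1]] := conn g h.
  have := @countable_range_path (fun t => F (c t, z)) S cS; rewrite c0 c1; apply=> // t.
  have cp : from_subspace `[0, 1] (fun s => (c s, z)) @ t --> (c t, z).
    exact: (cvg_pair (cc t) (cvg_cst z)).
  exact: (@continuous_comp _ _ _ (from_subspace `[0, 1] (fun s => (c s, z))) F t cp (cF _)).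
apply: (@countable_range_uhp (fun u => F (h, u)) S) => //.
exact: continuous_slice.
Qed.

End CountableRange.

(** * Branches of the powers of the Jacobian *)

Section CoveringGroup.
Context {R : realType}.
Local Notation C := (cplx R).
Local Notation Re := (@complex.Re R).
Local Notation Im := (@complex.Im R).
Local Notation D := (@hderiv R).

Lemma cpowE (w : C) (a : R) : cpow w a = cexp (ofR a * clog w).
Proof. by []. Qed.

Local Opaque cexp cpow.

Lemma contM (T : topologicalType) (f g : T -> C) : continuous f -> continuous g ->
  continuous (fun x => f x * g x).
Proof. by move=> cf cg x; exact: (continuousM (cf x) (cg x)). Qed.

Lemma contV (T : topologicalType) (f : T -> C) : (forall x, f x != 0) -> continuous f ->
  continuous (fun x => (f x)^-1).
Proof. by move=> f0 cf x; exact: (continuousV (f0 x) (cf x)). Qed.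

Lemma countable_range_of (T : countType) (F : T -> C) : countable (range F).
Proof. by apply: sub_countable (card_image_le F setT) _; exact: countableP. Qed.

Lemma cexp_eq (x y : C) : cexp x = cexp y -> exists n : int, x = y + ofR (2 * pi * n%:~R) * ci.
Proof.
move=> E; have [n nE] : exists n : int, x - y = ofR (2 * pi * n%:~R) * ci.
  by apply: cexp_eq1; rewrite cexpB E divff// cexp_neq0.
by exists n; rewrite -nE addrC subrK.
Qed.

Context (G : topGroupType) (p : G -> uhp R -> uhp R) (hp : universal_covering_Aut p).
Context (j : R -> G -> uhp R -> cplx R) (hj : forall s : R, is_Jpow p s (j s)).

Lemma cover_biholo g : biholomorphism (p g).
Proof.
case: hp => E _ _ _; have : range p (p g) by exists g.
by rewrite E.
Qed.

Lemma cover1 z : p 1%g z = z.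
Proof.
have [_ [psi [pK _ _]]] := cover_biholo 1%g; case: hp => _ pM _ _.
by have := pM 1%g 1%g; rewrite mulg1 => /(congr1 (fun F => F z)) /= /(can_inj pK).
Qed.

Lemma coverVK g : cancel (p g^-1%g) (p g).
Proof.
move=> z; case: hp => _ pM _ _; have := pM g g^-1%g; rewrite mulgV.
by move=> /(congr1 (fun F => F z)) /= <-; exact: cover1.
Qed.

Lemma coverKV g : cancel (p g) (p g^-1%g).
Proof.
move=> z; case: hp => _ pM _ _; have := pM g^-1%g g; rewrite mulVg.
by move=> /(congr1 (fun F => F z)) /= <-; exact: cover1.
Qed.

Lemma cover_surj phi : biholomorphism phi -> exists g, p g^-1%g = phi.
Proof.
case: hp => E _ _ _; move=> b; have : range p phi by rewrite E.
by move=> [g _ <-]; exists g^-1%g; rewrite invgK.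
Qed.

Lemma cover_mobius g : exists a b, mobius (p g^-1%g) a b.
Proof. exact/automorphism_mobius/cover_biholo. Qed.

Lemma mobius_jac (phi : uhp R -> uhp R) (a b : C) z : mobius phi a b -> jac phi z = mfactor a b z ^- 2.
Proof. by move=> [_ h _]; exact: hd_hderiv. Qed.

Lemma jpow_log s g z : exists2 l, cexp l = jac (p g^-1%g) z & j s g z = cexp (ofR (s / 2) * l).
Proof. by have [_ _ /(_ g z) [l lE <-]] := hj s; exists l. Qed.

Lemma jpow_neq0 s g z : j s g z != 0.
Proof. by have [l _ ->] := jpow_log s g z; exact: cexp_neq0. Qed.

Lemma jpow_cont s : continuous (fun x : G * uhp R => j s x.1 x.2).
Proof. by have [] := hj s. Qed.
Arguments jpow_cont : clear implicits.

Lemma jpow_slice s g : continuous (j s g).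
Proof. exact: (@continuous_slice _ _ (fun x => j s x.1 x.2) g (jpow_cont s)). Qed.
Arguments jpow_slice : clear implicits.

(** For each weight the branch is specified separately; their coherence follows since the ratio of
    the two sides is continuous with countably many values, and is 1 at the base point. *)
Lemma jpow_add s t g z : j s g z * j t g z = j (s + t) g z.
Proof.
pose F (x : G * uhp R) := j s x.1 x.2 * j t x.1 x.2 * (j (s + t) x.1 x.2)^-1.
have cF : continuous F.
  apply: contM; first exact: contM (jpow_cont s) (jpow_cont t).
  by apply: contV (jpow_cont (s + t)) => x; exact: jpow_neq0.
(* The three logarithms of the same Jacobian differ by multiples of [2 pi i], which the exponents
   [s / 2] and [t / 2] turn into these values. *)
pose q (x : int * int) : C := cexp (ofR (pi * (s * x.1%:~R + t * x.2%:~R)) * ci).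
have hS x : range q (F x).
  have [l1 h1 e1] := jpow_log s x.1 x.2; have [l2 h2 e2] := jpow_log t x.1 x.2.
  have [l3 h3 e3] := jpow_log (s + t) x.1 x.2.
  have [n nE] := cexp_eq (etrans h1 (esym h3)); have [m mE] := cexp_eq (etrans h2 (esym h3)).
  exists (n, m) => //; rewrite /q /F e1 e2 e3 -cexpN -!cexpD nE mE; congr cexp.
  have -> : ofR (s / 2) = ofR s / 2 :> C by rewrite ofRM ofRV (ofR_nat 2).
  have -> : ofR (t / 2) = ofR t / 2 :> C by rewrite ofRM ofRV (ofR_nat 2).
  have -> : ofR ((s + t) / 2) = (ofR s + ofR t) / 2 :> C by rewrite ofRM ofRV (ofR_nat 2) ofRD.
  have E2 (k : int) : ofR (2 * pi * k%:~R) = 2 * ofR pi * ofR k%:~R :> C by rewrite !ofRM (ofR_nat 2).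
  rewrite !E2 (ofRM pi) (ofRD (s * _)) (ofRM s) (ofRM t); by field.
have [_ _ _ sc] := hp.
have := countable_range_group sc (countable_range_of q) cF hS (g, z) (1%g, uhp_i R).
rewrite /F /=; have [_ -> _] := hj s; have [_ -> _] := hj t; have [_ -> _] := hj (s + t).
rewrite mulr1 divff ?oner_neq0// => E.
by rewrite -[LHS](divfK (jpow_neq0 (s + t) g z)) E; exact: mul1r.
Qed.

Lemma jpow2 g z : j 2 g z = jac (p g^-1%g) z.
Proof.
have [l <- ->] := jpow_log 2 g z; rewrite divff ?pnatr_eq0// ofR1; congr cexp; exact: mul1r.
Qed.

Lemma karg_mobius (phi : uhp R -> uhp R) (a b : C) z w : mobius phi a b ->
  karg (phi z) (phi w) * mfactor a b z * cconj (mfactor a b w) = karg z w.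
Proof. by move=> [_ _ K]; rewrite /karg -(K z w); ring. Qed.

Lemma Im_mobius (phi : uhp R -> uhp R) (a b : C) z : mobius phi a b ->
  Im (uhp_val (phi z)) * cabs (mfactor a b z) ^+ 2 = Im (uhp_val z).
Proof.
move=> m; have := karg_mobius z z m; rewrite !karg_diag -mulrA mul_cconj -ofRM.
exact: (@ofR_inj R).
Qed.

(** On the diagonal only moduli occur, so the choice of branch does not matter; this is the base
    point for the general identity. *)
Lemma kern_jpow_diag s g w :
  kern s (p g^-1%g w) (p g^-1%g w) * j s g w * cconj (j s g w) = kern s w w.
Proof.
have [a [b m]] := cover_mobius g; have [l lE jE] := jpow_log s g w.
have q0 : mfactor a b w != 0 by case: m.
rewrite (mobius_jac w m) in lE.
have E : expR (Re l) * cabs (mfactor a b w) ^+ 2 = 1.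
  by rewrite -cabs_cexp lE cabsV cabsX mulVf// expf_neq0// cabs_eq0.
have y0 := uhp_val_gt0 (p g^-1%g w).
have IE : Im (uhp_val (p g^-1%g w)) = Im (uhp_val w) * expR (Re l).
  by rewrite -(Im_mobius w m) -mulrA [_ * expR _]mulrC E mulr1.
rewrite -mulrA mul_cconj !kern_diag -ofRM; congr ofR; rewrite IE jE cabs_cexp !ReImE mul0r subr0.
rewrite powRM ?expR_ge0// ?ltW ?uhp_val_gt0// -expRM -mulrA expr2 -!expRD.
have -> : Re l * - s + (s / 2 * Re l + s / 2 * Re l) = 0 by field.
by rewrite expR0 mulr1.
Qed.

(* The ratio of the two sides is an integral power of [exp (i pi s)], hence constant in [z]. *)
Lemma kern_jpow (A : R -> fspace R) s g z w : (forall s : R, 0 <= s -> is_rkhs (A s) (kern s)) -> 0 <= s ->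
  kern s (p g^-1%g z) (p g^-1%g w) * j s g z * cconj (j s g w) = kern s z w.
Proof.
move=> hA s0; set phi := p g^-1%g.
have hk w' : holomorphic (fun z => kern s z w').
  by case: (hA s s0) => _ h m _; exact: h (m w').
have [a [b m]] := cover_mobius g.
have hkp : holomorphic (fun z => kern s (phi z) (phi w)).
  have /holomorphicP h1 := hk (phi w); case: m => _ h2 _.
  exact: hd_holomorphic (fun z => hd_comp (h1 (phi z)) (h2 z)).
pose F z := kern s (phi z) (phi w) * j s g z * cconj (j s g w) * (kern s z w)^-1.
have cF : continuous F.
  apply: contM; last first.
    by apply: contV (holomorphic_continuous (hk w)) => x; exact: kern_neq0.
  apply: contM (fun x => cvg_cst _).
  exact: contM (holomorphic_continuous hkp) (jpow_slice s g).
pose q (n : int) : C := cexp (ofR (s / 2) * (ofR (2 * pi * n%:~R) * ci)).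
have hS x : range q (F x).
  have [l1 h1 e1] := jpow_log s g x; have [l2 h2 e2] := jpow_log s g w.
  rewrite (mobius_jac _ m) in h1; rewrite (mobius_jac _ m) in h2.
  pose al := clog (karg (phi x) (phi w)); pose be := clog (karg x w).
  (* The ratio [F x] is [cexp (s / 2 * X)], while [cexp X = 1] is the identity between [karg] and
     [q] squared. *)
  pose X := l1 + cconj l2 - (al + al) + (be + be).
  have EX : cexp X = 1.
    rewrite /X !cexpD cexpN !cexpD cexp_conj h1 h2 !clogK ?Re_karg_gt0// -(karg_mobius x w m).
    have k0 := karg_neq0 (phi x) (phi w); have [q0 _ _] := m.
    have := q0 x; have : cconj (mfactor a b w) != 0 by rewrite cconj_eq0.
    rewrite cconjV cconjX; move: (cconj _) (mfactor a b x) (karg _ _) k0 => u v k k0 u0 v0.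
    by field; rewrite u0 v0 k0.
  have [n nE] := cexp_eq1 EX; exists n => //.
  rewrite /q -nE /F e1 e2 !kernE !cpowE -cexp_conj -cexpN -!cexpD; congr cexp.
  rewrite -/al -/be cconjM cconj_ofR /X.
  have -> : ofR (s / 2) = ofR s / 2 :> C by rewrite ofRM ofRV (ofR_nat 2).
  by rewrite ofRN; field.
have := countable_range_uhp (countable_range_of q) cF hS z w.
have -> : F w = 1.
  rewrite /F /phi (kern_jpow_diag s g w); exact: (divff (kern_neq0 s w w)).
move=> E; have := congr1 (fun x => x * kern s z w) E.
rewrite /F (divfK (kern_neq0 s z w)) => ->; exact: mul1r.
Qed.

(** The branch is only given as continuous; [kern_jpow] with the second argument fixed expresses it
    as a quotient of holomorphic functions. *)
Lemma jpow_holomorphic (A : R -> fspace R) s g : (forall s : R, 0 <= s -> is_rkhs (A s) (kern s)) -> 0 <= s ->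
  holomorphic (j s g).
Proof.
move=> hA s0; pose w := uhp_i R; set phi := p g^-1%g.
have hk w' : holomorphic (fun z => kern s z w').
  by case: (hA s s0) => _ h m _; exact: h (m w').
have [a [b m]] := cover_mobius g.
have /holomorphicP h1 := hk (phi w); have [_ h2 _] := m; have /holomorphicP h3 := hk w.
have c0 : cconj (j s g w) != 0 by rewrite cconj_eq0 jpow_neq0.
have -> : j s g = fun z => (cconj (j s g w))^-1 * (kern s z w * (kern s (phi z) (phi w))^-1).
  apply/funext => z; rewrite -(kern_jpow g z w hA s0) -/phi.
  have := kern_neq0 s (phi z) (phi w); move: (kern _ _ _) (j s g z) (cconj _) c0 => k x y y0 k0.
  by field; rewrite y0 k0.
exact: (hd_holomorphic (fun z => hdZ (cconj (j s g w))^-1 (hdM (h3 z)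
  (hdV (f := fun z => kern s (phi z) (phi w)) (kern_neq0 s (phi z) (phi w)) (hd_comp (h1 (phi z)) (h2 z)))))).
Qed.

(** The Jacobian is [q ^ -2], so the ratio of the two sides has square 1; by continuity its sign
    does not depend on [z]. It records the lift [g] and the sign chosen for [q]. *)
Lemma jpow_neg (h : nat) g (a b : C) : mobius (p g^-1%g) a b -> exists2 e : C, e ^+ 2 = 1 &
  j (- h%:R) g = fun z => e * mfactor a b z ^+ h.
Proof.
move=> m; have [q0 hq _] := m.
have cq : continuous (mfactor a b : uhp R -> C).
  exact: holomorphic_continuous (hd_holomorphic (hd_mfactor a b)).
have cqn n : continuous (fun z => mfactor a b z ^+ n : C).
  exact: holomorphic_continuous (hd_holomorphic (fun z => hdX n (hd_mfactor a b z))).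
pose F z := j (- h%:R) g z * (mfactor a b z ^+ h)^-1.
have cF : continuous F.
  apply: contM (jpow_slice _ g) _; apply: contV (cqn h) => z; exact: expf_neq0.
have F2 z : F z ^+ 2 = 1.
  have [l lE jE] := jpow_log (- h%:R) g z; rewrite (mobius_jac z m) in lE.
  rewrite /F exprMn jE -cexpMn.
  have -> : (ofR (- h%:R / 2) * l) *+ 2 = - (l *+ h) :> C.
    have -> : ofR (- h%:R / 2) = - h%:R / 2 :> C by rewrite ofRM ofRV (ofR_nat 2) ofRN (ofR_nat h).
    by rewrite -mulr_natl -[l *+ h]mulr_natl; field.
  rewrite cexpN cexpMn lE exprVn invrK -exprM -exprVn -exprM mulnC exprVn divff//.
  exact: expf_neq0.
pose q (b : bool) : C := if b then 1 else -1.
have hS z : range q (F z).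
  by move/eqP: (F2 z); rewrite sqrf_eq1 => /orP[/eqP ->|/eqP ->]; [exists true|exists false].
exists (F (uhp_i R)) => //; apply/funext => z.
rewrite -(countable_range_uhp (countable_range_of q) cF hS z (uhp_i R)) /F divfK//.
exact: expf_neq0.
Qed.

Lemma Ucov_surj s g (h : hfun R) : holomorphic (j s g) -> holomorphic h ->
  exists2 f, holomorphic f & Ucov p (j s) g f = h.
Proof.
move=> /holomorphicP hjs /holomorphicP hh; have [/holomorphicP hg _] := cover_biholo g.
exists (fun z => h (p g z) * (j s g (p g z))^-1).
  exact: (hd_holomorphic (fun z => hdM (hd_comp (hh (p g z)) (hg z))
    (hdV (f := fun z => j s g (p g z)) (jpow_neq0 s g (p g z)) (hd_comp (hjs (p g z)) (hg z))))).
apply/funext => z; rewrite /Ucov (coverVK g z).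
by rewrite (divfK (jpow_neq0 s g z)).
Qed.

Lemma Ucov_inj s g (f h : hfun R) : Ucov p (j s) g f = Ucov p (j s) g h -> f = h.
Proof.
move=> E; apply/funext => z; have := congr1 (fun F : hfun R => F (p g z)) E.
by rewrite /Ucov coverKV => /(mulIf (jpow_neq0 _ _ _)).
Qed.

Lemma Ucov_deriv_action (A : R -> fspace R) s k : (forall s : R, 0 <= s -> is_rkhs (A s) (kern s)) ->
  admissible s k -> deriv_action k (Ucov p (j s)) (Ucov p (j (s + 2 * k%:R))).
Proof.
move=> hA [[s0 ->]|[h [-> ->]]] g; split; try exact: Ucov_inj.
- move=> f /holomorphicP hf; rewrite mulr0 addr0; split=> //.
  have /holomorphicP hjs := jpow_holomorphic (g := g) hA (ltW s0).
  have [/holomorphicP hg _] := cover_biholo g^-1%g.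
  exact: (hd_holomorphic (fun z => hdM (hd_comp (hf (p g^-1%g z)) (hg z)) (hjs z))).
- move=> u hu; exact: (Ucov_surj (jpow_holomorphic (g := g) hA (ltW s0)) hu).
- have [a [b m]] := cover_mobius g; have [e e2 jE] := jpow_neg h m.
  have [q0 hq _] := m; have e0 : e != 0 by apply: contra_eq_neq e2 => ->; rewrite expr0n eq_sym oner_neq0.
  move=> f hf; have hk := (holomorphicP f).1 hf.
  have hF : holomorphic (fun z => mfactor a b z ^+ h * f (p g^-1%g z)).
    exact: (hd_holomorphic (fun z => hdM (hdX h (hd_mfactor a b z)) (hd_comp (hk (p g^-1%g z)) (hq z)))).
  have UE : Ucov p (j (- h%:R)) g f = hscale e (fun z => mfactor a b z ^+ h * f (p g^-1%g z)).
    by apply/funext => z; rewrite /Ucov /hscale jE; ring.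
  have h0 : holomorphic (hzero : hfun R) := hd_holomorphic (hd_cst 0).
  rewrite UE hscaleE; split; first exact: hd_lincomb_holo.
  rewrite (iterD_lincomb h.+1 e hF h0) (bol h m hf).
  have -> : iter h.+1 D hzero = hzero.
    by have [] := @polys_iterD R h.+1 hzero; first by exists 0; [rewrite size_poly0|apply/funext => z; rewrite horner0].
  apply/funext => z; rewrite /lincomb /Ucov /hzero addr0.
  (* The branch of weight [2 + h] is recovered from its product with that of weight [- h], the
     Jacobian itself; so the same sign [e] occurs before and after differentiation. *)
  have -> : - h%:R + 2 * h.+1%:R = 2 + h%:R :> R by rewrite -natr1; ring.
  have J2 : j (2 + h%:R) g z * j (- h%:R) g z = mfactor a b z ^- 2.
    by rewrite jpow_add addrK jpow2 (mobius_jac z m).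
  rewrite jE in J2; have qz := q0 z; have qh := expf_neq0 h qz.
  have -> : j (2 + h%:R) g z = mfactor a b z ^- 2 / (e * mfactor a b z ^+ h).
    by rewrite -J2 mulfK// mulf_neq0.
  have eV : e^-1 = e by apply: (mulfI e0); rewrite divff// -e2 expr2.
  have -> : (e * mfactor a b z ^+ h)^-1 = e * (mfactor a b z ^+ h)^-1 by rewrite invfM eV.
  rewrite !exprS; move: (mfactor a b z) (iter _ _ _ _) qz qh => q x qz; set Q := q ^+ h => qh.
  by field; rewrite qz qh.
- have [a [b m]] := cover_mobius g; have [e e2 jE] := jpow_neg h m.
  have hol : holomorphic (j (- h%:R) g).
    by rewrite jE; exact: (hd_holomorphic (fun z => hdZ e (hdX h (hd_mfactor a b z)))).
  move=> u hu; exact: (Ucov_surj hol hu).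
Qed.

Lemma Ucov_isom (A : R -> fspace R) s g : (forall s : R, 0 <= s -> is_rkhs (A s) (kern s)) -> 0 <= s ->
  isom (A s) (A s) (Ucov p (j s) g).
Proof.
move=> hA s0; have [||m i] := @rkhs_covariant R (A s) (kern s) (p g^-1%g) (p g) (j s g)
  (hA s s0) (coverVK g) (coverKV g).
- by move=> z; exact: jpow_neq0.
- by move=> z w; exact: kern_jpow hA s0.
by split.
Qed.

End CoveringGroup.

(** * Rotations and the classification *)

Section Rotations.
Context {R : realType}.
Local Notation C := (cplx R).
Local Notation Re := (@complex.Re R).
Local Notation Im := (@complex.Im R).
Local Notation D := (@hderiv R).
Local Opaque cexp cpow.

(** The denominator for the rotation matrix of angle [t], which fixes [i]. In the disc it acts by
    the angle [2 t], so the action on points has period [pi]. *)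
Definition rotq (t : R) : hfun R := mfactor (ofR (- sin t)) (ofR (cos t)).

Lemma rotq_neq0 t z : rotq t z != 0.
Proof.
apply/eqP => q0; have y0 := uhp_val_gt0 z.
have := congr1 Im q0; rewrite /rotq /mfactor !ReImE mul0r !addr0 => /eqP.
rewrite mulf_eq0 oppr_eq0 (gt_eqF y0) orbF => /eqP s0.
have := congr1 Re q0; rewrite /rotq /mfactor s0 !ReImE oppr0 !mul0r subr0 add0r => c0.
by have := cos2Dsin2 t; rewrite s0 c0 expr0n addr0 => /eqP; rewrite eq_sym oner_eq0.
Qed.

Lemma rot_subproof (t : R) (z : uhp R) : 0 < Im ((ofR (cos t) * uhp_val z + ofR (sin t)) / rotq t z).
Proof.
have q0 := rotq_neq0 t z; have N0 : 0 < (cabs (rotq t z))^-1 ^+ 2 by rewrite exprn_gt0// invr_gt0 cabs_gt0.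
have -> : (ofR (cos t) * uhp_val z + ofR (sin t)) / rotq t z =
    (ofR (cos t) * uhp_val z + ofR (sin t)) * cconj (rotq t z) * ofR ((cabs (rotq t z))^-1 ^+ 2).
  have q1 : cconj (rotq t z) != 0 by rewrite cconj_eq0.
  rewrite exprVn ofRV -mul_cconj; move: (ofR (cos t) * _ + _) => x.
  move: (cconj (rotq t z)) q1 => y y0; move: (rotq t z) q0 => u u0.
  by field; rewrite u0 y0.
rewrite ImM Re_ofR Im_ofR mulr0 add0r.
suff -> : Im ((ofR (cos t) * uhp_val z + ofR (sin t)) * cconj (rotq t z)) = Im (uhp_val z).
  by rewrite mulr_gt0 ?uhp_val_gt0.
rewrite /rotq /mfactor !ReImE.
transitivity ((cos t ^+ 2 + sin t ^+ 2) * Im (uhp_val z)); first by ring.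
by rewrite cos2Dsin2 mul1r.
Qed.

Definition rot t z : uhp R := to_uhp (rot_subproof t z).

Lemma rotE t z : uhp_val (rot t z) = (ofR (cos t) * uhp_val z + ofR (sin t)) / rotq t z.
Proof. by []. Qed.

Lemma cs1 t : ofR (cos t) * ofR (cos t) + ofR (sin t) * ofR (sin t) = 1 :> C.
Proof. by rewrite -!ofRM -ofRD -!expr2 cos2Dsin2. Qed.

Lemma hd_rot t z : hd (fun z => uhp_val (rot t z)) z (rotq t z ^- 2).
Proof.
have q0 := rotq_neq0 t z.
have := hdM (hd_mfactor (ofR (cos t)) (ofR (sin t)) z) (hdV q0 (hd_mfactor _ _ z)).
move/hd_eq; apply.
transitivity ((ofR (cos t) * ofR (cos t) + ofR (sin t) * ofR (sin t)) / rotq t z ^+ 2 : C).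
  move: q0; rewrite ofRN /rotq /mfactor ofRN.
  move: (ofR (cos t)) (ofR (sin t)) (uhp_val z) => c s x q0; by field.
by rewrite cs1 div1r.
Qed.

Definition eit (t : R) : C := cexp (ofR t * ci).

Lemma eitE t : eit t = ofR (cos t) + ci * ofR (sin t).
Proof.
apply: cplx_eq; rewrite /eit ?Re_cexp ?Im_cexp !ReImE !(mulr0, mul0r, subr0, addr0, add0r, mulr1, mul1r, expR0);
by rewrite ?oppr0 ?addr0 ?expR0 ?mul1r.
Qed.

Lemma eitD s t : eit (s + t) = eit s * eit t.
Proof. by rewrite /eit ofRD mulrDl cexpD. Qed.

Lemma eit0 : eit 0 = 1.
Proof. by rewrite /eit ofR0 mul0r cexp0. Qed.

Lemma eit_neq0 t : eit t != 0.
Proof. exact: cexp_neq0. Qed.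

Lemma cayley_rot t z : cayley (rot t z) = eit (2 * t) * cayley z.
Proof.
have q0 := rotq_neq0 t z; have p0 := addi_neq0 (rot t z); have z0 := addi_neq0 z.
have -> : 2 * t = t + t by ring.
rewrite eitD; rewrite /cayley mulrA; apply/eqP; rewrite eqr_div//; apply/eqP.
rewrite rotE; apply: (mulfI q0).
transitivity ((ofR (cos t) * uhp_val z + ofR (sin t) - ci * rotq t z) * (uhp_val z + ci)).
  by move: (rotq t z) q0 => q q0; field.
transitivity (eit t * eit t * (uhp_val z - ci) * (ofR (cos t) * uhp_val z + ofR (sin t) + ci * rotq t z)); last first.
  by move: (rotq t z) q0 => q q0; field.
rewrite !eitE /rotq /mfactor ofRN; have cs := cs1 t; have i2 := @ciM R.
move: (ofR (cos t)) (ofR (sin t)) (uhp_val z) cs => c s x cs.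
have E1 : c * x + s - ci * (- s * x + c) = (c + ci * s) * (x - ci).
  apply/eqP; rewrite -subr_eq0; apply/eqP.
  by transitivity (s * (1 + ci * ci)); [ring|rewrite i2 subrr mulr0].
have E2 : c * x + s + ci * (- s * x + c) = (c - ci * s) * (x + ci).
  apply/eqP; rewrite -subr_eq0; apply/eqP.
  by transitivity (s * (1 + ci * ci)); [ring|rewrite i2 subrr mulr0].
have E3 : (c + ci * s) * (c - ci * s) = 1.
  by rewrite -cs; apply/eqP; rewrite -subr_eq0; apply/eqP;
    transitivity (- (s * s) * (1 + ci * ci)); [ring|rewrite i2 subrr mulr0].
rewrite E1 E2.
transitivity ((c + ci * s) * ((c + ci * s) * (c - ci * s)) * (x - ci) * (x + ci)); last by ring.
by rewrite E3 mulr1.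
Qed.

Lemma rot_comp s t z : rot s (rot t z) = rot (s + t) z.
Proof. by apply: cayley_inj; rewrite !cayley_rot mulrA -eitD -mulrDr. Qed.

Lemma rot0 z : rot 0 z = z.
Proof. by apply: cayley_inj; rewrite cayley_rot mulr0 eit0 mul1r. Qed.

Lemma eit_pi : eit pi = -1.
Proof. by rewrite eitE cospi sinpi ofR0 mulr0 addr0 ofRN ofR1. Qed.

Lemma rot_pi z : rot pi z = z.
Proof.
apply: cayley_inj; rewrite cayley_rot; have -> : 2 * pi = pi + pi :> R by ring.
by rewrite eitD eit_pi mulrNN mulr1 mul1r.
Qed.

Lemma rot_i t : rot t (uhp_i R) = uhp_i R.
Proof. by apply: cayley_inj; rewrite cayley_rot cayley_i mulr0. Qed.

Lemma rotq_i t : rotq t (uhp_i R) * eit t = 1.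
Proof.
rewrite eitE /rotq /mfactor uhp_val_i -(cs1 t) ofRN; move: (ofR (cos t)) (ofR (sin t)) => c s.
apply/eqP; rewrite -subr_eq0; apply/eqP.
by transitivity (- (s * s) * (1 + ci * ci)); [ring|rewrite ciM subrr mulr0].
Qed.

Lemma jac_rot_i t : jac (rot t) (uhp_i R) = eit (2 * t).
Proof.
rewrite /jac (hd_hderiv (hd_rot t (uhp_i R))); have q0 := rotq_neq0 t (uhp_i R).
have -> : 2 * t = t + t by ring.
rewrite eitD; have -> : eit t = (rotq t (uhp_i R))^-1.
  by apply: (mulfI q0); rewrite rotq_i divff.
by rewrite -invfM expr2.
Qed.

Lemma biholomorphism_rot t : biholomorphism (rot t).
Proof.
have h s : holomorphic (fun z => uhp_val (rot s z)) := hd_holomorphic (hd_rot s).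
split; first exact: h.
exists (rot (- t)); split; last exact: h.
- by move=> z; rewrite rot_comp addNr rot0.
- by move=> z; rewrite rot_comp addrN rot0.
Qed.

Lemma rd_rot t z : rd (fun s => uhp_val (rot s z)) t (1 + uhp_val (rot t z) ^+ 2).
Proof.
have dc : rd (fun s => ofR (cos s)) t (- ofR (sin t)).
  by rewrite -ofRN; split; [exact: is_derive_cos|exact: is_derive_cst].
have ds : rd (fun s => ofR (sin s)) t (ofR (cos t)).
  by split; [exact: is_derive_sin|exact: is_derive_cst].
have dU := rdD (rdZ (uhp_val z) dc) ds; have dV := rdD (rdZ (- uhp_val z) ds) dc.
have q0 := rotq_neq0 t z.
have qE s : rotq s z = - uhp_val z * ofR (sin s) + ofR (cos s) by rewrite /rotq /mfactor ofRN; ring.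
have v0 : - uhp_val z * ofR (sin t) + ofR (cos t) != 0 by rewrite -qE.
have did (x : C) : is_derive x 1 (fun w : C => w) 1 by exact: is_derive_id.
have dI := rd_comp (g := fun s => - uhp_val z * ofR (sin s) + ofR (cos s))
  (is_derive_invC (f := fun w : C => w) v0 (did _)) dV.
have := rdM dU dI.
have -> : (fun s => (uhp_val z * ofR (cos s) + ofR (sin s)) * (- uhp_val z * ofR (sin s) + ofR (cos s))^-1) =
    (fun s => uhp_val (rot s z)).
  by apply/funext => s; rewrite rotE qE [ofR (cos s) * _]mulrC.
move/rd_eq; apply; rewrite rotE qE; move: v0.
by move: (uhp_val z) (ofR (sin t)) (ofR (cos t)) => x s c v0 /=; field.
Qed.

Lemma rd_eit d t : rd (fun s => eit (d * s)) t (eit (d * t) * (ofR d * ci)).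
Proof.
have h := rd_affine 0 (ofR d * ci) t.
have := rd_comp (F := @cexp R) (g := fun s => 0 + ofR d * ci * ofR s) (is_derive_cexp _) h.
have E s : cexp (0 + ofR d * ci * ofR s) = eit (d * s) by rewrite /eit ofRM add0r mulrAC.
by rewrite E; congr rd; apply/funext => s; exact: E.
Qed.

(* The continuity of [t |-> h (rot t z0)] forces [n = 0]; at [t = pi] this makes [d] an even integer,
   and for [d < 0] the function [h * cayley^(-d/2)] is rotation invariant, hence constant, and it
   vanishes at [i]. *)
Lemma rotation_weight_ge0 (h : hfun R) (d : R) z0 : holomorphic h -> h z0 != 0 ->
  (forall t, exists n : int, forall z, h (rot t z) = eit (d * t + d * pi * n%:~R) * h z) -> 0 <= d.
Proof.
move=> /holomorphicP hh h0 hw.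
(* With the expected weight removed, [F] only takes values in the countable range of [q], and
   [F 0 = 1]. *)
pose F t := h (rot t z0) * (h z0)^-1 * eit (- d * t).
have cF t : ccont F t.
  apply: ccontM; last exact: rd_ccont (rd_eit (- d) t).
  have := rdZ (h z0)^-1 (rd_hd (g := fun s => rot s z0) (hh (rot t z0)) (rd_rot t z0)).
  by move=> /rd_ccont; congr ccont; apply/funext => s; rewrite mulrC.
pose q (n : int) := eit (d * pi * n%:~R).
have hS t : range q (F t).
  have [n hn] := hw t; exists n => //.
  rewrite /F hn mulfK// -eitD /q; congr eit; ring.
have F1 t : F t = 1.
  rewrite (countable_range_ccont (countable_range_of q) cF hS t) /F rot0 mulr0 eit0 divff//.
  exact: mulr1.
have W t z : h (rot t z) = eit (d * t) * h z.
  have E : h (rot t z0) = eit (d * t) * h z0.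
    have := congr1 (fun x => x * eit (d * t) * h z0) (F1 t).
    rewrite /F -[_ * _ * eit (d * t)]mulrA -eitD mulNr addNr eit0 mulr1 divfK// => ->.
    by rewrite mul1r.
  have [n hn] := hw t; rewrite hn; congr (_ * _).
  by apply: (mulIf h0); rewrite -hn.
have [n dn] : exists n : int, d = 2 * n%:~R.
  have /cexp_eq1[n] : cexp (ofR (d * pi) * ci) = 1.
    by apply: (mulIf h0); rewrite -/(eit (d * pi)) -W rot_pi mul1r.
  move=> /(mulIf (@ci_neq0 R))/(@ofR_inj R) E; exists n.
  have p0 : (pi : R) != 0 by rewrite gt_eqF// pi_gt0.
  by apply: (mulIf p0); rewrite E; ring.
rewrite leNgt; apply/negP => d0.
pose m := `|n|%N.
have dm : d = - (2 * m%:R).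
  have n0 : n < 0 by move: d0; rewrite dn pmulr_rlt0// ltrz0.
  by rewrite dn -mulrN; congr (_ * _); rewrite /m natr_absz ltr0_norm// mulrNz opprK.
have m0 : (0 < m)%N by rewrite lt0n; apply/eqP => m0; move: d0; rewrite dm m0 mulr0 oppr0 ltxx.
(* The rotation with [t = pi / (2 m)] fixes [i] while its weight is [eit (- pi) = -1]. *)
have hi : h (uhp_i R) = 0.
  have := W (pi / (2 * m%:R)) (uhp_i R); rewrite rot_i.
  have -> : d * (pi / (2 * m%:R)) = - pi.
    by rewrite dm; field; rewrite pnatr_eq0 -lt0n.
  have -> : eit (- pi) = -1.
    apply: (mulIf (eit_neq0 pi)); rewrite -eitD addNr eit0 eit_pi.
    by rewrite mulrNN mulr1.
  move=> E; apply/eqP; have : 2 * h (uhp_i R) = 0.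
    by rewrite mulr_natl mulr2n {1}E mulN1r addNr.
  by move/eqP; rewrite mulf_eq0 pnatr_eq0.
pose H z := h z * cayley z ^+ m.
have HW t z : H (rot t z) = H z.
  rewrite /H W cayley_rot exprMn mulrACA.
  have -> : eit (2 * t) ^+ m = eit (2 * m%:R * t).
    rewrite /eit -cexpMn; congr cexp; rewrite -mulr_natl !ofRM (ofR_nat m) (ofR_nat 2); ring.
  by rewrite -eitD dm mulNr addNr eit0 mul1r.
pose l z := D h z * cayley z ^+ m + h z * (m%:R * cayley z ^+ m.-1 * (2 * ci / (uhp_val z + ci) ^+ 2)).
have hH z : hd H z (l z) := hdM (hh z) (hdX m (hd_cayley z)).
have l0 z : l z = 0.
  (* Away from [i] the orbit under rotations has the nonzero velocity [1 + z ^ 2], along which [H]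
     is constant. At [i] the orbit stands still; there the half-turn of the disc, with derivative
     -1, gives [l = - l]. *)
  have [->|zi] := pselect (z = uhp_i R).
    have := hd_comp (phi := rot (pi / 2)) (hH (rot (pi / 2) (uhp_i R))) (hd_rot (pi / 2) (uhp_i R)).
    have -> : (fun w => H (rot (pi / 2) w)) = H by apply/funext => w; exact: HW.
    move=> /(hd_unique (hH (uhp_i R))); rewrite rot_i => E.
    have J : rotq (pi / 2) (uhp_i R) ^- 2 = -1.
      have := jac_rot_i (pi / 2); rewrite /jac (hd_hderiv (hd_rot _ _)) => ->.
      have -> : 2 * (pi / 2) = pi :> R by field.
      exact: eit_pi.
    rewrite J mulrN mulr1 in E; apply/eqP; have : 2 * l (uhp_i R) = 0.
      by rewrite mulr_natl mulr2n {1}E addNr.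
    by move/eqP; rewrite mulf_eq0 pnatr_eq0.
  have := hH z; rewrite -{1}(rot0 z) => hz.
  have := rd_hd (g := fun s => rot s z) hz (rd_rot 0 z).
  have -> : (fun s => H (rot s z)) = (fun=> H z) by apply/funext => s; exact: HW.
  move=> /(rd_unique (rd_cst (H z) 0)) /esym /eqP; rewrite rot0 mulf_eq0 => /orP[/eqP //|/eqP e].
  have : (uhp_val z - ci) * (uhp_val z + ci) = 0.
    by rewrite -e -(opprK (1 : C)) -(@ciM R); ring.
  move/eqP; rewrite mulf_eq0 (negPf (addi_neq0 z)) orbF subr_eq0 => /eqP e'.
  by case: zi; apply: uhp_val_inj.
have H0 z : H z = 0.
  have hH0 w : hd H w 0 by rewrite -(l0 w).
  by rewrite (hd_zero_cst hH0 z (uhp_i R)) /H hi mul0r.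
have := H0 z0; rewrite /H => /eqP; rewrite mulf_eq0 (negPf h0) /= expf_eq0 m0 /= => /eqP c0.
have z0i : z0 = uhp_i R by apply: cayley_inj; rewrite cayley_i.
by move: h0; rewrite z0i hi eqxx.
Qed.

End Rotations.

(** * Which representations of the covering group are equivalent *)

Section Classification.
Context {R : realType}.
Local Notation C := (cplx R).
Local Opaque cexp cpow.
Context (A : R -> fspace R) (hA : forall s : R, 0 <= s -> is_rkhs (A s) (kern s)).
Context (G : topGroupType) (p : G -> uhp R -> uhp R) (hp : universal_covering_Aut p).
Context (j : R -> G -> uhp R -> cplx R) (hj : forall s : R, is_Jpow p s (j s)).

Lemma kern_ii (s : R) : kern s (uhp_i R) (uhp_i R) = 1.
Proof. by rewrite kern_diag /= powR1 ofR1. Qed.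

(** The kernel at [i] is an eigenvector of every lift of an automorphism fixing [i]; the eigenvalue
    is the multiplier at [i]. *)
Lemma skern_fixed s g z : 0 <= s -> p g^-1%g (uhp_i R) = uhp_i R ->
  skern s (uhp_i R) (p g^-1%g z) * j s g z = j s g (uhp_i R) * skern s (uhp_i R) z.
Proof.
move=> s0 fi; have := kern_jpow hp hj g z (uhp_i R) hA s0.
have := kern_jpow hp hj g (uhp_i R) (uhp_i R) hA s0.
rewrite fi kern_ii mul1r /skern => E <-.
by rewrite mulrCA E mulr1.
Qed.

Lemma intertwined_le s s' : 0 < s -> 0 < s' ->
  intertwined (A s) (Ucov p (j s)) (A s') (Ucov p (j s')) -> s' <= s.
Proof.
move=> s0 s'0 [S [iS _ cS]]; pose i := uhp_i R.
have hK := hA (ltW s0); have hK' := hA (ltW s'0).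
have mk : A s (skern s i) := rkhs_kernel hK i.
pose v := S (skern s i); have mv : A s' v := iS.1 _ mk.
have k0 z : skern s' i z != 0 := kern_neq0 s' z i.
have [z0 v0] : exists z, v z != 0.
  apply: contrapT => /forallNP v0.
  have vz : v = hzero.
    by apply/funext => z; apply/eqP; apply: contraT => vz; case: (v0 z).
  have := iS.2 _ _ mk mk; rewrite -/v vz (ip_0l (rkhs_hilbert hK') (mem_hzero (rkhs_hilbert hK'))).
  by rewrite (rkhs_gram hK) kern_ii => /eqP; rewrite eq_sym oner_eq0.
rewrite -subr_ge0.
have hv : holomorphic v by case: hK' => _ h _ _; exact: h.
have hk : holomorphic (skern s' i) by case: hK' => _ h m _; exact: h (m i).
have /holomorphicP hv' := hv; have /holomorphicP hk' := hk.
apply: (@rotation_weight_ge0 R (fun z => v z * (skern s' i z)^-1) (s - s') z0).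
- exact: (hd_holomorphic (fun z => hdM (hv' z) (hdV (f := skern s' i) (k0 z) (hk' z)))).
- by rewrite mulf_neq0// invr_eq0.
move=> t; have [g gE] := cover_surj hp (biholomorphism_rot t).
have fi : p g^-1%g i = i by rewrite gE rot_i.
have [l lE jE] := jpow_log hj (s - s') g i.
(* The lift [g] of the rotation is arbitrary, so the logarithm of the Jacobian is [2 t i] only up to
   [2 pi n i]; this is the integer that [rotation_weight_ge0] tolerates. *)
rewrite gE jac_rot_i in lE; have [n nE] := cexp_eq lE.
exists n => z.
(* The intertwiner keeps the eigenvalue of weight [s], now for the action of weight [s']. Dividing
   by the kernel of [A s'], whose eigenvalue has weight [s'], leaves the weight [s - s']. *)
have Ev : v (p g^-1%g z) * j s' g z = j s g i * v z.
  have := cS g _ mk; have -> : Ucov p (j s) g (skern s i) = hscale (j s g i) (skern s i).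
    by apply/funext => w; exact: (skern_fixed w (ltW s0) fi).
  rewrite (isom_scale _ (rkhs_hilbert hK) (rkhs_hilbert hK') iS mk) => /(congr1 (fun F : hfun R => F z)).
  by move=> /esym.
have Ek := skern_fixed z (ltW s'0) fi.
have Ej : j s g i = j (s - s') g i * j s' g i by rewrite (jpow_add hp hj) subrK.
have je : j (s - s') g i = eit ((s - s') * t + (s - s') * pi * n%:~R).
  rewrite jE nE /eit; congr cexp; rewrite mulrDr !mulrA -!ofRM -mulrDl -ofRD.
  by congr (ofR _ * _); field.
rewrite -je -gE.
have j0 := jpow_neq0 hj s' g z; have ji := jpow_neq0 hj s' g i.
rewrite Ej in Ev.
have -> : v (p g^-1%g z) = j (s - s') g i * j s' g i * v z / j s' g z by rewrite -Ev mulfK.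
have -> : skern s' i (p g^-1%g z) = j s' g i * skern s' i z / j s' g z by rewrite -Ek mulfK.
move: (skern s' i z) (k0 z) => k kn; move: (j s' g z) (j s' g i) (j _ _ _) j0 ji => a b c a0 b0.
by field; rewrite a0 b0 kn.
Qed.

Lemma intertwined_eq s s' : 0 < s -> 0 < s' ->
  intertwined (A s) (Ucov p (j s)) (A s') (Ucov p (j s')) -> s = s'.
Proof.
move=> s0 s'0 h; apply/eqP; rewrite eq_le (intertwined_le s0 s'0 h) andbT.
apply: (intertwined_le s'0 s0); apply: intertwined_sym h.
- exact: rkhs_hilbert (hA (ltW s0)).
- exact: rkhs_hilbert (hA (ltW s'0)).
by move=> g f; exact: (Ucov_isom hp hj g hA (ltW s0)).1.
Qed.

Lemma admissible_gt0 (s : R) k : admissible s k -> 0 < s + 2 * k%:R.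
Proof.
case=> [[s0 ->]|[h [-> ->]]]; first by rewrite mulr0 addr0.
by rewrite -natr1; have := ler0n R h; lra.
Qed.

Lemma covering_equivalence s s' k k' : admissible s k -> admissible s' k' ->
  unitarily_equivalent k (Ask A s k) (Ucov p (j s)) k' (Ask A s' k') (Ucov p (j s'))
  <-> s + 2 * k%:R = s' + 2 * k'%:R.
Proof.
move=> a a'; have s0 := admissible_gt0 a; have s'0 := admissible_gt0 a'.
have d := Ucov_deriv_action hp hj hA a; have d' := Ucov_deriv_action hp hj hA a'.
split=> [/(intertwined_of_equivalent hA (ltW s0) (ltW s'0) d d')|E].
  exact: intertwined_eq.
apply: (equivalent_of_intertwined hA (ltW s0) (ltW s'0) d d').
by rewrite E; exact: intertwined_refl.
Qed.

(** The invariant [s + 2k] is [s] in the first family and [h + 2] in the second. Across the families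
    [s = s'] is impossible by sign, and the only alternative left is the one that expresses the
    equality of invariants. *)
Lemma admissible_eq (s s' : R) k k' : admissible s k -> admissible s' k' ->
  s + 2 * k%:R = s' + 2 * k'%:R <-> (s = s' \/ s' = s + 2 * k%:R \/ s = s' + 2 * k'%:R).
Proof.
case=> [[s0 ->]|[h [-> ->]]] [[s'0 ->]|[h' [-> ->]]].
- rewrite !mulr0 !addr0; split=> [->|[->|[->|->]]] //; by left.
- have n0 := ler0n R h'; rewrite !mulr0 !addr0; split=> [->|[e|[e|->//]]]; first by right; right.
    by move: s0; rewrite e; move: n0; lra.
  by move: s0; rewrite -e; move: n0; lra.
- have n0 := ler0n R h; rewrite !mulr0 !addr0; split=> [<-|[e|[->//|e]]]; first by right; left.
    by move: s'0; rewrite -e; move: n0; lra.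
  by move: s'0; rewrite -e; move: n0; lra.
- have n0 := ler0n R h; have n0' := ler0n R h'; rewrite -!natr1; split=> [e|].
    by left; move: e; move: (h%:R) (h'%:R) => a b; lra.
  move: (h%:R) (h'%:R) n0 n0' => a b n0 n0' [e|[e|e]]; move: e n0 n0'; lra.
Qed.

End Classification.

Theorem mainTheorem16 (R : realType) (A : R -> fspace R)
    (hA : forall s : R, 0 <= s -> is_rkhs (A s) (kern s)) :
  (forall (s s' : R) (k k' : nat),
     0 < s + 2 * k%:R -> 0 < s' + 2 * k'%:R ->
     unitarily_equivalent k (Ask A s k) (Uaff s) k' (Ask A s' k') (Uaff s'))
  /\
  (forall (G : topGroupType) (p : G -> uhp R -> uhp R),
     universal_covering_Aut p ->
   forall j : R -> G -> uhp R -> cplx R,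
     (forall s : R, is_Jpow p s (j s)) ->
   forall (s s' : R) (k k' : nat),
     admissible s k -> admissible s' k' ->
     (unitarily_equivalent k (Ask A s k) (Ucov p (j s))
                           k' (Ask A s' k') (Ucov p (j s'))
      <-> (s = s' \/ s' = s + 2 * k%:R \/ s = s' + 2 * k'%:R))).
Proof.
split=> [s s' k k' s0 s'0|G p hp j hj s s' k k' a a']; first exact: affine_equivalence.
exact: iff_trans (covering_equivalence hA hp hj a a') (admissible_eq a a').
Qed.
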